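(* Let $N$ be a Poisson random measure on the Polish space $\mathscr{V}$ with mean intensity $\nu$, and let $X_1,\ldots,X_n$, $\tau_i=N(h_i)$, $\gamma_i=N(g_i)$, $\psi_1,\psi_2$, $A_i=X_i-\mu\Delta$ be as specified in the context. For $(y_1,\ldots,y_n)\in\mathbb{R}^n$ and $x\in\mathscr{V}$, with $\xi=\sqrt{-1}$, define $$\Omega_n(x)=\sum_{i=1}^n\Big[\psi_1(\beta+\xi y_i)+\tfrac{\beta^2+y_i^2}{2}\Big]h_i(x),$$ $$\Upsilon_n(x)=\sum_{i=1}^n\Big[\psi_2(\beta+\xi y_i)+\rho(\beta+\xi y_i)+\tfrac{\beta^2+y_i^2}{2}\Big]g_i(x).$$ Suppose that the $\tau_i$ and $\gamma_i$ (i.e. the functions $h_i,g_i$) are chosen such that $\Lambda(\Omega_n+\Upsilon_n)<\infty$, where $\Lambda(f)=\int_{\mathscr{V}}(1-e^{-f(x)})\,\nu(dx)$; as $\Omega_n+\Upsilon_n$ is complex valued, this means that this integral is well defined and finite, for all $(y_1,\ldots,y_n)\in\mathbb{R}^n$. Then the joint marginal density (likelihood) of $(X_1,\ldots,X_n)$ given $(\mu,\beta,\theta,\rho)$ is $$\mathscr{L}(X_1,\ldots,X_n\mid\mu,\beta,\theta,\rho)=\frac{e^{n\bar A\beta}}{(2\pi)^n}\int_{\mathbb{R}^n}e^{-\Lambda(\Omega_n+\Upsilon_n)}\prod_{i=1}^n e^{\xi A_i y_i}\,dy_i,\qquad \bar A=\frac1n\sum_{i=1}^n A_i .$$ Moreover,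 the result also applies when the random measure $N$ is not necessarily Poisson, upon replacing $e^{-\Lambda(\Omega_n+\Upsilon_n)}$ by $\mathbb{E}[e^{-N(\Omega_n+\Upsilon_n)}]$.
   Context: Notation and model. (1) $\mathscr{V}$ is a Polish space, $N$ is a random measure on $\mathscr{V}$ (taking values in the boundedly finite measures), and $N(f)=\int_{\mathscr{V}}f(x)\,N(dx)$. When $N$ is Poisson with mean intensity $\nu$, i.e. $\mathbb{E}[N(dx)]=\nu(dx)$, its Laplace functional is $\mathbb{E}[e^{-N(f)}]=e^{-\Lambda(f)}$ for positive $f$, with $\Lambda(f)=\int_{\mathscr{V}}(1-e^{-f(x)})\,\nu(dx)$; the same expression defines $\Lambda(f)$ for complex-valued $f$. (2) $n\ge 1$ is an integer, $\Delta>0$, and $h_1,\ldots,h_n,g_1,\ldots,g_n$ are positive measurable functions on $\mathscr{V}$. Set $\tau_i=N(h_i)$, $\gamma_i=N(g_i)$ and $\tau_i^*=\tau_i+\gamma_i=N(h_i+g_i)$; it is understood that $0<\tau_i^*<\infty$ almost surely, so that the conditional Normal densities below make sense. (3) $J_1,J_2$ are independent real-valued pure jump Lévy processes, independent of $N$. For $j=1,2$ the function $\psi_j$ is given by the Lévy–Khinchine formula through $\mathbb{E}[e^{-\omega[J_j(t)-J_j(s)]}]=e^{-(t-s)\psi_j(\omega)}$ for $s\le t$ and real or complex $\omega$ (in particular for $\omega=\beta+\xi y$, $y\in\mathbb{R}$). The variables $J_{i,1}$ and $J_{i,2}$, $i=1,\ldots,n$, are the increments of $J_1$ and $J_2$ over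 the successive time-changed intervals, of lengths $\tau_i$ and $\gamma_i$ respectively. Thus the families $(J_{i,1})_i$ and $(J_{i,2})_i$ are conditionally independent given $N$, and for real or complex numbers $\omega_1,\ldots,\omega_n$ (in particular for $\omega_i=\beta+\xi y_i$ with $y_i\in\mathbb{R}$ and $\xi=\sqrt{-1}$), $$\mathbb{E}\Big[\prod_{i=1}^n e^{-\omega_iJ_{i,1}}\,\Big|\,N\Big]=\prod_{i=1}^n e^{-\tau_i\psi_1(\omega_i)},\qquad \mathbb{E}\Big[\prod_{i=1}^n e^{-\omega_iJ_{i,2}}\,\Big|\,N\Big]=\prod_{i=1}^n e^{-\gamma_i\psi_2(\omega_i)}.$$ (4) $r,q,\alpha,\beta$ are real parameters, $\mu=r-q$, $\rho=\alpha-\beta$, and $\theta$ is a Euclidean parameter on which the laws of $J_1,J_2,\tau,\gamma$ (that is, $\nu$, $h_i$, $g_i$, $\psi_1$, $\psi_2$) may depend. The aggregate returns are $$X_i=\mu\Delta+J_{i,1}+J_{i,2}+\beta\tau_i^*+\rho\gamma_i+\sqrt{\tau_i^*}\,\epsilon_i,\qquad i=1,\ldots,n,$$ where $\epsilon_1,\ldots,\epsilon_n$ are independent standard Normal variables, independent of $(N,J_1,J_2)$. Hence, conditionally on $(\tau_i,\gamma_i,J_{i,1},J_{i,2})_{i\le n}$ and the parameters, the $X_i$ are independent, and with $A_i=X_i-\mu\Delta$ the conditional density of $X_i$ is $$e^{(A_i-J_{i,1}-J_{i,2}-\rho\gamma_i)\beta}\,\frac{1}{\sqrt{2\pi}}\,\frac{1}{\sqrt{\tau_i^*}}\,e^{-(A_i-J_{i,1}-J_{i,2}-\rho\gamma_i)^2/(2\tau_i^*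 )}\,e^{-\tau_i^*\beta^2/2}.$$ The joint marginal density of $(X_1,\ldots,X_n)$ is obtained by integrating the product over $i$ of these conditional densities over the joint law of $(N,J_1,J_2)$. In the displayed likelihood, the dependence on the data is through $A_i=X_i-\mu\Delta$.
   Formalization: Finiteness of Λ(Ω_n+Υ_n) does not make the integral over R^n exist (e.g. variance gamma, shape ≤ 1/2). The formula is proved a.e. when e^{-Λ} (or E[e^{-N(Ω_n+Υ_n)}]) is integrable, and always with the integral as limit of its Gaussian-damped versions in weighted L^1. *)

(* Defs.v *)
From HB Require Import structures.
From mathcomp Require Import all_boot all_order all_algebra.
From mathcomp Require Import complex.
From mathcomp Require Import all_classical all_reals all_analysis.
From mathcomp Require Import measurable_realfun.
Set Implicit Arguments.
Unset Strict Implicit.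
Unset Printing Implicit Defensive.
Import Order.TTheory GRing.Theory Num.Theory.
Import numFieldNormedType.Exports.
Local Open Scope classical_set_scope.
Local Open Scope complex_scope.
Local Open Scope ring_scope.

Notation Rn R n := (n.-tuple (measurableTypeR R)).

Section lebesgue_rn.
Variable R : realType.
Local Notation Rn n := (Rn R n).

Section step.
Variable n : nat.

Definition rn_cons (p : measurableTypeR R * Rn n) : Rn n.+1 :=
  [tuple of p.1 :: p.2].

Let measurable_rn_cons : measurable_fun [set: _] rn_cons.
Proof. exact: measurable_cons. Qed.

Variable m : {sigma_finite_measure set (Rn n) -> \bar R}.
Definition lebesgue_step : set (Rn n.+1) -> \bar R :=
  pushforward (@lebesgue_measure R \x m)%E rn_cons.

Let step0 : lebesgue_step set0 = 0%E.
Proof. by rewrite /lebesgue_step /pushforward preimage_set0 measure0. Qed.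

Let step_ge0 A : (0 <= lebesgue_step A)%E.
Proof. exact: measure_ge0. Qed.

Let step_sigma_additive : semi_sigma_additive lebesgue_step.
Proof.
move=> F mF tF mUF; rewrite /lebesgue_step /pushforward preimage_bigcup.
apply: measure_semi_sigma_additive.
- by move=> k; rewrite -[X in measurable X]setTI; exact: measurable_rn_cons.
- apply/trivIsetP => /= i j _ _ ij; rewrite -preimage_setI.
  by move/trivIsetP : tF => /(_ _ _ _ _ ij) ->//; rewrite preimage_set0.
- by rewrite -preimage_bigcup -[X in measurable X]setTI;
    exact: measurable_rn_cons.
Qed.

HB.instance Definition _ := isMeasure.Build _ _ _ lebesgue_step
  step0 step_ge0 step_sigma_additive.

Let step_sigma_finite : sigma_finite setT lebesgue_step.
Proof.
have /sigma_finiteP[F [TF ndF Foo]] := sigma_finiteT (@lebesgue_measure R).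
have /sigma_finiteP[G [TG ndG Goo]] := sigma_finiteT m.
pose split (t : Rn n.+1) : measurableTypeR R * Rn n :=
  (tnth t ord0, [tuple of behead t]).
have splitK : cancel rn_cons split.
  by move=> [x t]; congr pair => //; apply: val_inj.
have msplit : measurable_fun [set: _] split.
  apply/measurable_fun_pairP; split; first exact: measurable_tnth.
  exact: measurable_behead.
exists (fun k => split @^-1` (F k `*` G k)).
  rewrite -preimage_bigcup (_ : \bigcup_k _ = setT) ?preimage_setT//.
  rewrite -subTset => -[x y] _.
  have [i _ Fx] : (\bigcup_k F k) x by rewrite -TF.
  have [j _ Gy] : (\bigcup_k G k) y by rewrite -TG.
  exists (maxn i j) => //; split => /=.
  - by move: x Fx; exact/subsetPset/ndF/leq_maxl.
  - by move: y Gy; exact/subsetPset/ndG/leq_maxr.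
move=> k; have [? ?] := Foo k; have [? ?] := Goo k; split.
  rewrite -[X in measurable X]setTI.
  by apply: msplit => //; exact: measurableX.
rewrite /lebesgue_step /pushforward -comp_preimage.
rewrite (_ : split \o rn_cons = id); last first.
  by apply/funext => p /=; rewrite splitK.
by rewrite preimage_id product_measure1E// lte_mul_pinfty// ge0_fin_numE.
Qed.

HB.instance Definition _ := Measure_isSigmaFinite.Build _ _ _ lebesgue_step
  step_sigma_finite.

End step.

Fixpoint lebesgue_rn n : {sigma_finite_measure set (Rn n) -> \bar R} :=
  if n is n'.+1 then lebesgue_step (lebesgue_rn n') else \d_[tuple].

End lebesgue_rn.

Lemma lebesgue_rn_box (R : realType) n (B : 'I_n -> set (measurableTypeR R)) :
  (forall i, measurable (B i)) ->
  lebesgue_rn R n [set t | forall i, B i (tnth t i)] =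
  (\prod_(i < n) lebesgue_measure (B i))%E.
Proof.
elim: n B => [|n IH] B mB /=.
  rewrite big_ord0 diracE mem_set//; by case.
rewrite big_ord_recl -IH//.
rewrite /lebesgue_step /pushforward -product_measure1E//.
- congr (_ _); apply/seteqP; split => [[x t]/= h|[x t] /= [h1 h2] i].
  + split; first exact: (h ord0).
    by move=> i /=; have := h (lift ord0 i); rewrite /= tnthS.
  + by case: (unliftP ord0 i) => [j ->|->]; rewrite ?tnthS//; exact: h2.
- rewrite (_ : [set _ | _] = \bigcap_(i in [set: 'I_n])
      (fun t : Rn R n => tnth t i) @^-1` B (lift ord0 i)).
    apply: fin_bigcap_measurable => // i _.
    by rewrite -[X in measurable X]setTI; apply: measurable_tnth.
  by apply/seteqP; split => [t h i _|t h i]; exact: h.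
Qed.

(* Integrability and integral of a complex function are taken componentwise. *)
Section complex_valued.
Context {R : realType}.

Definition cexp (z : R[i]) : R[i] :=
  (expR (complex.Re z))%:C * (cos (complex.Im z) +i* sin (complex.Im z)).

Definition cintegrable d (T : measurableType d)
    (mu : {measure set T -> \bar R}) (f : T -> R[i]) : Prop :=
  mu.-integrable setT (fun x => (complex.Re (f x))%:E) /\
  mu.-integrable setT (fun x => (complex.Im (f x))%:E).

Definition cintegral d (T : measurableType d)
    (mu : {measure set T -> \bar R}) (f : T -> R[i]) : R[i] :=
  (\int[mu]_x complex.Re (f x)) +i* (\int[mu]_x complex.Im (f x)).

End complex_valued.

(* A Polish space is presented by a complete separable metric, which is also
   the metric with respect to which "bounded" is understood. *)
#[short(type="completeMetricType")]
HB.structure Definition CompleteMetric (R : numDomainType) :=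
  {V of CompletePseudoMetric R V & Metric R V}.

Definition separable (V : topologicalType) : Prop :=
  exists2 D : set V, countable D & dense D.

Definition borel (R : realType) (V : completeMetricType R) : measurableType _ :=
  g_sigma_algebraType (@open V).

Section independence.
Context d (T : measurableType d) (R : realType) (P : probability T R).

Definition sigma_of (I : Type) d' (S : measurableType d') (D : set I)
    (f : I -> T -> S) : set (set T) :=
  <<s [set E | exists i B, [/\ D i, measurable B & E = f i @^-1` B]] >>.

Definition sigma_join (F G : set (set T)) : set (set T) := <<s F `|` G >>.

Definition independent (F G : set (set T)) : Prop :=
  forall A B, F A -> G B -> P (A `&` B) = (P A * P B)%E.

(* The product rule over the whole index set gives the one over subfamilies,
   because every F i below contains setT. *)
Definition mutually_independent (I : finType) (F : I -> set (set T)) : Prop :=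
  forall E : I -> set T, (forall i, F i (E i)) ->
    P (\bigcap_(i in [set: I]) E i) = (\prod_(i : I) P (E i))%E.

End independence.

Section random_measure.
Context d (T : measurableType d) (R : realType) (P : probability T R).
Context (V : completeMetricType R).
Implicit Types (N : R.-ker T ~> borel V) (nu : {measure set (borel V) -> \bar R}).

(* A random measure is a kernel from the sample space. *)
Definition boundedly_finite N : Prop :=
  forall o (B : set (borel V)), measurable B ->
    (exists (x : V) (r : R), B `<=` ball x r) -> (N o B < +oo)%E.

Definition sigma_random_measure N : set (set T) :=
  sigma_of (@measurable _ (borel V)) (fun U o => N o U).

(* The second argument of poisson_prob is a dummy. *)
Definition poisson_random_measure N nu : Prop :=
  [/\ forall A, measurable A -> (nu A < +oo)%E -> forall k : nat,
        P [set o | N o A = k%:R%:E] = poisson_prob (fine (nu A)) 0 [set k],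
      forall A, measurable A -> nu A = +oo%E -> P [set o | N o A = +oo%E] = 1%E
    & forall m (A : 'I_m -> set (borel V)), (forall i, measurable (A i)) ->
        trivIset setT A ->
        mutually_independent P
          (fun i => sigma_of [set i] (fun j o => N o (A j)))].

Definition rm_integral N (f : borel V -> R) (o : T) : R := \int[N o]_x f x.

End random_measure.

Section levy.
Context d (T : measurableType d) (R : realType) (P : probability T R).
Implicit Types (J : R -> T -> R) (psi : R[i] -> R[i]).

Definition levy_process J : Prop :=
  [/\ forall t, 0 <= t -> measurable_fun setT (J t),
      {ae P, forall o, J 0 o = 0},
      forall m (t : nat -> R), 0 <= t 0 -> (forall k, t k <= t k.+1) ->
        mutually_independent P (fun k : 'I_m =>
          sigma_of [set k] (fun (l : 'I_m) o => J (t l.+1) o - J (t l) o)),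
      forall s t (B : set R), 0 <= s -> s <= t -> measurable B ->
        P [set o | B (J t o - J s o)] = P [set o | B (J (t - s) o)]
    & forall o t, 0 <= t ->
        J s o @[s --> t^'+] --> J t o /\
        (0 < t -> cvg (J s o @[s --> t^'-]))].

(* Lévy-Khinchine formula with no Gaussian part: the Lévy measure is Pi, and
   the drift b is relative to the truncation function 1_{|x| <= 1}. *)
Definition pure_jump J : Prop :=
  exists (b : R) (Pi : {measure set R -> \bar R}),
    [/\ Pi [set 0] = 0%E,
        (\int[Pi]_x (Num.min 1 (x ^+ 2))%:E < +oo)%E
      & forall t u, 0 <= t ->
          cintegral P (fun o => cexp (- 'i * (u * J t o)%:C)) =
          cexp (- t%:C * ('i * (b * u)%:C +
            cintegral Pi (fun x => 1 - cexp (- 'i * (u * x)%:C) -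
              (if `|x| <= 1 then 'i * (u * x)%:C else 0))))].

(* E[exp(-w (J t - J s))] = exp(-(t - s) psi(w)) at every complex w for which
   the left-hand side exists. *)
Definition laplace_exponent J psi : Prop :=
  forall s t w, 0 <= s -> s <= t ->
    P.-integrable setT
      (fun o => (expR (- (complex.Re w * (J t o - J s o))))%:E) ->
    cintegral P (fun o => cexp (- w * (J t o - J s o)%:C)) =
    cexp (- (t - s)%:C * psi w).

Definition exponential_moment J (beta : R) : Prop :=
  forall t, 0 <= t -> P.-integrable setT (fun o => (expR (- (beta * J t o)))%:E).

End levy.

Section model.
Context d (T : measurableType d) (R : realType) (P : probability T R).
Context (n : nat).
Implicit Types (J : R -> T -> R) (clock tau gamma : 'I_n -> T -> R).

(* The increment of J over the i-th of the successive intervals of lengths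
   clock 0, ..., clock (n - 1). *)
Definition time_changed_increment J clock (i : 'I_n) (o : T) : R :=
  let start := \sum_(k < n | (k < i)%N) clock k o in
  J (start + clock i o) o - J start o.

Definition aggregate_return (mu Delta beta rho : R) J1 J2 tau gamma
    (eps : 'I_n -> T -> R) (o : T) : Rn R n :=
  [tuple mu * Delta + time_changed_increment J1 tau i o
         + time_changed_increment J2 gamma i o + beta * (tau i o + gamma i o)
         + rho * gamma i o + Num.sqrt (tau i o + gamma i o) * eps i o | i < n].

Definition centered (mu Delta : R) (x : Rn R n) : Rn R n :=
  [tuple tnth x i - mu * Delta | i < n].

Definition sample_mean (A : Rn R n) : R := n%:R^-1 * \sum_(i < n) tnth A i.

(* a stands for A_i = X_i - mu Delta, not for the value of X_i. *)
Definition conditional_density (beta rho : R) J1 J2 tau gamma (i : 'I_n)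
    (a : R) (o : T) : R :=
  let z := a - time_changed_increment J1 tau i o
             - time_changed_increment J2 gamma i o - rho * gamma i o in
  let taus := tau i o + gamma i o in
  expR (z * beta) * (Num.sqrt (2 * pi))^-1 * (Num.sqrt taus)^-1
  * expR (- (z ^+ 2 / (2 * taus))) * expR (- (taus * beta ^+ 2 / 2)).

Definition marginal_density (mu Delta beta rho : R) J1 J2 tau gamma
    (x : Rn R n) : \bar R :=
  (\int[P]_o (\prod_(i < n) conditional_density beta rho J1 J2 tau gamma i
                (tnth (centered mu Delta x) i) o)%:E)%E.

Definition is_density_of (X : T -> Rn R n) (L : Rn R n -> \bar R) : Prop :=
  [/\ measurable_fun setT X, measurable_fun setT L
    & forall B, measurable B ->
        P (X @^-1` B) = (\int[lebesgue_rn R n]_(x in B) L x)%E].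

End model.

Section likelihood.
Context (R : realType) (n : nat).
Implicit Types (Phi : Rn R n -> R[i]) (L : Rn R n -> \bar R).

Definition Omega_n (V : Type) (psi1 : R[i] -> R[i]) (beta : R)
    (h : 'I_n -> V -> R) (y : Rn R n) (x : V) : R[i] :=
  \sum_(i < n) (psi1 (beta%:C + 'i * (tnth y i)%:C)
    + ((beta ^+ 2 + tnth y i ^+ 2) / 2)%:C) * (h i x)%:C.

Definition Upsilon_n (V : Type) (psi2 : R[i] -> R[i]) (beta rho : R)
    (g : 'I_n -> V -> R) (y : Rn R n) (x : V) : R[i] :=
  \sum_(i < n) (psi2 (beta%:C + 'i * (tnth y i)%:C)
    + rho%:C * (beta%:C + 'i * (tnth y i)%:C)
    + ((beta ^+ 2 + tnth y i ^+ 2) / 2)%:C) * (g i x)%:C.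

Definition fourier_likelihood (beta : R) Phi (A : Rn R n) : R[i] :=
  (expR (n%:R * sample_mean A * beta) / (2 * pi) ^+ n)%:C *
  cintegral (lebesgue_rn R n)
    (fun y => Phi y * \prod_(i < n) cexp ('i * (tnth A i * tnth y i)%:C)).

Definition gauss_damped (e : R) Phi (y : Rn R n) : R[i] :=
  Phi y * (expR (- (e * (\sum_(i < n) tnth y i ^+ 2) / 2)))%:C.

(* L is given by the Fourier integral of Phi. Densities are identified up to
   null sets. Finiteness of Phi does not make Phi Lebesgue integrable over R^n;
   when it is not (for instance for a normal mixture whose density is unbounded
   at a point), the integral is the limit of its Gauss means, in L^1 with the
   weight e^{-n Abar beta}. *)
Definition likelihood_formula (mu Delta beta : R) L Phi : Prop :=
  (cintegrable (lebesgue_rn R n) Phi ->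
    {ae lebesgue_rn R n, forall x,
      let l := fourier_likelihood beta Phi (centered mu Delta x) in
      complex.Im l = 0 /\ L x = (complex.Re l)%:E}) /\
  (forall e, 0 < e -> cintegrable (lebesgue_rn R n) (gauss_damped e Phi)) /\
  (\int[lebesgue_rn R n]_x
     (let A := centered mu Delta x in
      (expR (- (n%:R * sample_mean A * beta)))%:E *
      `|L x - (complex.Re (fourier_likelihood beta (gauss_damped e Phi) A))%:E|))%E
    @[e --> (0 : R)^'+] --> (0 : \bar R).

End likelihood.

(* Main.v *)
Require Import Defs.
From HB Require Import structures.
From mathcomp Require Import all_boot all_order all_algebra.
From mathcomp Require Import complex.
From mathcomp Require Import all_classical all_reals all_analysis.
From mathcomp Require Import measurable_realfun.
From mathcomp Require Import ring lra.
Set Implicit Arguments.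
Unset Strict Implicit.
Unset Printing Implicit Defensive.
Import Order.TTheory GRing.Theory Num.Theory.
Import numFieldNormedType.Exports.
Local Open Scope classical_set_scope.
Local Open Scope complex_scope.
Local Open Scope ring_scope.

(** Given the clocks and the jumps, the returns are independent Gaussian variables.
    Their joint density is therefore a mixture, over the sample points, of
    products of Gaussian densities: this is [marginal_density_correct]. Taking
    exp(n Abar beta) out of it leaves a mixture of Gaussian densities in
    A = X - mu Delta with means J_(i,1) + J_(i,2) + rho gamma_i, variances
    tau_i + gamma_i and a weight of finite mean ([marginal_density_mixture]).

    The Fourier transform of this mixture at y is, with xi the imaginary unit, the
    mean of the product over i of
    exp(- (beta + xi y_i) (J_(i,1) + J_(i,2) + rho gamma_i)
        - (tau_i + gamma_i) (beta^2 + y_i^2) / 2).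
    Averaging over the jumps for frozen clocks replaces exp(- w J_(i,1)) by
    exp(- tau_i psi_1(w)), and likewise for the second process. What remains in the
    exponent is linear in the clocks, and is - N (Omega_n + Upsilon_n). Hence the
    transform is the mean of exp(- N (Omega_n + Upsilon_n))
    ([mixture_fourier_laplace]), and the formula is Fourier inversion for a
    Gaussian mixture.

    The inversion rests on one computation ([damped_fourier]): damping the transform
    by exp(- e |y|^2 / 2) amounts to adding e to all variances, that is to a mixture
    of the same kind. As e tends to 0 the components converge pointwise with constant
    mass, hence in L1 by [scheffe], and so do the mixtures ([cvg_mixture]). If the
    transform is integrable, the damped integrals also converge pointwise by
    dominated convergence, and the two limits agree ([mixture_inversion]).

    For a Poisson random measure it remains to see that exp(- N f) is integrable with
    mean exp(- Lambda(f)) for complex f ([poisson_laplace]). For f with finitely many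
    values, N f is a combination of independent Poisson variables. The general case
    is a limit: the mass of nu where |f| is bounded away from 0 is finite because
    N |f| is, and exp(N f^-), with f^- the negative part of Re f, dominates exp(- N f);
    its mean is bounded with the help of Fatou by exp of the integral of
    |1 - exp(- f)|. *)

Local Notation normc := ComplexField.Normc.normc.

(** * Complex exponential *)
Section complex_exponential.
Context {R : realType}.
Implicit Types (z : R[i]) (x y : R).

Lemma complex_eqP z z' :
  complex.Re z = complex.Re z' -> complex.Im z = complex.Im z' -> z = z'.
Proof. by case: z => ? ?; case: z' => ? ? /= -> ->. Qed.

Lemma ReD z z' : complex.Re (z + z') = complex.Re z + complex.Re z'.
Proof. by case: z; case: z'. Qed.
Lemma ImD z z' : complex.Im (z + z') = complex.Im z + complex.Im z'.
Proof. by case: z; case: z'. Qed.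
Lemma ReN z : complex.Re (- z) = - complex.Re z.
Proof. by case: z. Qed.
Lemma ImN z : complex.Im (- z) = - complex.Im z.
Proof. by case: z. Qed.
Lemma ReM z z' : complex.Re (z * z') =
  complex.Re z * complex.Re z' - complex.Im z * complex.Im z'.
Proof. by case: z; case: z'. Qed.
Lemma ImM z z' : complex.Im (z * z') =
  complex.Re z * complex.Im z' + complex.Im z * complex.Re z'.
Proof. by case: z => a b; case: z' => c d /=. Qed.
Lemma ReZ x z : complex.Re (x%:C * z) = x * complex.Re z.
Proof. by rewrite ReM/= mul0r subr0. Qed.
Lemma ImZ x z : complex.Im (x%:C * z) = x * complex.Im z.
Proof. by rewrite ImM/= mul0r addr0. Qed.
Lemma Re_cexp z : complex.Re (cexp z) = expR (complex.Re z) * cos (complex.Im z).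
Proof. by rewrite /cexp ReM/= mul0r subr0. Qed.
Lemma Im_cexp z : complex.Im (cexp z) = expR (complex.Re z) * sin (complex.Im z).
Proof. by rewrite /cexp ImM/= mul0r addr0. Qed.

Lemma cexpD z z' : cexp (z + z') = cexp z * cexp z'.
Proof.
apply: complex_eqP.
  by rewrite Re_cexp ReM !Re_cexp !Im_cexp ReD ImD expRD cosD; ring.
by rewrite Im_cexp ImM !Im_cexp !Re_cexp ReD ImD expRD sinD; ring.
Qed.

Lemma cexp0 : cexp (0 : R[i]) = 1.
Proof. by apply: complex_eqP; rewrite ?Re_cexp ?Im_cexp/= ?expR0 ?cos0 ?sin0 ?mul1r. Qed.

Lemma cexp_sum (I : Type) (s : seq I) (P : pred I) (F : I -> R[i]) :
  cexp (\sum_(i <- s | P i) F i) = \prod_(i <- s | P i) cexp (F i).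
Proof. exact: (big_morph _ cexpD cexp0). Qed.

Lemma cexp_real x : cexp x%:C = (expR x)%:C.
Proof.
by apply: complex_eqP; rewrite ?Re_cexp ?Im_cexp/= ?cos0 ?sin0 ?mulr1 ?mulr0.
Qed.

Lemma normcE z : normc z = Num.sqrt (complex.Re z ^+ 2 + complex.Im z ^+ 2).
Proof. by case: z. Qed.

Lemma normc_ge0 z : 0 <= normc z.
Proof. by rewrite normcE sqrtr_ge0. Qed.

Lemma normc_cexp z : normc (cexp z) = expR (complex.Re z).
Proof.
rewrite normcE Re_cexp Im_cexp !exprMn -mulrDr cos2Dsin2 mulr1 sqrtr_sqr.
by rewrite ger0_norm ?expR_ge0.
Qed.

Lemma normc_prod (I : Type) (s : seq I) (P : pred I) (F : I -> R[i]) :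
  normc (\prod_(i <- s | P i) F i) = \prod_(i <- s | P i) normc (F i).
Proof.
apply: (big_morph _ (@ComplexField.Normc.normcM R)).
by rewrite normcE/= expr1n expr0n/= addr0 sqrtr1.
Qed.

Lemma normc_real x : normc x%:C = `|x|.
Proof. by rewrite normcE/= expr0n/= addr0 sqrtr_sqr. Qed.

Lemma normReal_le z : `|complex.Re z| <= normc z.
Proof.
by rewrite normcE -sqrtr_sqr ler_sqrt ?lerDl ?addr_ge0 ?sqr_ge0.
Qed.

Lemma normImag_le z : `|complex.Im z| <= normc z.
Proof.
by rewrite normcE -sqrtr_sqr ler_sqrt ?lerDr ?addr_ge0 ?sqr_ge0.
Qed.

Lemma normc_le z : normc z <= `|complex.Re z| + `|complex.Im z|.
Proof.
rewrite normcE -[leRHS]ger0_norm ?addr_ge0// -sqrtr_sqr ler_sqrt ?sqr_ge0//.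
rewrite sqrrD !real_normK ?num_real//.
have : 0 <= `|complex.Re z| * `|complex.Im z| by rewrite mulr_ge0.
lra.
Qed.

Lemma normcN (z : R[i]) : normc (- z) = normc z.
Proof. by rewrite !normcE ReN ImN !sqrrN. Qed.

Lemma normcD (z z' : R[i]) : normc (z + z') <= normc z + normc z'.
Proof. by rewrite -lecR (rmorphD (real_complex R)); exact: (@ler_normD _ _ z z'). Qed.

End complex_exponential.

Lemma eq_cvg_nat (U : topologicalType) (f g : nat -> U) (l : U) :
  f =1 g -> g k @[k --> \oo] --> l -> f k @[k --> \oo] --> l.
Proof. by move=> /funext ->. Qed.

Lemma cvg_cexpN (R : realType) (z_ : nat -> R[i]) (z : R[i]) :
  complex.Re (z_ k) @[k --> \oo] --> complex.Re z ->
  complex.Im (z_ k) @[k --> \oo] --> complex.Im z ->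
  complex.Re (cexp (- z_ k)) @[k --> \oo] --> complex.Re (cexp (- z)) /\
  complex.Im (cexp (- z_ k)) @[k --> \oo] --> complex.Im (cexp (- z)).
Proof.
move=> c1 c2.
have ce : expR (- complex.Re (z_ k)) @[k --> \oo] --> expR (- complex.Re z).
  apply: (@continuous_cvg _ _ _ _ _ _ (@expR R)); first exact: continuous_expR.
  exact: cvgN.
have E1 k : complex.Re (cexp (- z_ k)) =
    expR (- complex.Re (z_ k)) * cos (- complex.Im (z_ k)) by rewrite Re_cexp ReN ImN.
have E2 k : complex.Im (cexp (- z_ k)) =
    expR (- complex.Re (z_ k)) * sin (- complex.Im (z_ k)) by rewrite Im_cexp ReN ImN.
rewrite Re_cexp Im_cexp ReN ImN; split.
  apply: (eq_cvg_nat E1); apply: cvgM => //.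
  apply: (@continuous_cvg _ _ _ _ _ _ (@cos R)); first exact: continuous_cos.
  exact: cvgN.
apply: (eq_cvg_nat E2); apply: cvgM => //.
apply: (@continuous_cvg _ _ _ _ _ _ (@sin R)); first exact: continuous_sin.
exact: cvgN.
Qed.

(** * Integrals of complex functions *)
Section complex_integral.
Context {R : realType} d (T : measurableType d).
Implicit Types (f g : T -> R[i]) (z : R[i]).

Definition cmeasurable f :=
  measurable_fun [set: T] (fun x => complex.Re (f x)) /\
  measurable_fun [set: T] (fun x => complex.Im (f x)).

Lemma cmeasurable_cst z : cmeasurable (fun=> z).
Proof. by split; exact: measurable_cst. Qed.

Lemma cmeasurable_real (f : T -> R) :
  measurable_fun setT f -> cmeasurable (fun x => (f x)%:C).
Proof. by move=> mf; split => //; exact: measurable_cst. Qed.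

Lemma cmeasurableD f g :
  cmeasurable f -> cmeasurable g -> cmeasurable (fun x => f x + g x).
Proof.
move=> [f1 f2] [g1 g2]; split.
  by under eq_fun do rewrite ReD; exact: measurable_funD.
by under eq_fun do rewrite ImD; exact: measurable_funD.
Qed.

Lemma cmeasurableN f : cmeasurable f -> cmeasurable (fun x => - f x).
Proof.
move=> [f1 f2]; split.
  by under eq_fun do rewrite ReN; exact: measurableT_comp.
by under eq_fun do rewrite ImN; exact: measurableT_comp.
Qed.

Lemma cmeasurableM f g :
  cmeasurable f -> cmeasurable g -> cmeasurable (fun x => f x * g x).
Proof.
move=> [f1 f2] [g1 g2]; split.
  by under eq_fun do rewrite ReM; apply: measurable_funB; exact: measurable_funM.
by under eq_fun do rewrite ImM; apply: measurable_funD; exact: measurable_funM.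
Qed.

Lemma cmeasurable_sum (I : Type) (s : seq I) (F : I -> T -> R[i]) :
  (forall i, cmeasurable (F i)) -> cmeasurable (fun x => \sum_(i <- s) F i x).
Proof.
move=> mF; elim: s => [|i s IH].
  by under eq_fun do rewrite big_nil; exact: cmeasurable_cst.
by under eq_fun do rewrite big_cons; exact: cmeasurableD.
Qed.

Lemma cmeasurable_prod (I : Type) (s : seq I) (F : I -> T -> R[i]) :
  (forall i, cmeasurable (F i)) -> cmeasurable (fun x => \prod_(i <- s) F i x).
Proof.
move=> mF; elim: s => [|i s IH].
  by under eq_fun do rewrite big_nil; exact: cmeasurable_cst.
by under eq_fun do rewrite big_cons; exact: cmeasurableM.
Qed.

Lemma measurable_cos : measurable_fun [set: R] (cos : R -> R).
Proof. by apply: continuous_measurable_fun; exact: continuous_cos. Qed.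
Lemma measurable_sin : measurable_fun [set: R] (sin : R -> R).
Proof. by apply: continuous_measurable_fun; exact: continuous_sin. Qed.

Lemma cmeasurable_exp f : cmeasurable f -> cmeasurable (fun x => cexp (f x)).
Proof.
move=> [f1 f2]; split.
  under eq_fun do rewrite Re_cexp; apply: measurable_funM.
    exact: measurableT_comp.
  exact: (measurableT_comp measurable_cos).
under eq_fun do rewrite Im_cexp; apply: measurable_funM.
  exact: measurableT_comp.
exact: (measurableT_comp measurable_sin).
Qed.

Lemma measurable_normc f :
  cmeasurable f -> measurable_fun setT (fun x => normc (f x)).
Proof.
move=> [f1 f2]; under eq_fun do rewrite normcE.
apply: (@measurableT_comp _ _ _ _ _ _ (@Num.sqrt R)) => //.
  by apply: continuous_measurable_fun; exact: sqrt_continuous.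
by apply: measurable_funD; exact: measurable_funX.
Qed.

Variable mu : {measure set T -> \bar R}.

Lemma cintegrable_cmeasurable f : cintegrable mu f -> cmeasurable f.
Proof.
by move=> [/integrableP[/measurable_EFinP ? _] /integrableP[/measurable_EFinP ? _]].
Qed.

Lemma cintegrable_le f (g : T -> R) : cmeasurable f ->
  mu.-integrable setT (EFin \o g) -> (forall x, normc (f x) <= g x) ->
  cintegrable mu f.
Proof.
move=> [f1 f2] ig fg; split; apply: le_integrable ig => //=;
  try exact/measurable_EFinP; move=> x _; rewrite lee_fin;
  apply: (le_trans _ (ler_norm _)); apply: le_trans (fg x).
- exact: normReal_le.
- exact: normImag_le.
Qed.

Lemma cintegrable_normc f : cintegrable mu f ->
  mu.-integrable setT (fun x => (normc (f x))%:E).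
Proof.
move=> cf; have mf := cintegrable_cmeasurable cf; case: cf => f1 f2.
have := integrableD measurableT (integrable_abse f1) (integrable_abse f2).
apply: le_integrable => //=; first exact/measurable_EFinP/measurable_normc.
move=> x _; rewrite lee_fin ger0_norm ?normc_ge0//.
by apply: le_trans (normc_le _) _; rewrite ler_norm.
Qed.

Lemma eq_cintegral f g : f =1 g -> cintegral mu f = cintegral mu g.
Proof. by move=> /funext ->. Qed.

Lemma ae_eq_cintegral f g : cmeasurable f -> cmeasurable g ->
  {ae mu, forall x, f x = g x} -> cintegral mu f = cintegral mu g.
Proof.
move=> [f1 f2] [g1 g2] fg; congr (_ +i* _); congr fine;
  apply: ae_eq_integral => //; try exact/measurable_EFinP.
- by apply: filterS fg => x /= -> _.
- by apply: filterS fg => x /= -> _.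
Qed.

Lemma cintegrable_ae f g : cmeasurable g -> cintegrable mu f ->
  {ae mu, forall x, f x = g x} -> cintegrable mu g.
Proof.
move=> [g1 g2] [f1 f2] fg; split.
  apply/integrableP; split; first exact/measurable_EFinP.
  have /integrableP[mf1] := f1; apply: le_lt_trans.
  rewrite le_eqVlt; apply/orP; left; apply/eqP; apply: ge0_ae_eq_integral => //=.
  - by apply/measurable_EFinP; exact: measurableT_comp.
  - by apply/measurable_EFinP; apply: measurableT_comp => //; exact/measurable_EFinP.
  - by apply: filterS fg => x /= -> _.
apply/integrableP; split; first exact/measurable_EFinP.
have /integrableP[mf2] := f2; apply: le_lt_trans.
rewrite le_eqVlt; apply/orP; left; apply/eqP; apply: ge0_ae_eq_integral => //=.
- by apply/measurable_EFinP; exact: measurableT_comp.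
- by apply/measurable_EFinP; apply: measurableT_comp => //; exact/measurable_EFinP.
- by apply: filterS fg => x /= -> _.
Qed.

Lemma cintegrableZ z f : cintegrable mu f -> cintegrable mu (fun x => z * f x).
Proof.
move=> cf; apply: (@cintegrable_le _ (fun x => normc z * normc (f x))).
- by apply: cmeasurableM; [exact: cmeasurable_cst|exact: cintegrable_cmeasurable cf].
- exact: integrableZl (cintegrable_normc cf).
- by move=> x; rewrite ComplexField.Normc.normcM.
Qed.

Lemma cintegralZ z f : cintegrable mu f ->
  cintegral mu (fun x => z * f x) = z * cintegral mu f.
Proof.
move=> [f1 f2]; apply: complex_eqP => /=; rewrite ?ReM ?ImM/=.
  under eq_Rintegral do rewrite ReM.
  rewrite RintegralB// ?RintegralZl//.
  - exact: (integrableZl measurableT _ f1).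
  - exact: (integrableZl measurableT _ f2).
under eq_Rintegral do rewrite ImM.
rewrite RintegralD// ?RintegralZl//.
- exact: (integrableZl measurableT _ f2).
- exact: (integrableZl measurableT _ f1).
Qed.

Lemma cintegrableD f g : cintegrable mu f -> cintegrable mu g ->
  cintegrable mu (fun x => f x + g x).
Proof.
move=> [f1 f2] [g1 g2]; split.
  under eq_fun do rewrite ReD; exact: (integrableD measurableT f1 g1).
under eq_fun do rewrite ImD; exact: (integrableD measurableT f2 g2).
Qed.

Lemma cintegralD f g : cintegrable mu f -> cintegrable mu g ->
  cintegral mu (fun x => f x + g x) = cintegral mu f + cintegral mu g.
Proof.
move=> [f1 f2] [g1 g2]; apply: complex_eqP => /=.
  by under eq_Rintegral do rewrite ReD; rewrite RintegralD.
by under eq_Rintegral do rewrite ImD; rewrite RintegralD.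
Qed.

Lemma cintegrable0 : cintegrable mu (fun=> 0).
Proof. by split; exact: integrable0. Qed.

Lemma cintegral0 : cintegral mu (fun=> 0) = 0.
Proof. by rewrite /cintegral /= !Rintegral_cst// !mul0r. Qed.

Lemma cintegrable_sum (I : Type) (s : seq I) (F : I -> T -> R[i]) :
  (forall i, cintegrable mu (F i)) ->
  cintegrable mu (fun x => \sum_(i <- s) F i x).
Proof.
move=> iF; elim: s => [|i s IH].
  by under eq_fun do rewrite big_nil; exact: cintegrable0.
by under eq_fun do rewrite big_cons; exact: cintegrableD.
Qed.

Lemma cintegral_sum (I : Type) (s : seq I) (F : I -> T -> R[i]) :
  (forall i, cintegrable mu (F i)) ->
  cintegral mu (fun x => \sum_(i <- s) F i x) = \sum_(i <- s) cintegral mu (F i).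
Proof.
move=> iF; elim: s => [|i s IH].
  by under eq_cintegral do rewrite big_nil; rewrite cintegral0 big_nil.
under eq_cintegral do rewrite big_cons.
by rewrite cintegralD ?IH ?big_cons//; exact: cintegrable_sum.
Qed.

(** The limits are taken componentwise, so that no topology on the complex
    numbers enters. *)
Lemma cvg_cintegral (f_ : nat -> T -> R[i]) f (g : T -> R) :
  (forall n, cmeasurable (f_ n)) -> cmeasurable f ->
  mu.-integrable setT (EFin \o g) ->
  {ae mu, forall x, forall n, normc (f_ n x) <= g x} ->
  {ae mu, forall x, (fun n => complex.Re (f_ n x)) @ \oo --> complex.Re (f x) /\
             (fun n => complex.Im (f_ n x)) @ \oo --> complex.Im (f x)} ->
  [/\ cintegrable mu f,
      (fun n => complex.Re (cintegral mu (f_ n))) @ \oo --> complex.Re (cintegral mu f) &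
      (fun n => complex.Im (cintegral mu (f_ n))) @ \oo --> complex.Im (cintegral mu f)].
Proof.
move=> mf_ mf ig fg cvf.
have key (h : R[i] -> R) : (forall n, measurable_fun setT (fun x => h (f_ n x))) ->
    measurable_fun setT (fun x => h (f x)) -> (forall z, `|h z| <= normc z) ->
    {ae mu, forall x, (fun n => h (f_ n x)) @ \oo --> h (f x)} ->
    mu.-integrable setT (fun x => (h (f x))%:E) /\
    (fun n => \int[mu]_x h (f_ n x)) @ \oo --> \int[mu]_x h (f x).
  move=> mh_ mh hn hcv.
  have [|||||ih _ hc] := @dominated_convergence _ _ _ mu _ measurableT
    (fun n x => (h (f_ n x))%:E) (fun x => (h (f x))%:E) (EFin \o g).
  - by move=> n; exact/measurable_EFinP.
  - exact/measurable_EFinP.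
  - by apply: filterS hcv => x /= hx _; apply: cvg_EFin => //; exact: nearW.
  - exact: ig.
  - apply: filterS fg => x /= fx n _; rewrite lee_fin.
    by apply: le_trans (hn _) (fx n).
  split => //.
  have ifn := integrable_fin_num measurableT ih.
  by apply/fine_cvg; rewrite fineK.
have [i1 c1] := key (@complex.Re R) (fun n => (mf_ n).1) mf.1 (@normReal_le R)
  (filterS (fun x (h : _ /\ _) => h.1) cvf).
have [i2 c2] := key (@complex.Im R) (fun n => (mf_ n).2) mf.2 (@normImag_le R)
  (filterS (fun x (h : _ /\ _) => h.2) cvf).
by split.
Qed.

Lemma cintegral_real (v : T -> R) :
  cintegral mu (fun x => (v x)%:C) = (\int[mu]_x v x)%:C.
Proof. by congr (_ +i* _); rewrite /Rintegral integral0. Qed.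

Lemma cintegrableN f : cintegrable mu f ->
  cintegrable mu (fun x => - f x).
Proof. by move=> fi; under eq_fun do rewrite -mulN1r; exact: cintegrableZ. Qed.

Lemma cintegralN f : cintegrable mu f ->
  cintegral mu (fun x => - f x) = - cintegral mu f.
Proof.
move=> fi; under eq_cintegral do rewrite -mulN1r.
by rewrite cintegralZ// mulN1r.
Qed.

End complex_integral.

Lemma cmeasurable_comp {R : realType} d d' (T : measurableType d)
    (T' : measurableType d') (f : T' -> R[i]) (phi : T -> T') :
  cmeasurable f -> measurable_fun setT phi -> cmeasurable (fun x => f (phi x)).
Proof.
move=> [f1 f2] mphi; split; first exact: (measurableT_comp f1 mphi).
exact: (measurableT_comp f2 mphi).
Qed.

(** The image measure enters through its defining property only, so that the
    lemmas also apply to [lebesgue_rn], which is an image by construction. *)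
Section pushforward_integral.
Context {R : realType} d d' (T : measurableType d) (T' : measurableType d').
Variables (mu : {measure set T -> \bar R}) (phi : T -> T').
Hypothesis mphi : measurable_fun setT phi.
Variable mu' : {measure set T' -> \bar R}.
Hypothesis mu'E : forall A, measurable A -> mu' A = mu (phi @^-1` A).

Lemma ge0_integral_image (f : T' -> \bar R) : measurable_fun setT f ->
  (forall x, 0 <= f x)%E -> (\int[mu']_x f x = \int[mu]_x f (phi x))%E.
Proof.
move=> mf f0.
rewrite (eq_measure_integral (pushforward mu phi)); last first.
  by move=> A mA _; rewrite mu'E.
by rewrite ge0_integral_pushforward//= ?preimage_setT.
Qed.

Lemma integrable_image (f : T' -> R) : measurable_fun setT f ->
  mu.-integrable setT (fun x => (f (phi x))%:E) <->
  mu'.-integrable setT (fun x => (f x)%:E).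
Proof.
move=> mf; split => /integrableP[_ fi]; apply/integrableP; split.
- exact/measurable_EFinP.
- rewrite ge0_integral_image//=.
  by apply/measurable_EFinP; exact: measurableT_comp.
- by apply/measurable_EFinP; exact: measurableT_comp.
- move: fi; rewrite ge0_integral_image//=.
  by apply/measurable_EFinP; exact: measurableT_comp.
Qed.

Lemma Rintegral_image (f : T' -> R) : measurable_fun setT f ->
  \int[mu']_x f x = \int[mu]_x f (phi x).
Proof.
move=> mf; congr fine; rewrite integralE [in RHS]integralE.
congr (_ - _)%E; rewrite ge0_integral_image//.
- by apply: eq_integral => x _; rewrite !funeposE.
- by apply: measurable_funepos; exact/measurable_EFinP.
- by apply: eq_integral => x _; rewrite !funenegE.
- by apply: measurable_funeneg; exact/measurable_EFinP.
Qed.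

Lemma cintegrable_image (f : T' -> R[i]) : cmeasurable f ->
  cintegrable mu (fun x => f (phi x)) <-> cintegrable mu' f.
Proof.
move=> [f1 f2]; split => -[i1 i2]; split.
- exact/(integrable_image f1).
- exact/(integrable_image f2).
- exact/(integrable_image f1).
- exact/(integrable_image f2).
Qed.

Lemma cintegral_image (f : T' -> R[i]) : cmeasurable f ->
  cintegral mu' f = cintegral mu (fun x => f (phi x)).
Proof. by move=> [f1 f2]; rewrite /cintegral !Rintegral_image. Qed.

End pushforward_integral.

Section fubini_complex.
Context {R : realType} d1 d2 (T1 : measurableType d1) (T2 : measurableType d2).
Variables (m1 : {sigma_finite_measure set T1 -> \bar R}).
Variables (m2 : {sigma_finite_measure set T2 -> \bar R}).

Lemma Rintegral_fubini1 (f : T1 * T2 -> R) :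
  (m1 \x m2)%E.-integrable setT (EFin \o f) ->
  m1.-integrable setT (fun x => (\int[m2]_y f (x, y))%:E) /\
  \int[(m1 \x m2)%E]_z f z = \int[m1]_x \int[m2]_y f (x, y).
Proof.
move=> fi; have iF := integrable_fubini_F fi.
have aeF : {ae m1, forall x, fubini_F m2 (EFin \o f) x =
    (\int[m2]_y f (x, y))%:E}.
  apply: filterS (integrable_ae measurableT iF) => x /(_ I) Fx.
  by rewrite /Rintegral fineK.
have mF : measurable_fun setT (fun x => (\int[m2]_y f (x, y))%:E).
  apply/measurable_EFinP; apply: (measurableT_comp (@fine_measurable R _ measurableT)).
  exact: (measurable_fubini_F fi).
have E : (\int[m1]_x (\int[m2]_y f (x, y))%:E =
          \int[(m1 \x m2)%E]_z (f z)%:E)%E.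
  rewrite -(integral12_prod_meas1 fi); apply: ae_eq_integral => //.
    exact: (measurable_fubini_F fi).
  by apply: filterS aeF => x <-.
split; last by rewrite /Rintegral -E.
apply/integrableP; split => //.
have /integrableP[_] := iF; apply: le_lt_trans.
rewrite le_eqVlt; apply/orP; left; apply/eqP; apply: ge0_ae_eq_integral => //.
- exact: measurableT_comp.
- by apply: measurableT_comp => //; exact: (measurable_fubini_F fi).
- by apply: filterS aeF => x <-.
Qed.

Lemma Rintegral_fubini2 (f : T1 * T2 -> R) :
  (m1 \x m2)%E.-integrable setT (EFin \o f) ->
  \int[(m1 \x m2)%E]_z f z = \int[m2]_y \int[m1]_x f (x, y).
Proof.
move=> fi; have mf := measurable_int _ fi.
have iG : m2.-integrable setT (fubini_G m1 (EFin \o f)).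
  apply/integrableP; split; first exact: (measurable_fubini_G fi).
  have := (integrable21ltyP m1 m2 mf).1 fi; apply: le_lt_trans.
  apply: ge0_le_integral => //=.
  - by apply: measurableT_comp => //; exact: (measurable_fubini_G fi).
  - apply: (@measurable_fun_fubini_tonelli_G _ _ _ _ _ m1 (fun z => `|(f z)%:E|%E)) => //=.
    by apply/measurable_EFinP; apply: measurableT_comp => //; exact/measurable_EFinP.
  - move=> y _; apply: le_abse_integral => //.
    exact: (measurableT_comp mf (measurable_pair2 y)).
have aeG : {ae m2, forall y, fubini_G m1 (EFin \o f) y =
    (\int[m1]_x f (x, y))%:E}.
  apply: filterS (integrable_ae measurableT iG) => x /(_ I) Gx.
  by rewrite /Rintegral fineK.
rewrite /Rintegral -(integral21_prod_meas1 fi); congr fine.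
apply: ae_eq_integral => //.
- exact: (measurable_fubini_G fi).
- apply/measurable_EFinP; apply: (measurableT_comp (@fine_measurable R _ measurableT)).
  exact: (measurable_fubini_G fi).
- by apply: filterS aeG => x ->.
Qed.

Lemma cintegral_fubini1 (f : T1 * T2 -> R[i]) : cintegrable (m1 \x m2)%E f ->
  cintegrable m1 (fun x => cintegral m2 (fun y => f (x, y))) /\
  cintegral (m1 \x m2)%E f = cintegral m1 (fun x => cintegral m2 (fun y => f (x, y))).
Proof.
move=> [f1 f2]; have [i1 e1] := Rintegral_fubini1 f1.
have [i2 e2] := Rintegral_fubini1 f2.
by split; [split|rewrite /cintegral e1 e2].
Qed.

Lemma cintegral_fubini2 (f : T1 * T2 -> R[i]) : cintegrable (m1 \x m2)%E f ->
  cintegral (m1 \x m2)%E f = cintegral m2 (fun y => cintegral m1 (fun x => f (x, y))).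
Proof.
by move=> [f1 f2]; rewrite /cintegral (Rintegral_fubini2 f1) (Rintegral_fubini2 f2).
Qed.

(** Integrability is Tonelli for the moduli; the formula is what makes transforms
    of independent variables factorize. *)
Lemma cintegral_tensor (f : T1 -> R[i]) (g : T2 -> R[i]) :
  cintegrable m1 f -> cintegrable m2 g ->
  cintegrable (m1 \x m2)%E (fun z => f z.1 * g z.2) /\
  cintegral (m1 \x m2)%E (fun z => f z.1 * g z.2) =
    cintegral m1 f * cintegral m2 g.
Proof.
move=> fi gi; have mf := cintegrable_cmeasurable fi.
have mg := cintegrable_cmeasurable gi.
have fgi : cintegrable (m1 \x m2)%E (fun z => f z.1 * g z.2).
  have m12 : cmeasurable (fun z : T1 * T2 => f z.1 * g z.2).
    by apply: cmeasurableM; [exact: (cmeasurable_comp mf measurable_fst)|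
                             exact: (cmeasurable_comp mg measurable_snd)].
  apply: (@cintegrable_le _ _ _ _ _ (fun z => normc (f z.1 * g z.2))) => //.
  apply/integrable12ltyP; first exact/measurable_EFinP/measurable_normc.
  have /integrableP[mnf nf] := cintegrable_normc fi.
  have /integrableP[mng ng] := cintegrable_normc gi.
  rewrite (eq_integral (fun x => `|(normc (f x))%:E| *
      \int[m2]_y `|(normc (g y))%:E|))%E; last first.
    move=> x _; rewrite -ge0_integralZl//=.
      by apply: eq_integral => y _; rewrite -EFinM ComplexField.Normc.normcM normrM.
    by apply/measurable_EFinP; apply: measurableT_comp => //; exact: measurable_normc.
  rewrite ge0_integralZr//=.
  - by rewrite lte_mul_pinfty// ?integral_ge0// ge0_fin_numE// integral_ge0.
  - by apply/measurable_EFinP; apply: measurableT_comp => //; exact: measurable_normc.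
  - exact: integral_ge0.
split => //; rewrite (cintegral_fubini1 fgi).2 mulrC -cintegralZ//.
apply: eq_cintegral => x; rewrite mulrC -cintegralZ//.
Qed.

End fubini_complex.

(** * Independence *)

Lemma image_measure (R : realType) d d' (T : measurableType d)
    (T' : measurableType d') (mu : {measure set T -> \bar R}) (phi : T -> T') :
  measurable_fun setT phi ->
  exists mu' : {measure set T' -> \bar R}, forall A, mu' A = mu (phi @^-1` A).
Proof.
move=> mphi.
by apply: (@ex_intro {measure set T' -> \bar R} _ (pushforward mu phi)).
Qed.

Section decoupling.
Context d (T : measurableType d) (R : realType) (P : probability T R).
Context d1 d2 (T1 : measurableType d1) (T2 : measurableType d2).
Variables (a : T -> T1) (b : T -> T2).
Hypotheses (ma : measurable_fun setT a) (mb : measurable_fun setT b).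
Hypothesis ab_indep : forall A B, measurable A -> measurable B ->
  P (a @^-1` A `&` b @^-1` B) = (P (a @^-1` A) * P (b @^-1` B))%E.

Let ab o := (a o, b o).
Let axb (z : T * T) : T1 * T2 := (a z.1, b z.2).

Let mab : measurable_fun setT ab.
Proof. exact: measurable_fun_pair. Qed.

Let maxb : measurable_fun setT axb.
Proof.
apply: measurable_fun_pair; first exact: (measurableT_comp ma measurable_fst).
exact: (measurableT_comp mb measurable_snd).
Qed.

Let mpre1 A : measurable A -> measurable (a @^-1` A).
Proof. by move=> mA; rewrite -[X in measurable X]setTI; exact: ma. Qed.
Let mpre2 B : measurable B -> measurable (b @^-1` B).
Proof. by move=> mB; rewrite -[X in measurable X]setTI; exact: mb. Qed.

(** Under independence the joint law of the pair is the image of the product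
    measure on two copies of the probability space, so that expectations can be
    computed with the two arguments evaluated at unrelated sample points. *)
Lemma decoupling_law : exists2 m : {measure set (T1 * T2) -> \bar R},
  (forall A, measurable A -> m A = P (ab @^-1` A)) &
  (forall A, measurable A -> m A = (P \x P)%E (axb @^-1` A)).
Proof.
pose Xa : {mfun T >-> T1} := HB.pack a (isMeasurableFun.Build _ _ _ _ a ma).
pose Xb : {mfun T >-> T2} := HB.pack b (isMeasurableFun.Build _ _ _ _ b mb).
have [m1 m1E] := image_measure P mab.
have [m2 m2E] := image_measure (P \x P)%E maxb.
exists m1 => A mA; first exact: m1E.
rewrite -m2E -(@product_measure_unique _ _ _ _ _ (distribution P Xa)
  (distribution P Xb) m1)//.
  apply: product_measure_unique => // B C mB mC.
  rewrite m2E -[RHS](product_measure1E _ _ (mpre1 mB) (mpre2 mC)).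
  by congr (_ _); apply/seteqP; split => -[x y].
by move=> B C mB mC; rewrite m1E -[RHS]ab_indep.
Qed.

Lemma decoupling_ge0 (F : T1 * T2 -> \bar R) : measurable_fun setT F ->
  (forall z, 0 <= F z)%E ->
  (\int[P]_o F (a o, b o) = \int[P]_o1 \int[P]_o2 F (a o1, b o2))%E.
Proof.
move=> mF F0; have [m mE1 mE2] := decoupling_law.
rewrite -(ge0_integral_image mab mE1 mF F0) (ge0_integral_image maxb mE2 mF F0).
rewrite (fubini_tonelli1 (fun z => F (axb z)))//.
exact: (measurableT_comp mF maxb).
Qed.

Lemma decoupling_complex (F : T1 * T2 -> R[i]) : cmeasurable F ->
  cintegrable P (fun o => F (a o, b o)) ->
  cintegrable P (fun o1 => cintegral P (fun o2 => F (a o1, b o2))) /\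
  cintegral P (fun o => F (a o, b o)) =
    cintegral P (fun o1 => cintegral P (fun o2 => F (a o1, b o2))).
Proof.
move=> mF; have [m mE1 mE2] := decoupling_law.
move=> /(cintegrable_image mab mE1 mF)/(cintegrable_image maxb mE2 mF) Fi.
rewrite -(cintegral_image mab mE1 mF) (cintegral_image maxb mE2 mF).
exact: (cintegral_fubini1 Fi).
Qed.

Lemma decoupling_tensor (f : T1 -> R[i]) (g : T2 -> R[i]) :
  cmeasurable f -> cmeasurable g ->
  cintegrable P (fun o => f (a o)) -> cintegrable P (fun o => g (b o)) ->
  cintegrable P (fun o => f (a o) * g (b o)) /\
  cintegral P (fun o => f (a o) * g (b o)) =
    cintegral P (fun o => f (a o)) * cintegral P (fun o => g (b o)).
Proof.
move=> mf mg fi gi; have [m mE1 mE2] := decoupling_law.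
have mfg : cmeasurable (fun z : T1 * T2 => f z.1 * g z.2).
  by apply: cmeasurableM; [exact: (cmeasurable_comp mf measurable_fst)|
                           exact: (cmeasurable_comp mg measurable_snd)].
have [fgi <-] := cintegral_tensor fi gi.
have mi : cintegrable m (fun z : T1 * T2 => f z.1 * g z.2).
  exact/(cintegrable_image maxb mE2 mfg).
split; first exact: (cintegrable_image mab mE1 mfg).2.
by rewrite -(cintegral_image mab mE1 mfg) (cintegral_image maxb mE2 mfg).
Qed.

End decoupling.

(** * Boxes *)
Section boxes.
Context {R : realType}.

Definition box n (B : 'I_n -> set (measurableTypeR R)) : set (Rn R n) :=
  [set t | forall i, B i (tnth t i)].

Lemma measurable_box n (B : 'I_n -> set (measurableTypeR R)) :
  (forall i, measurable (B i)) -> measurable (box B).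
Proof.
move=> mB; rewrite /box (_ : [set _ | _] = \bigcap_(i in [set: 'I_n])
    (fun t : Rn R n => tnth t i) @^-1` B i).
  apply: fin_bigcap_measurable => // i _.
  by rewrite -[X in measurable X]setTI; apply: measurable_tnth.
by apply/seteqP; split => [t h i _|t h i]; exact: h.
Qed.

(** Boxes form a pi-system that generates the product sigma-algebra, so two
    finite measures that agree on boxes are equal. *)
Lemma box_measure_unique n (m1 m2 : {measure set (Rn R n) -> \bar R}) :
  (m1 setT < +oo)%E ->
  (forall B, (forall i, measurable (B i)) -> m1 (box B) = m2 (box B)) ->
  forall A, measurable A -> m1 A = m2 A.
Proof.
move=> m1oo m12 A mA.
pose G := [set A : set (Rn R n) |
  exists2 B : 'I_n -> set (measurableTypeR R), forall i, measurable (B i) & A = box B].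
have GT : G setT.
  by exists (fun=> setT) => //; apply/seteqP; split.
apply: (@g_sigma_algebra_measure_unique _ _ _ G _ (fun=> setT)) => //.
- by move=> _ [B mB ->]; exact: measurable_box.
- exact: bigcup_const.
- move=> _ _ [B mB ->] [C mC ->]; exists (fun i => B i `&` C i).
    by move=> i; exact: measurableI.
  by apply/seteqP; split => [t [h1 h2] i|t h]; split => //; move=> i; case: (h i).
- by move=> _ [B mB ->]; exact: m12.
- move: A mA; apply: smallest_sub; first exact: smallest_sigma_algebra.
  move=> C; rewrite -bigcup_seq => -[i _ [B mB <-]].
  apply: sub_sigma_algebra; exists (fun j => if j == i then B else setT).
    by move=> j; case: ifP.
  apply/seteqP; split => [t [_ Bt] j|t h]; first by case: eqP => [->|].
  by split => //; have := h i; rewrite eqxx.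
Qed.

End boxes.

(** * Product rule for independent real random variables *)
Section product_rule.
Context d (T : measurableType d) (R : realType) (P : probability T R).

Definition box_independent n (X : 'I_n -> T -> measurableTypeR R) :=
  forall B : 'I_n -> set (measurableTypeR R), (forall i, measurable (B i)) ->
  P (\bigcap_i X i @^-1` B i) = (\prod_(i < n) P (X i @^-1` B i))%E.

(** For a fixed event about the first variable both sides are finite measures in
    [E], and they agree on boxes. *)
Lemma head_tail_independent n (X : 'I_n.+1 -> T -> measurableTypeR R) :
  (forall i, measurable_fun setT (X i)) -> box_independent X ->
  forall A (E : set (Rn R n)), measurable A -> measurable E ->
  P (X ord0 @^-1` A `&` (fun o => [tuple X (lift ord0 i) o | i < n]) @^-1` E) =
  (P (X ord0 @^-1` A) * P ((fun o => [tuple X (lift ord0 i) o | i < n]) @^-1` E))%E.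
Proof.
move=> mX indX A E mA mE.
set b := fun o => _.
have mb : measurable_fun setT b.
  apply/measurable_fun_tnthP => i; rewrite (_ : _ \o _ = X (lift ord0 i))//.
  by apply/funext => o /=; rewrite tnth_mktuple.
have mXA : measurable (X ord0 @^-1` A).
  by rewrite -[X in measurable X]setTI; exact: mX.
have [m1 m1E] := image_measure (mrestr P mXA) mb.
have p0 : 0 <= fine (P (X ord0 @^-1` A)) by rewrite fine_ge0.
have [m2 m2E] := image_measure (mscale (NngNum p0) P) mb.
have m12 : m1 E = m2 E.
  apply: box_measure_unique => //.
    rewrite m1E; apply: (@le_lt_trans _ _ 1%E); last exact: ltry.
    apply: probability_le1; apply: measurableI => //.
    by rewrite preimage_setT.
  move=> B mB.
  pose B' A0 (i : 'I_n.+1) : set (measurableTypeR R) :=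
    if unlift ord0 i is Some j then B j else A0.
  have mB' A0 : measurable A0 -> forall i, measurable (B' A0 i).
    by move=> mA0 i; rewrite /B'; case: unliftP.
  have capE A0 : \bigcap_i X i @^-1` B' A0 i = b @^-1` box B `&` X ord0 @^-1` A0.
    apply/seteqP; split => [w h|w [h1 h2] i _].
      split; last by have := h ord0 I; rewrite /B'/= unlift_none.
      by move=> i; have := h (lift ord0 i) I; rewrite /B'/= liftK tnth_mktuple.
    rewrite /B' /=; case: unliftP => [j ->|->//].
    by have := h1 j; rewrite tnth_mktuple.
  have prodE A0 : measurable A0 -> P (b @^-1` box B `&` X ord0 @^-1` A0) =
      (P (X ord0 @^-1` A0) * \prod_(i < n) P (X (lift ord0 i) @^-1` B i))%E.
    move=> mA0; rewrite -capE indX; last exact: mB'.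
    rewrite big_ord_recl /B' unlift_none; congr (_ * _)%E.
    by apply: eq_bigr => i _; rewrite liftK.
  have := prodE _ mA.
  have := prodE _ measurableT; rewrite preimage_setT setIT probability_setT mul1e.
  move=> <- prodA; rewrite m1E m2E.
  transitivity (P (b @^-1` box B `&` X ord0 @^-1` A)) => //.
  rewrite prodA; transitivity ((fine (P (X ord0 @^-1` A)))%:E * P (b @^-1` box B))%E => //.
  by rewrite fineK//; exact: fin_num_measure.
rewrite setIC; transitivity (m1 E); first by rewrite m1E.
rewrite m12 m2E; transitivity ((fine (P (X ord0 @^-1` A)))%:E * P (b @^-1` E))%E => //.
by rewrite fineK//; exact: fin_num_measure.
Qed.

Lemma cintegral_cst1 : cintegral P (fun=> 1) = 1.
Proof.
apply: complex_eqP => /=; rewrite Rintegral_cst//= ?mul0r//.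
by rewrite probability_setT mulr1.
Qed.

(** Induction on the number of variables: the first one is independent of the
    vector of the others, so that [decoupling_tensor] splits off its factor. *)
Lemma box_independent_prod n (X : 'I_n -> T -> measurableTypeR R)
    (f : 'I_n -> measurableTypeR R -> R[i]) :
  (forall i, measurable_fun setT (X i)) -> box_independent X ->
  (forall i, cmeasurable (f i)) -> (forall i, cintegrable P (fun o => f i (X i o))) ->
  cintegrable P (fun o => \prod_(i < n) f i (X i o)) /\
  cintegral P (fun o => \prod_(i < n) f i (X i o)) =
    \prod_(i < n) cintegral P (fun o => f i (X i o)).
Proof.
elim: n X f => [|n IH] X f mX indX mf fi.
  rewrite big_ord0; split; last first.
    by under eq_cintegral do rewrite big_ord0; rewrite cintegral_cst1.
  under eq_fun do rewrite big_ord0.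
  by split; [exact: finite_measure_integrable_cst|exact: integrable0].
have indX' : box_independent (fun i => X (lift ord0 i)).
  move=> B mB.
  have := head_tail_independent mX indX measurableT (measurable_box mB).
  rewrite preimage_setT setTI probability_setT mul1e.
  have := indX (fun i => if unlift ord0 i is Some j then B j else setT).
  rewrite big_ord_recl unlift_none preimage_setT probability_setT mul1e.
  under eq_bigr do rewrite liftK.
  move=> <-; last by move=> i; case: unliftP.
  move=> _; congr (P _); apply/seteqP; split => o h i _.
    by rewrite /=; case: unliftP => [j ->|//]; exact: h.
  by have := h (lift ord0 i) I; rewrite /= liftK.
have [ti te] := IH _ _ (fun i => mX _) indX' (fun i => mf _) (fun i => fi (lift ord0 i)).
pose g (t : Rn R n) := \prod_(i < n) f (lift ord0 i) (tnth t i).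
pose b o := [tuple X (lift ord0 i) o | i < n].
have mb : measurable_fun setT b.
  apply/measurable_fun_tnthP => i; rewrite (_ : _ \o _ = X (lift ord0 i))//.
  by apply/funext => o /=; rewrite tnth_mktuple.
have mg : cmeasurable g.
  apply: cmeasurable_prod => i; apply: (cmeasurable_comp (mf _)).
  exact: measurable_tnth.
have gE o : g (b o) = \prod_(i < n) f (lift ord0 i) (X (lift ord0 i) o).
  by apply: eq_bigr => i _; rewrite tnth_mktuple.
have gi : cintegrable P (fun o => g (b o)) by under eq_fun do rewrite gE.
have [h1 h2] := decoupling_tensor (mX ord0) mb (head_tail_independent mX indX)
  (mf ord0) mg (fi ord0) gi.
have E o : \prod_(i < n.+1) f i (X i o) = f ord0 (X ord0 o) * g (b o).
  by rewrite big_ord_recl gE.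
rewrite big_ord_recl -te; under eq_fun do rewrite E.
by split => //; rewrite h2; congr (_ * _); exact: eq_cintegral.
Qed.

End product_rule.

(** * Fourier transform of the Gaussian density *)
Section gaussian_fourier.
Context {R : realType}.
Notation mu := (@lebesgue_measure R).
Implicit Types s x y c : R.

Definition gauss s y : R := expR (- (s * y ^+ 2 / 2)).

Lemma gauss_ge0 s y : 0 <= gauss s y. Proof. exact: expR_ge0. Qed.

Lemma measurable_gauss s : measurable_fun setT (gauss s).
Proof.
apply: measurableT_comp => //; apply: measurableT_comp => //.
by apply: measurable_funM => //; apply: measurable_funM => //; exact: measurable_funX.
Qed.

Lemma gaussE s : 0 < s -> gauss s = normal_fun 0 (Num.sqrt s^-1).
Proof.
move=> s0; apply/funext => y; rewrite /gauss /normal_fun subr0 sqr_sqrtr ?invr_ge0 1?ltW//.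
congr expR; rewrite mulNr; congr (- _).
by rewrite -mulr_natr; field; rewrite gt_eqF.
Qed.

Lemma normal_pdf_gauss s y : 0 < s ->
  normal_pdf 0 (Num.sqrt s) y = (Num.sqrt (2 * pi * s))^-1 * gauss s^-1 y.
Proof.
move=> s0; rewrite normal_pdfE ?gt_eqF ?sqrtr_gt0// gaussE ?invr_gt0// invrK.
by rewrite /normal_peak sqr_sqrtr ?ltW//; congr ((Num.sqrt _)^-1 * _); ring.
Qed.

Lemma gauss_pdf s y : 0 < s ->
  gauss s y = Num.sqrt (2 * pi / s) * normal_pdf 0 (Num.sqrt s^-1) y.
Proof.
move=> s0; rewrite normal_pdf_gauss ?invr_gt0// invrK mulrA divff ?mul1r//.
by rewrite gt_eqF// sqrtr_gt0 !mulr_gt0 ?pi_gt0 ?invr_gt0.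
Qed.

Lemma integrable_gauss s : 0 < s -> mu.-integrable setT (EFin \o gauss s).
Proof.
move=> s0; rewrite (_ : _ \o _ = (fun y => (Num.sqrt (2 * pi / s))%:E *
   (normal_pdf 0 (Num.sqrt s^-1) y)%:E)%E); last first.
  by apply/funext => y /=; rewrite (gauss_pdf _ s0) EFinM.
exact: (integrableZl measurableT _ (integrable_normal_pdf _ _)).
Qed.

Lemma Rintegral_gauss s : 0 < s -> \int[mu]_y gauss s y = Num.sqrt (2 * pi / s).
Proof.
move=> s0; under eq_Rintegral do rewrite (gauss_pdf _ s0).
rewrite RintegralZl//; last exact: integrable_normal_pdf.
by rewrite /Rintegral integral_normal_pdf/= mulr1.
Qed.

(** Half of the exponent absorbs the factor y: exp(s y^2/4) is at least
    1 + s y^2/4, and (1 + 4/s) (1 + s y^2/4) at least 1 + y^2. *)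
Lemma norm_gauss_le s y : 0 < s -> `|y * gauss s y| <= (1 + 4 / s) * gauss (s / 2) y.
Proof.
move=> s0; rewrite normrM (ger0_norm (gauss_ge0 _ _)).
have -> : gauss s y = gauss (s / 2) y * gauss (s / 2) y.
  by rewrite /gauss -expRD; congr expR; field.
rewrite mulrA ler_wpM2r ?gauss_ge0//.
rewrite /gauss expRN -lter_pdivlMr ?invr_gt0 ?expR_gt0// invrK.
have e1 : 1 + s / 2 * y ^+ 2 / 2 <= expR (s / 2 * y ^+ 2 / 2) by exact: expR_ge1Dx.
have c0 : 0 <= 1 + 4 / s by rewrite addr_ge0 ?divr_ge0 ?ltW.
apply: le_trans (ler_wpM2l c0 e1).
have -> : (1 + 4 / s) * (1 + s / 2 * y ^+ 2 / 2) =
   1 + 4 / s + s * y ^+ 2 / 4 + y ^+ 2 by field; rewrite gt_eqF.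
have h1 : 0 <= 4 / s by rewrite divr_ge0 ?ltW.
have h2 : 0 <= s * y ^+ 2 / 4 by rewrite divr_ge0// mulr_ge0 ?sqr_ge0// ltW.
have : 0 <= (1 - `|y|) ^+ 2 by exact: sqr_ge0.
rewrite sqrrB expr1n mul1r real_normK ?num_real// => h3.
have h4 : 0 <= y ^+ 2 by exact: sqr_ge0.
lra.
Qed.

Lemma integrable_gauss_mul s (b : R -> R) K : 0 < s -> measurable_fun setT b ->
  (forall y, `|b y| <= K) -> mu.-integrable setT (fun y => (gauss s y * b y)%:E).
Proof.
move=> s0 mb bK.
apply: (le_integrable measurableT _ _ (integrableZl measurableT K (integrable_gauss s0))).
  by apply/measurable_EFinP; apply: measurable_funM => //; exact: measurable_gauss.
move=> y _; rewrite lee_fin mulrC !normrM ler_wpM2r//.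
by apply: le_trans (bK y) (ler_norm _).
Qed.

Lemma integrable_id_gauss_mul s (b : R -> R) K : 0 < s -> measurable_fun setT b ->
  (forall y, `|b y| <= K) -> mu.-integrable setT (fun y => (y * gauss s y * b y)%:E).
Proof.
move=> s0 mb bK; have s20 : 0 < s / 2 by rewrite divr_gt0.
apply: (le_integrable measurableT _ _
  (integrableZl measurableT (K * (1 + 4 / s)) (integrable_gauss s20))).
  apply/measurable_EFinP; apply: measurable_funM => //; apply: measurable_funM => //.
  exact: measurable_gauss.
move=> y _; rewrite lee_fin/= mulrC normrM -(mulrA K) [leRHS]normrM.
apply: ler_pM => //; first by apply: le_trans (bK y) (ler_norm _).
by apply: le_trans (norm_gauss_le _ s0) (ler_norm _).
Qed.

Lemma is_derive_gauss s y : is_derive y 1 (gauss s) (- (s * y) * gauss s y).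
Proof.
have d1 : is_derive y 1 (fun y => - (s * y ^+ 2 / 2)) (- (s * y)).
  have -> : (fun y : R => - (s * y ^+ 2 / 2)) = (- (s / 2)) *: ((@id R) ^+ 2).
    apply/funext => z; transitivity (- (s / 2) * z ^+ 2) => //.
    by field.
  by apply: is_derive_eq; rewrite /GRing.scale/=; field.
by apply: is_derive_eq; rewrite mulrC.
Qed.

Lemma is_derive_phase x c y : is_derive y 1 (fun y => x * y + c) x.
Proof.
have -> : (fun y : R => x * y + c) = x *: (@id R) + cst c by apply/funext.
by apply: is_derive_eq; rewrite /GRing.scale/= addr0 mulr1.
Qed.

Lemma is_derive_sin_phase x c y :
  is_derive y 1 (fun y => sin (x * y + c)) (x * cos (x * y + c)).
Proof.
have d1 := is_derive_phase x c y.
by apply: is_derive_eq; rewrite mulrC.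
Qed.

Lemma is_derive_cos_phase x c y :
  is_derive y 1 (fun y => cos (x * y + c)) (- (x * sin (x * y + c))).
Proof.
have d1 := is_derive_phase x c y.
by apply: is_derive_eq; rewrite mulrC mulrN.
Qed.

Lemma cvg_gauss_nat s : 0 < s -> gauss s n.+1%:R @[n --> \oo] --> (0 : R).
Proof.
move=> s0.
apply: (@squeeze_cvgr _ _ _ _ (fun=> 0) (fun n => (1 + 2 / s) * n.+1%:R^-1)); last 2 first.
- exact: cvg_cst.
- rewrite -[X in _ --> X](mulr0 (1 + 2 / s)); apply: cvgMr.
  exact: cvg_harmonic.
near=> n; rewrite gauss_ge0/= /gauss expRN.
have k0 : 0 < 1 + 2 / s by rewrite addr_gt0 ?divr_gt0.
rewrite ler_pdivlMr ?ltr0n// mulrC ler_pdivrMr ?expR_gt0//.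
apply: le_trans (ler_wpM2l (ltW k0) (expR_ge1Dx _)).
have : (1 : R) <= n.+1%:R by rewrite ler1n.
set m : R := n.+1%:R => m1.
have -> : (1 + 2 / s) * (1 + s * m ^+ 2 / 2) = 1 + 2 / s + s * m ^+ 2 / 2 + m ^+ 2.
  by field; rewrite gt_eqF.
have h1 : 0 <= 2 / s by rewrite divr_ge0 ?ltW.
have h2 : 0 <= s * m ^+ 2 / 2 by rewrite divr_ge0// mulr_ge0 ?sqr_ge0// ltW.
have h3 : m <= m ^+ 2 by rewrite expr2 ler_peMr// (le_trans _ m1).
lra.
Unshelve. all: by end_near. Qed.

Let bounded_sin x c (y : R) : `|sin (x * y + c)| <= 1.
Proof. exact: sin_max. Qed.
Let bounded_cos x c (y : R) : `|cos (x * y + c)| <= 1.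
Proof. exact: cos_max. Qed.
Let msin x c : measurable_fun setT (fun y => sin (x * y + c)).
Proof. by apply: (measurableT_comp measurable_sin); exact: measurable_funD. Qed.
Let mcos x c : measurable_fun setT (fun y => cos (x * y + c)).
Proof. by apply: (measurableT_comp measurable_cos); exact: measurable_funD. Qed.

(** Integration by parts: the derivative of a function that vanishes at both
    ends of the real line has integral zero. *)
Lemma gauss_by_parts s x c : 0 < s ->
  s * \int[mu]_y (y * gauss s y * sin (x * y + c)) =
  x * \int[mu]_y (gauss s y * cos (x * y + c)).
Proof.
move=> s0.
pose g y := gauss s y * sin (x * y + c).
pose dg y := - s * (y * gauss s y * sin (x * y + c)) + x * (gauss s y * cos (x * y + c)).
have i1 := integrable_id_gauss_mul s0 (msin x c) (bounded_sin x c).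
have i2 := integrable_gauss_mul s0 (mcos x c) (bounded_cos x c).
have idg : mu.-integrable setT (EFin \o dg).
  have := integrableD measurableT (integrableZl measurableT (- s) i1)
    (integrableZl measurableT x i2).
  by apply: eq_integrable => // y _; rewrite /dg/= EFinD !EFinM.
have dgE y : is_derive y 1 g (dg y).
  have d1 := is_derive_gauss s y; have d2 := is_derive_sin_phase x c y.
  by apply: is_derive_eq; rewrite /dg /GRing.scale/=; ring.
have cdg : continuous dg.
  have derc (k : R -> R) l y : is_derive y 1 k l -> {for y, continuous k}.
    by move=> kl; apply: differentiable_continuous; apply/derivable1_diffP; case: kl.
  move=> y; apply: cvgD.
    apply: cvgMr; apply: cvgM; last exact: derc (is_derive_sin_phase x c y).
    by apply: cvgM; [exact: cvg_id|exact: derc (is_derive_gauss s y)].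
  apply: cvgMr; apply: cvgM; first exact: derc (is_derive_gauss s y).
  exact: derc (is_derive_cos_phase x c y).
have ftc n : \int[mu]_(y in `[- n.+1%:R, n.+1%:R]) dg y = g n.+1%:R - g (- n.+1%:R).
  rewrite /Rintegral (@continuous_FTC2 _ dg g)//.
  - by rewrite ltrNl (lt_trans (_ : _ < 0))// oppr_lt0.
  - exact: continuous_subspaceT.
  - have cg y : {for y, continuous g}.
      by apply: differentiable_continuous; apply/derivable1_diffP; case: (dgE y).
    split; first by move=> y _; case: (dgE y).
    + by apply: cvg_at_right_filter; exact: cg.
    + by apply: cvg_at_left_filter; exact: cg.
  - by move=> y _; rewrite derive1E; case: (dgE y).
have c1 : \int[mu]_(y in `[- n.+1%:R, n.+1%:R]) dg y @[n --> \oo] --> \int[mu]_y dg y.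
  have [|||||_ _ hc] := @dominated_convergence _ _ _ mu _ measurableT
    (fun n y => (((dg \_ `[- n.+1%:R, n.+1%:R]) y)%:E)) (EFin \o dg) (abse \o (EFin \o dg)).
  - move=> n; apply/measurable_EFinP; apply/measurable_restrict => //.
    by apply: measurable_funS (continuous_measurable_fun cdg).
  - exact: measurable_int idg.
  - apply: aeW => y _; apply: cvg_near_cst; near=> n.
    rewrite /= patchE mem_set//= in_itv/= -ler_norml.
    near: n; exists (Num.truncn `|y|) => // k /= yk.
    by apply: ltW; apply: lt_le_trans (truncnS_gt _) _; rewrite ler_nat.
  - exact: integrable_abse.
  - apply: aeW => y n _; rewrite lee_fin/= patchE; case: ifPn => // _.
    by rewrite normr0.
  apply/fine_cvg; rewrite /Rintegral fineK; last exact: integrable_fin_num.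
  apply: cvg_trans hc; apply: near_eq_cvg; near=> n.
  by rewrite [RHS]integral_mkcond restrict_EFin.
have c2 : \int[mu]_(y in `[- n.+1%:R, n.+1%:R]) dg y @[n --> \oo] --> (0 : R).
  under eq_fun do rewrite ftc.
  have gb y : `|g y| <= gauss s y.
    by rewrite /g normrM (ger0_norm (gauss_ge0 _ _)) ler_piMr ?gauss_ge0.
  have b0 : (2 * gauss s n.+1%:R) @[n --> \oo] --> (0 : R).
    by rewrite -[X in _ --> X](mulr0 2); apply: cvgMr; exact: cvg_gauss_nat.
  apply/norm_cvg0P; apply: (@squeeze_cvgr _ _ _ _ (fun=> 0) _ _ _ _ (cvg_cst _) b0).
  near=> n; rewrite normr_ge0/=; apply: le_trans (ler_normB _ _) _.
  rewrite mulrDl mul1r; apply: lerD; first exact: gb.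
  by apply: le_trans (gb _) _; rewrite /gauss sqrrN.
have : \int[mu]_y dg y = 0 by apply: (cvg_unique _ c1 c2).
rewrite /dg RintegralD//; last 2 first.
- exact: (integrableZl measurableT _ i1).
- exact: (integrableZl measurableT _ i2).
rewrite !RintegralZl// => /eqP; rewrite mulNr addrC subr_eq0 => /eqP ->//.
Unshelve. all: by end_near. Qed.

(** Differentiating in the frequency x and integrating by parts shows that the
    left-hand side satisfies F' = - (x/s) F, whence F is a multiple of
    exp(-x^2/(2s)). The phase c covers sine and cosine at once. *)
Lemma gauss_oscillating s x c : 0 < s ->
  \int[mu]_y (gauss s y * cos (x * y + c)) =
  Num.sqrt (2 * pi / s) * gauss s^-1 x * cos c.
Proof.
move=> s0.
pose f x y := gauss s y * cos (x * y + c).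
pose F x := \int[mu]_y f x y.
have df z y : is_derive z (1 : R) (f ^~ y : R -> R) (- (y * gauss s y * sin (z * y + c))).
  have d1 : is_derive z (1 : R) (fun z : R => cos (z * y + c)) (- (y * sin (z * y + c))).
    rewrite (_ : (fun _ => _) = (fun z => cos (y * z + c))).
      by rewrite (mulrC z); exact: is_derive_cos_phase.
    by apply/funext => w; rewrite mulrC.
  have -> : f ^~ y = gauss s y *: (fun z => cos (z * y + c)) by apply/funext.
  by apply: is_derive_eq; rewrite /GRing.scale/=; ring.
have p1 z y : partial1of2 f z y = - (y * gauss s y * sin (z * y + c)).
  by rewrite /partial1of2 derive1E; case: (df z y).
pose G y := `|y * gauss s y|.
have iG : mu.-integrable setT (EFin \o G).
  have := integrable_abse (integrable_id_gauss_mul s0 (measurable_cst (1:R)) (fun=> lexx `|1|)).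
  by apply: eq_integrable => // y _; rewrite /G/= mulr1.
have inx : x \in `](x - 1), (x + 1)[ by rewrite in_itv/=; lra.
have ifz z : mu.-integrable setT (EFin \o f z).
  exact: (integrable_gauss_mul s0 (mcos z c) (bounded_cos z c)).
have Gub z y : `|partial1of2 f z y| <= G y.
  by rewrite p1 normrN normrM ler_piMr.
have dF z : is_derive z (1 : R) (F : R -> R) (- (z / s) * F z).
  have inz : `]z - 1, z + 1[%classic z by rewrite /= in_itv/=; lra.
  have der1 := @derivable_under_integral _ _ _ mu f setT measurableT z (z - 1) (z + 1) inz
    (fun z _ => ifz z) (fun z y _ _ => let: DeriveDef h _ := df z y in h) G
    (fun y => normr_ge0 _) iG (fun z y _ _ => Gub z y).
  have der2 := @differentiation_under_integral _ _ _ mu f setT measurableT z (z - 1) (z + 1) inz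
    (fun z _ => ifz z) (fun z y _ _ => let: DeriveDef h _ := df z y in h) G
    (fun y => normr_ge0 _) iG (fun z y _ _ => Gub z y).
  apply: DeriveDef => //; rewrite -derive1E der2.
  under eq_Rintegral do rewrite p1.
  have i1 := integrable_id_gauss_mul s0 (msin z c) (bounded_sin z c).
  transitivity (- \int[mu]_y (y * gauss s y * sin (z * y + c))).
    under eq_Rintegral do rewrite -mulN1r.
    by rewrite RintegralZl// mulN1r.
  have := gauss_by_parts z c s0; rewrite -/(F z) => e.
  apply: (mulfI (lt0r_neq0 s0)); rewrite mulrN e.
  by field; rewrite gt_eqF.
have dE z : is_derive z (1 : R) (fun z : R => expR (z ^+ 2 / s / 2)) (z / s * expR (z ^+ 2 / s / 2)).
  have -> : (fun z => expR (z ^+ 2 / s / 2)) = gauss (- s^-1).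
    by apply/funext => w; rewrite /gauss; congr expR; ring.
  have := is_derive_gauss (- s^-1) z.
  have -> : expR (z ^+ 2 / s / 2) = gauss (- s^-1) z.
    by rewrite /gauss; congr expR; ring.
  by have -> : - (- s^-1 * z) = z / s by ring.
have dFE z : is_derive z (1 : R) (fun z : R => F z * expR (z ^+ 2 / s / 2)) 0.
  have d1 := dF z; have d2 := dE z.
  by apply: is_derive_eq; rewrite /GRing.scale/=; ring.
have := is_derive_0_is_cst x 0 dFE; rewrite expr0n/= !mul0r expR0 mulr1.
have -> : F 0 = Num.sqrt (2 * pi / s) * cos c.
  rewrite -(Rintegral_gauss s0) -RintegralZr//; last exact: integrable_gauss.
  by apply: eq_Rintegral => y _; rewrite /f mul0r add0r.
move=> e; rewrite -/(F x) mulrAC -e.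
have -> : gauss s^-1 x = (expR (x ^+ 2 / s / 2))^-1.
  by rewrite -expRN /gauss; congr expR; ring.
by rewrite mulfK// gt_eqF// expR_gt0.
Qed.

(** The sine is a shifted cosine, so both components are instances of
    [gauss_oscillating]; the constant is written so that the Gaussian density of
    variance [s] appears. *)
Lemma gaussian_fourier s a : 0 < s ->
  cintegrable mu (fun y => cexp (- (s * y ^+ 2 / 2) +i* (a * y))) /\
  cintegral mu (fun y => cexp (- (s * y ^+ 2 / 2) +i* (a * y))) =
    (2 * pi * normal_pdf 0 (Num.sqrt s) a)%:C.
Proof.
move=> s0.
have cE y : complex.Re (cexp (- (s * y ^+ 2 / 2) +i* (a * y))) =
    gauss s y * cos (a * y + 0) by rewrite Re_cexp addr0.
have sE y : complex.Im (cexp (- (s * y ^+ 2 / 2) +i* (a * y))) =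
    gauss s y * cos (a * y + - (pi / 2)).
  rewrite Im_cexp/=; congr (_ * _).
  by rewrite cosD cosN cos_pihalf sinN sin_pihalf mulr0 add0r mulrN1 opprK.
split.
  split; under eq_fun do rewrite ?cE ?sE.
    exact: (integrable_gauss_mul s0 (mcos a 0) (bounded_cos a 0)).
  exact: (integrable_gauss_mul s0 (mcos a _) (bounded_cos a _)).
apply: complex_eqP.
  rewrite -[LHS]/(\int[mu]_y complex.Re (cexp (- (s * y ^+ 2 / 2) +i* (a * y)))).
  rewrite [RHS]/=; under eq_Rintegral do rewrite cE; rewrite gauss_oscillating// cos0 mulr1.
  rewrite normal_pdf_gauss// mulrA; congr (_ * _).
  have p0 : 0 < 2 * pi :> R by rewrite mulr_gt0 ?pi_gt0.
  rewrite !sqrtrM ?ltW// sqrtrV ?ltW// invfM mulrA; congr (_ / _).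
  rewrite -[X in _ = X / _]sqr_sqrtr; last by rewrite ltW.
  rewrite -sqrtrM// expr2 mulfK//.
  by rewrite gt_eqF// sqrtr_gt0.
rewrite -[LHS]/(\int[mu]_y complex.Im (cexp (- (s * y ^+ 2 / 2) +i* (a * y)))).
rewrite [RHS]/=; under eq_Rintegral do rewrite sE; rewrite gauss_oscillating//.
by rewrite cosN cos_pihalf mulr0.
Qed.

End gaussian_fourier.

(** * Product functions on the Euclidean space *)
Section lebesgue_rn_product.
Context {R : realType}.

Lemma measurable_rn_cons n : measurable_fun setT (@rn_cons R n).
Proof. exact: measurable_cons. Qed.

Lemma lebesgue_rnS n A : lebesgue_rn R n.+1 A =
  (@lebesgue_measure R \x lebesgue_rn R n)%E (@rn_cons R n @^-1` A).
Proof. by []. Qed.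

Lemma prod_rn_cons (A : comPzSemiRingType) n (f : 'I_n.+1 -> measurableTypeR R -> A)
    (z : measurableTypeR R * Rn R n) :
  \prod_(i < n.+1) f i (tnth (rn_cons z) i) =
  f ord0 z.1 * \prod_(i < n) f (lift ord0 i) (tnth z.2 i).
Proof. by rewrite big_ord_recl; congr (_ * _); apply: eq_bigr => i _; rewrite tnthS. Qed.

Lemma measurable_prod_rn n (f : 'I_n -> measurableTypeR R -> R) :
  (forall i, measurable_fun setT (f i)) ->
  measurable_fun setT (fun y : Rn R n => \prod_(i < n) f i (tnth y i)).
Proof.
move=> mf; apply: measurable_prod => i _.
exact: (measurableT_comp (mf i) (measurable_tnth i)).
Qed.

Lemma cmeasurable_prod_rn n (f : 'I_n -> measurableTypeR R -> R[i]) :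
  (forall i, cmeasurable (f i)) ->
  cmeasurable (fun y : Rn R n => \prod_(i < n) f i (tnth y i)).
Proof.
move=> mf; apply: cmeasurable_prod => i.
exact: (cmeasurable_comp (mf i) (measurable_tnth i)).
Qed.

Lemma ge0_integral_prod_rn n (f : 'I_n -> measurableTypeR R -> R) :
  (forall i, measurable_fun setT (f i)) -> (forall i x, 0 <= f i x) ->
  (\int[lebesgue_rn R n]_y (\prod_(i < n) f i (tnth y i))%:E =
   \prod_(i < n) \int[@lebesgue_measure R]_x (f i x)%:E)%E.
Proof.
elim: n f => [|n IH] f mf f0.
  rewrite big_ord0 /=; under eq_integral do rewrite big_ord0.
  by rewrite integral_cst//= diracE mem_set// mule1.
rewrite (ge0_integral_image (@measurable_rn_cons n) (fun A _ => lebesgue_rnS A)); last 2 first.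
- by apply/measurable_EFinP; exact: measurable_prod_rn.
- by move=> y; rewrite lee_fin prodr_ge0.
rewrite (fubini_tonelli1 (fun z => (\prod_(i < n.+1) f i (tnth (rn_cons z) i))%:E)); last 2 first.
- apply/measurable_EFinP.
  exact: (measurableT_comp (measurable_prod_rn mf) (@measurable_rn_cons n)).
- by move=> y; rewrite lee_fin prodr_ge0.
rewrite big_ord_recl -IH// /fubini_F/=.
under eq_integral => x _.
  under eq_integral do rewrite prod_rn_cons EFinM/=.
  rewrite ge0_integralZl//=; last 3 first.
  - apply/measurable_EFinP.
    by apply: (@measurable_prod_rn n (fun i => f (lift ord0 i))) => i; exact: mf.
  - by move=> y _; rewrite lee_fin prodr_ge0.
  - by rewrite lee_fin.
  over.
rewrite ge0_integralZr//=.
- by apply/measurable_EFinP; exact: mf.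
- by move=> x _; rewrite lee_fin.
- by apply: integral_ge0 => y _; rewrite lee_fin prodr_ge0.
Qed.

Lemma cintegral_prod_rn n (f : 'I_n -> measurableTypeR R -> R[i]) :
  (forall i, cintegrable (@lebesgue_measure R) (f i)) ->
  cintegrable (lebesgue_rn R n) (fun y => \prod_(i < n) f i (tnth y i)) /\
  cintegral (lebesgue_rn R n) (fun y => \prod_(i < n) f i (tnth y i)) =
  \prod_(i < n) cintegral (@lebesgue_measure R) (f i).
Proof.
elim: n f => [|n IH] f fi.
  rewrite big_ord0; under [X in cintegrable _ X]eq_fun do rewrite big_ord0.
  split; first split.
  - apply/integrableP; split; first exact: measurable_cst.
    rewrite [X in (X < _)%E](_ : _ = 1%E) ?ltry//.
    transitivity (1 * (lebesgue_rn R 0) setT)%E.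
      by rewrite -integral_cst//; apply: eq_integral=> y _; rewrite /= normr1.
    by rewrite /= diracE mem_set//= mule1.
  - exact: integrable0.
  under eq_cintegral do rewrite big_ord0.
  apply: complex_eqP => /=; rewrite Rintegral_cst//= ?mul0r//.
  by rewrite indicE mem_set// mulr1.
have mf i : cmeasurable (f i) by exact: cintegrable_cmeasurable (fi i).
have [gi ge] := IH _ (fun i => fi (lift ord0 i)).
have [ti te] := cintegral_tensor (fi ord0) gi.
have mc := @measurable_rn_cons n.
have mp := cmeasurable_prod_rn mf.
split.
  apply/(cintegrable_image mc (fun A _ => lebesgue_rnS A) mp).
  by under eq_fun do rewrite prod_rn_cons.
rewrite (cintegral_image mc (fun A _ => lebesgue_rnS A) mp).
under eq_cintegral do rewrite prod_rn_cons.
by rewrite te ge big_ord_recl.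
Qed.

End lebesgue_rn_product.

(** * Fourier inversion for mixtures of Gaussian densities *)

Lemma measurable_invr {R : realType} : measurable_fun setT (@GRing.inv R).
Proof.
(* The factor x makes both sides vanish at 0. *)
rewrite (_ : GRing.inv = fun x : R => x * expR (- ln (x ^+ 2))); last first.
  apply/funext => x; have [->|x0] := eqVneq x 0; first by rewrite invr0 mul0r.
  have x20 : 0 < x ^+ 2 by rewrite exprn_even_gt0.
  by rewrite expRN lnK ?posrE// expr2 invfM mulrA divff// mul1r.
apply: measurable_funM => //; apply: measurableT_comp => //.
apply: measurableT_comp => //; apply: (measurableT_comp (@measurable_ln R)).
exact: measurable_funX.
Qed.

Lemma measurable_sqrtr {R : realType} : measurable_fun setT (@Num.sqrt R).
Proof. by apply: continuous_measurable_fun; exact: sqrt_continuous. Qed.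

(** The positive part of f - f_k is dominated by f; since the masses are equal,
    the negative part has the same integral as the positive part. *)
Lemma scheffe d (T : measurableType d) (R : realType)
    (mu : {measure set T -> \bar R}) (f_ : nat -> T -> R) (f : T -> R) :
  mu.-integrable setT (EFin \o f) ->
  (forall k, mu.-integrable setT (EFin \o f_ k)) ->
  (forall x, 0 <= f x) -> (forall k x, 0 <= f_ k x) ->
  (forall k, \int[mu]_x f_ k x = \int[mu]_x f x) ->
  (forall x, f_ k x @[k --> \oo] --> f x) ->
  (\int[mu]_x (`|f x - f_ k x|)%:E @[k --> \oo] --> (0 : \bar R))%E.
Proof.
move=> fi f_i f0 f_0 f_f cf.
pose g k x := Num.max (f x - f_ k x) 0.
have mf : measurable_fun setT f by apply/measurable_EFinP; exact: measurable_int fi.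
have mf_ k : measurable_fun setT (f_ k).
  by apply/measurable_EFinP; exact: measurable_int (f_i k).
have mg k : measurable_fun setT (g k).
  by apply: measurable_maxr => //; exact: measurable_funB.
have g0 k x : 0 <= g k x by rewrite le_max lexx orbT.
have gf k x : g k x <= f x by rewrite ge_max f0 gerBl f_0.
have gi k : mu.-integrable setT (EFin \o g k).
  apply: le_integrable fi => //; first exact/measurable_EFinP.
  by move=> x _; rewrite lee_fin !ger0_norm.
have [|||||_ _ hc] := @dominated_convergence _ _ _ mu _ measurableT
    (fun k x => (g k x)%:E) (fun=> 0%E) (EFin \o f).
- by move=> k; exact/measurable_EFinP.
- exact: measurable_cst.
- apply: aeW => x _; apply: cvg_EFin; first exact: nearW.
  have h0 : `|f x - f_ k x| @[k --> \oo] --> (0 : R).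
    rewrite -(normr0 R) -[X in `|X|](subrr (f x)); apply: cvg_norm.
    by apply: cvgB => //; exact: cvg_cst.
  apply: (@squeeze_cvgr _ _ _ _ (fun=> 0) _ _ _ _ (cvg_cst _) h0).
  by apply: nearW => k; rewrite /= g0 ge_max ler_norm normr_ge0.
- exact: fi.
- by apply: aeW => x k _; rewrite lee_fin ger0_norm.
have absE k : (\int[mu]_x (`|f x - f_ k x|)%:E = 2%:E * \int[mu]_x (g k x)%:E)%E.
  have e x : `|f x - f_ k x| = 2 * g k x - (f x - f_ k x).
    rewrite /g; case: (leP (f x - f_ k x) 0) => h.
      by rewrite ler0_norm// mulr0 sub0r.
    by rewrite gtr0_norm//; ring.
  under eq_integral do rewrite e EFinB EFinM.
  rewrite integralB//=; last 2 first.
  - exact: (integrableZl measurableT 2 (gi k)).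
  - exact: (integrableB measurableT fi (f_i k)).
  rewrite integralZl; [|by []|exact: gi].
  have -> : (\int[mu]_x (f x - f_ k x)%:E = 0)%E; last by rewrite sube0.
  under eq_integral do rewrite EFinB; rewrite integralB//; try exact: fi; try exact: f_i.
  have -> : (\int[mu]_x (f_ k x)%:E = \int[mu]_x (f x)%:E)%E.
    rewrite -[LHS]fineK ?(integrable_fin_num _ (f_i k))//.
    rewrite -[RHS]fineK ?(integrable_fin_num _ fi)//.
    by congr EFin; exact: f_f.
  by rewrite subee// (integrable_fin_num _ fi).
apply: (eq_cvg_nat absE); rewrite -[X in _ --> X](mule0 2%:E); apply: cvgeZl => //.
by move: hc; rewrite integral0.
Qed.

Section normal_density.
Context {R : realType}.
Implicit Types v z x a : R.

(** The centred Gaussian density, parametrized by its variance. *)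
Definition npdf v z : R := (Num.sqrt (2 * pi * v))^-1 * gauss v^-1 z.

Lemma npdf_ge0 v z : 0 <= npdf v z.
Proof. by rewrite mulr_ge0 ?gauss_ge0// invr_ge0 sqrtr_ge0. Qed.

Lemma npdf_le v z : 0 <= v -> npdf v z <= (Num.sqrt (2 * pi * v))^-1.
Proof.
move=> v0; rewrite ler_piMr ?invr_ge0 ?sqrtr_ge0// /gauss -expR0 ler_expR.
by rewrite oppr_le0 divr_ge0// mulr_ge0 ?invr_ge0// sqr_ge0.
Qed.

Lemma npdf_normal_pdf v a x : 0 < v -> npdf v (x - a) = normal_pdf a (Num.sqrt v) x.
Proof.
move=> v0; rewrite /npdf -normal_pdf_gauss// !normal_pdfE ?gt_eqF ?sqrtr_gt0//.
by rewrite /normal_fun subr0.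
Qed.

Lemma integral_npdf v a : 0 < v ->
  (\int[@lebesgue_measure R]_x (npdf v (x - a))%:E = 1)%E.
Proof.
move=> v0; under eq_integral do rewrite npdf_normal_pdf//.
exact: integral_normal_pdf.
Qed.

Lemma measurable_npdf d (T : measurableType d) (f g : T -> R) :
  measurable_fun setT f -> measurable_fun setT g ->
  measurable_fun setT (fun t => npdf (f t) (g t)).
Proof.
move=> mf mg; apply: measurable_funM.
  apply: (measurableT_comp measurable_invr); apply: (measurableT_comp measurable_sqrtr).
  exact: measurable_funM.
apply: measurableT_comp => //; apply: measurableT_comp => //.
apply: measurable_funM => //; apply: measurable_funM.
  exact: (measurableT_comp measurable_invr).
exact: measurable_funX.
Qed.

Lemma cvg_npdf (v_ : nat -> R) v z : 0 < v -> v_ k @[k --> \oo] --> v ->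
  npdf (v_ k) z @[k --> \oo] --> npdf v z.
Proof.
move=> v0 cv; apply: cvgM.
  apply: cvgV; first by rewrite gt_eqF// sqrtr_gt0 !mulr_gt0// pi_gt0.
  apply: (@continuous_cvg _ _ _ _ _ _ (@Num.sqrt R)); first exact: sqrt_continuous.
  exact: cvgMr.
apply: (@continuous_cvg _ _ _ _ _ _ (@expR R)); first exact: continuous_expR.
apply: cvgN; apply: cvgMl; apply: cvgMl; apply: cvgV => //.
by rewrite gt_eqF.
Qed.

End normal_density.

Lemma cvg_prod_nat (R : realType) (I : Type) (r : seq I) (f : I -> nat -> R) (l : I -> R) :
  (forall i, f i k @[k --> \oo] --> l i) ->
  \prod_(i <- r) f i k @[k --> \oo] --> \prod_(i <- r) l i.
Proof.
move=> fl; elim: r => [|i r IH].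
  by rewrite big_nil; under eq_fun do rewrite big_nil; exact: cvg_cst.
by rewrite big_cons; under eq_fun do rewrite big_cons; exact: cvgM.
Qed.

Section gaussian_mixture.
Context d (T : measurableType d) (R : realType) (P : probability T R) (n : nat).
Variables (w : T -> R) (m s : 'I_n -> T -> R).
Hypothesis mw : measurable_fun setT w.
Hypothesis w0 : forall o, 0 <= w o.
Hypothesis wi : P.-integrable setT (EFin \o w).
Hypotheses (mm : forall i, measurable_fun setT (m i))
  (ms : forall i, measurable_fun setT (s i)) (s0 : forall i o, 0 < s i o).

(** [mixture 0] is the density of a weighted mixture of Gaussian laws with
    independent coordinates, [mixture_fourier] its Fourier transform, and
    [mixture e] its convolution with the Gaussian law of variance [e]. *)
Definition mixand (e : R) (A : Rn R n) (o : T) : R :=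
  w o * \prod_(i < n) npdf (s i o + e) (tnth A i - m i o).

Definition mixture e A : \bar R := (\int[P]_o (mixand e A o)%:E)%E.

Definition mixture_fourier (y : Rn R n) : R[i] := cintegral P (fun o =>
  (w o)%:C * \prod_(i < n) cexp (- (s i o * tnth y i ^+ 2 / 2) +i* (- (m i o * tnth y i)))).

Notation lambda := (lebesgue_rn R n).

Lemma mixand_ge0 e A o : 0 <= mixand e A o.
Proof. by rewrite mulr_ge0// prodr_ge0// => i _; exact: npdf_ge0. Qed.

Lemma measurable_mixand e : measurable_fun setT
  (fun z : Rn R n * T => mixand e z.1 z.2).
Proof.
apply: measurable_funM; first exact: (measurableT_comp mw measurable_snd).
apply: measurable_prod => i _; apply: measurable_npdf.
  by apply: measurable_funD => //; exact: (measurableT_comp (ms i) measurable_snd).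
apply: measurable_funB; last exact: (measurableT_comp (mm i) measurable_snd).
exact: (measurableT_comp (measurable_tnth i) measurable_fst).
Qed.

Let se_gt0 e i o : 0 <= e -> 0 < s i o + e.
Proof. by move=> e0; rewrite ltr_wpDr. Qed.

Lemma integral_mixand e o : 0 <= e ->
  (\int[lambda]_A (mixand e A o)%:E = (w o)%:E)%E.
Proof.
move=> e0; under eq_integral do rewrite /mixand EFinM.
rewrite ge0_integralZl//=.
- rewrite (ge0_integral_prod_rn (f := fun i x => npdf (s i o + e) (x - m i o))).
  + by rewrite big1 ?mule1// => i _; rewrite integral_npdf// se_gt0.
  + by move=> i; apply: measurable_npdf => //; exact: measurable_funB.
  + by move=> i x; exact: npdf_ge0.
- apply/measurable_EFinP/measurable_prod => i _; apply: measurable_npdf => //.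
  by apply: measurable_funB => //; exact: measurable_tnth.
- by move=> A _; rewrite lee_fin prodr_ge0// => i _; exact: npdf_ge0.
- by rewrite lee_fin.
Qed.

Lemma cintegrable_mixture_fourier (y : Rn R n) : cintegrable P (fun o => (w o)%:C *
  \prod_(i < n) cexp (- (s i o * tnth y i ^+ 2 / 2) +i* (- (m i o * tnth y i)))).
Proof.
apply: (cintegrable_le (g := w)) => //.
  apply: cmeasurableM; first exact: cmeasurable_real.
  apply: cmeasurable_prod => i; apply: cmeasurable_exp; split => /=.
    by apply: measurableT_comp => //; apply: measurable_funM => //; exact: measurable_funM.
  by apply: measurableT_comp => //; exact: measurable_funM.
move=> o; rewrite ComplexField.Normc.normcM normc_real ger0_norm// ler_piMr//.
rewrite normc_prod; apply: prodr_ile1 => i; rewrite normc_ge0 normc_cexp -expR0.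
by rewrite ler_expR/= oppr_le0 divr_ge0// mulr_ge0 ?sqr_ge0// ltW.
Qed.

(** The Gauss-damped Fourier integral of the mixture is the smoothed mixture:
    exchange the integrals and use the Fourier transform of a Gaussian. *)
Lemma damped_fourier e A : 0 < e ->
  [/\ cintegrable lambda (fun y => gauss_damped e mixture_fourier y *
        \prod_(i < n) cexp ('i * (tnth A i * tnth y i)%:C)),
      P.-integrable setT (EFin \o mixand e A) &
      cintegral lambda (fun y => gauss_damped e mixture_fourier y *
        \prod_(i < n) cexp ('i * (tnth A i * tnth y i)%:C)) =
      ((2 * pi) ^+ n * \int[P]_o mixand e A o)%:C].
Proof.
move=> e0.
pose phase i o (z : R) : R[i] :=
  - ((s i o + e) * z ^+ 2 / 2) +i* ((tnth A i - m i o) * z).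
pose H (z : Rn R n * T) : R[i] := (w z.2)%:C *
  \prod_(i < n) cexp (phase i z.2 (tnth z.1 i)).
have mH : cmeasurable H.
  apply: cmeasurableM.
    exact: (cmeasurable_comp (cmeasurable_real mw) measurable_snd).
  apply: cmeasurable_prod => i; apply: cmeasurable_exp.
  have m1 : measurable_fun setT (fun z : Rn R n * T => tnth z.1 i).
    exact: (measurableT_comp (measurable_tnth i) measurable_fst).
  have m2 := measurableT_comp (mm i) (@measurable_snd _ _ (Rn R n) T).
  have m3 := measurableT_comp (ms i) (@measurable_snd _ _ (Rn R n) T).
  split => /=.
    apply: measurableT_comp => //; apply: measurable_funM => //.
    apply: measurable_funM; first exact: measurable_funD.
    exact: measurable_funX.
  by apply: measurable_funM => //; exact: measurable_funB.
have gci : cintegrable (@lebesgue_measure R) (fun z => (gauss e z)%:C).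
  by split; [exact: integrable_gauss|exact: integrable0].
have [di _] := @cintegral_prod_rn R n (fun _ z => (gauss e z)%:C) (fun=> gci).
have wci : cintegrable P (fun o => (w o)%:C) by split => //; exact: integrable0.
have [ti _] := cintegral_tensor di wci.
have iH : cintegrable (lambda \x P)%E H.
  apply: (cintegrable_le mH (cintegrable_normc ti)) => z.
  rewrite /H !ComplexField.Normc.normcM mulrC ler_wpM2r ?normc_ge0//.
  rewrite !normc_prod; apply: ler_prod => i _; apply/andP; split; first exact: normc_ge0.
  rewrite normc_cexp normc_real ger0_norm ?gauss_ge0// ler_expR/= lerN2.
  rewrite ler_pM2r// ler_wpM2r ?sqr_ge0// lerDr ltW//.
have wphi := cintegrable_mixture_fourier.
have HE y : cintegral P (fun o => H (y, o)) = gauss_damped e mixture_fourier y *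
        \prod_(i < n) cexp ('i * (tnth A i * tnth y i)%:C).
  rewrite /gauss_damped mulrAC -[RHS]mulrA mulrC -cintegralZ//.
  apply: eq_cintegral => o; rewrite /H /= mulrCA; congr (_ * _).
  have -> : (expR (- (e * (\sum_(i < n) tnth y i ^+ 2) / 2)))%:C =
      \prod_(i < n) cexp (- (e * tnth y i ^+ 2 / 2))%:C.
    rewrite -cexp_sum -cexp_real; congr cexp.
    by rewrite -(rmorph_sum (real_complex R)) sumrN mulr_sumr mulr_suml.
  rewrite -!big_split/=; apply: eq_bigr => i _; rewrite -!cexpD; congr cexp.
  by apply: complex_eqP => /=; ring.
have HF o : cintegral lambda (fun y => H (y, o)) = ((2 * pi) ^+ n * mixand e A o)%:C.
  have fi i := gaussian_fourier (tnth A i - m i o) (se_gt0 i o (ltW e0)).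
  have [pi1 pi2] := cintegral_prod_rn (fun i => (fi i).1).
  rewrite /H /= cintegralZ// pi2.
  under eq_bigr do rewrite (fi _).2 (normal_pdf_gauss _ (se_gt0 _ _ (ltW e0))).
  rewrite -(rmorph_prod (real_complex R)) -(rmorphM (real_complex R)) big_split/=.
  by rewrite prodr_const card_ord mulrCA.
have [h1 h2] := cintegral_fubini1 iH.
have h3 := cintegral_fubini2 iH.
have pn0 : (2 * pi) ^+ n != 0 :> R by rewrite expf_neq0// mulf_neq0// gt_eqF// pi_gt0.
have qi : P.-integrable setT (EFin \o mixand e A).
  pose K : R := (Num.sqrt (2 * pi * e))^-1 ^+ n.
  apply: (le_integrable measurableT _ _ (integrableZl measurableT K wi)).
    apply/measurable_EFinP; exact: (measurableT_comp (measurable_mixand e) (measurable_pair1 A)).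
  move=> o _; rewrite lee_fin/= ger0_norm ?mixand_ge0//.
  apply: le_trans (ler_norm _); rewrite /mixand mulrC ler_wpM2r//.
  rewrite /K -[X in _ ^+ X](card_ord n) -prodr_const; apply: ler_prod => i _.
  rewrite npdf_ge0/=; apply: le_trans (npdf_le _ (ltW (se_gt0 i o (ltW e0)))) _.
  have pp : 0 < 2 * pi :> R by rewrite mulr_gt0 ?pi_gt0.
  have pe := mulr_gt0 pp e0; have pv := mulr_gt0 pp (se_gt0 i o (ltW e0)).
  rewrite lef_pV2 ?posrE ?sqrtr_gt0// ler_sqrt; last exact: ltW.
  by rewrite ler_pM2l// lerDr ltW.
split => //.
  by move: h1; under eq_fun do rewrite HE.
transitivity (cintegral lambda (fun y => cintegral P (fun o => H (y, o)))).
  by apply: eq_cintegral => y; rewrite HE.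
rewrite -h2 h3; under eq_cintegral do rewrite HF.
apply: complex_eqP => /=; last by rewrite Rintegral_cst// mul0r.
by rewrite RintegralZl.
Qed.

Let e_ge0 (e_ : nat -> R) : (forall k, 0 < e_ k) -> forall k, 0 <= e_ k.
Proof. by move=> e0 k; exact/ltW/e0. Qed.

Lemma integrable_mixand e : 0 <= e ->
  (lambda \x P)%E.-integrable setT (fun z => (mixand e z.1 z.2)%:E) /\
  \int[(lambda \x P)%E]_z (mixand e z.1 z.2) = \int[P]_o w o.
Proof.
move=> e0.
have E : (\int[(lambda \x P)%E]_z (mixand e z.1 z.2)%:E = \int[P]_o (w o)%:E)%E.
  rewrite fubini_tonelli2//=.
  - by apply: eq_integral => o _; exact: integral_mixand.
  - by apply/measurable_EFinP; exact: measurable_mixand.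
  - by move=> z; rewrite lee_fin mixand_ge0.
split; last by rewrite /Rintegral E.
apply/integrableP; split.
  by apply/measurable_EFinP; exact: measurable_mixand.
under eq_integral do rewrite gee0_abs ?lee_fin ?mixand_ge0//.
rewrite E; have /integrableP[_] := wi.
by under eq_integral do rewrite gee0_abs ?lee_fin//.
Qed.

(** Smoothing by a Gaussian law of vanishing variance converges in L1: the
    components are themselves Gaussian, so only their variances move, and their
    densities converge pointwise with constant mass. *)
Lemma cvg_smoothing (e_ : nat -> R) : (forall k, 0 < e_ k) ->
  e_ k @[k --> \oo] --> (0 : R) ->
  (\int[lambda]_A \int[P]_o (`|mixand 0 A o - mixand (e_ k) A o|)%:E
    @[k --> \oo] --> (0 : \bar R))%E.
Proof.
move=> e0 ce; have [i0 E0] := integrable_mixand (lexx 0).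
have := @scheffe _ _ _ (lambda \x P)%E (fun k z => mixand (e_ k) z.1 z.2)
  (fun z => mixand 0 z.1 z.2) i0 (fun k => (integrable_mixand (e_ge0 e0 k)).1).
move=> /(_ (fun z => mixand_ge0 _ _ _) (fun k z => mixand_ge0 _ _ _)) h.
have {h}/h : forall k, \int[(lambda \x P)%E]_z (mixand (e_ k) z.1 z.2) =
    \int[(lambda \x P)%E]_z mixand 0 z.1 z.2.
  by move=> k; rewrite E0 (integrable_mixand (e_ge0 e0 k)).2.
move=> h; have {h}/h : forall z : Rn R n * T,
    mixand (e_ k) z.1 z.2 @[k --> \oo] --> mixand 0 z.1 z.2.
  move=> z; apply: cvgMr.
  apply: (cvg_prod_nat (f := fun i k => npdf (s i z.2 + e_ k) (tnth z.1 i - m i z.2))).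
  move=> i; rewrite addr0; apply: cvg_npdf => //.
  by rewrite -[X in _ --> X]addr0; apply: cvgD => //; exact: cvg_cst.
apply: cvg_trans; apply: near_eq_cvg; apply: nearW => k.
rewrite fubini_tonelli1//=.
apply/measurable_EFinP; apply: measurableT_comp => //.
by apply: measurable_funB; exact: measurable_mixand.
Qed.

Lemma measurable_mixture e : measurable_fun setT (mixture e).
Proof.
apply: (@measurable_fun_fubini_tonelli_F _ _ _ _ _ P
  (fun z : Rn R n * T => (mixand e z.1 z.2)%:E)).
  by apply/measurable_EFinP; exact: measurable_mixand.
by move=> z; rewrite lee_fin mixand_ge0.
Qed.

Lemma mixture_dist e A : 0 < e ->
  (`|mixture 0 A - mixture e A| <=
   \int[P]_o (`|mixand 0 A o - mixand e A o|)%:E)%E.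
Proof.
move=> e0; have [_ ie _] := damped_fourier A e0.
have mA e1 : measurable_fun setT (mixand e1 A).
  exact: (measurableT_comp (measurable_mixand e1) (measurable_pair1 A)).
have [lt_oo|] := ltP (\int[P]_o (`|mixand 0 A o - mixand e A o|)%:E)%E +oo%E; last first.
  by rewrite leye_eq => /eqP ->; rewrite leey.
have id : P.-integrable setT (EFin \o (fun o => mixand 0 A o - mixand e A o)).
  apply/integrableP; split => //.
  by apply/measurable_EFinP; exact: measurable_funB.
rewrite [X in (X - _)%E](_ : _ = \int[P]_o ((mixand 0 A o - mixand e A o)%:E + (mixand e A o)%:E))%E.
  rewrite integralD// addeK ?integrable_fin_num//.
  by apply: le_abse_integral => //; exact: measurable_int id.
by apply: eq_integral => o _; rewrite -EFinD subrK.
Qed.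

(** Averaging does not increase the L1 distance, so [cvg_smoothing] for the
    components is enough; limits along [e] are tested on sequences. *)
Lemma cvg_mixture : (\int[lambda]_A `|mixture 0 A - mixture e A|
    @[e --> (0 : R)^'+] --> (0 : \bar R))%E.
Proof.
apply/cvge_at_rightP => e_ [e0 ce].
apply: (@squeeze_cvge _ _ _ _ (fun=> 0%E) _ _ _ _ (cvg_cst _) (cvg_smoothing e0 ce)).
apply: nearW => k; rewrite integral_ge0//=; apply: ge0_le_integral => //=.
- by apply: measurableT_comp => //; apply: emeasurable_funB; exact: measurable_mixture.
- apply: (@measurable_fun_fubini_tonelli_F _ _ _ _ _ P
    (fun z : Rn R n * T => (`|mixand 0 z.1 z.2 - mixand (e_ k) z.1 z.2|)%:E)).
    apply/measurable_EFinP; apply: measurableT_comp => //.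
    by apply: measurable_funB; exact: measurable_mixand.
  by move=> z; rewrite lee_fin.
- by move=> A _; exact: mixture_dist.
Qed.

(** Fourier inversion when the transform is integrable: the smoothed densities
    converge pointwise by dominated convergence, and to the mixture in L1. *)
Lemma mixture_inversion : cintegrable lambda mixture_fourier ->
  {ae lambda, forall A,
    cintegral lambda (fun y => mixture_fourier y *
      \prod_(i < n) cexp ('i * (tnth A i * tnth y i)%:C)) =
    ((2 * pi) ^+ n)%:C * (fine (mixture 0 A))%:C /\ mixture 0 A \is a fin_num}.
Proof.
move=> iPhi.
pose unit A y : R[i] := \prod_(i < n) cexp ('i * (tnth A i * tnth y i)%:C).
have munit A : cmeasurable (unit A).
  apply: cmeasurable_prod => i; apply: cmeasurable_exp; split => /=.
    rewrite (_ : (fun _ => _) = cst 0); first exact: measurable_cst.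
    by apply/funext => y /=; ring.
  rewrite (_ : (fun _ => _) = (fun y : Rn R n => tnth A i * tnth y i)).
    by apply: measurable_funM => //; exact: measurable_tnth.
  by apply/funext => y /=; ring.
have nunit A y : normc (unit A y) = 1.
  rewrite normc_prod big1// => i _; rewrite normc_cexp/= mul0r mul1r subrr.
  by rewrite expR0.
have pn0 : (2 * pi) ^+ n != 0 :> R by rewrite expf_neq0// mulf_neq0// gt_eqF// pi_gt0.
pose e_ k : R := k.+1%:R^-1.
have e0 k : 0 < e_ k by rewrite invr_gt0 ltr0n.
have ce : e_ k @[k --> \oo] --> (0 : R) by exact: cvg_harmonic.
pose F A := cintegral lambda (fun y => mixture_fourier y * unit A y).
have mPhi := cintegrable_cmeasurable iPhi.
have mg k : cmeasurable (gauss_damped (e_ k) mixture_fourier).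
  have me : measurable_fun setT
      (fun y : Rn R n => expR (- (e_ k * (\sum_(i < n) tnth y i ^+ 2) / 2))).
    apply: measurableT_comp => //; apply: measurableT_comp => //.
    apply: measurable_funM => //; apply: measurable_funM => //.
    by apply: measurable_sum => i; apply: measurable_funX; exact: measurable_tnth.
  exact: (cmeasurableM mPhi (cmeasurable_real me)).
have cF A : complex.Im (F A) = 0 /\
    (fine (mixture (e_ k) A)) @[k --> \oo] --> complex.Re (F A) / (2 * pi) ^+ n.
  have [|||||_ c1 c2] := @cvg_cintegral _ _ _ lambda
    (fun k y => gauss_damped (e_ k) mixture_fourier y * unit A y)
    (fun y => mixture_fourier y * unit A y) (fun y => normc (mixture_fourier y)).
  - by move=> k; exact: (cmeasurableM (mg k) (munit A)).
  - exact: (cmeasurableM mPhi (munit A)).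
  - exact: cintegrable_normc.
  - apply: aeW => y k; rewrite !ComplexField.Normc.normcM nunit mulr1 ler_piMr ?normc_ge0//.
    rewrite normc_real ger0_norm ?expR_ge0// -expR0 ler_expR oppr_le0 divr_ge0//.
    by apply: mulr_ge0; [exact: ltW|apply: sumr_ge0 => i _; exact: sqr_ge0].
  - apply: aeW => y; set q : R := \sum_(i < n) tnth y i ^+ 2.
    have E1 k : gauss_damped (e_ k) mixture_fourier y * unit A y =
       (expR (- (e_ k * (q / 2))))%:C * (mixture_fourier y * unit A y).
      by rewrite /gauss_damped mulrAC [LHS]mulrC -/q (mulrA (e_ k)).
    have cq : expR (- (e_ k * (q / 2))) @[k --> \oo] --> (1 : R).
      rewrite [X in _ --> X](_ : _ = expR (- 0)); last by rewrite oppr0 expR0.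
      apply: (@continuous_cvg _ _ _ _ _ _ (@expR R)); first exact: continuous_expR.
      by apply: cvgN; rewrite -[X in _ --> X](mul0r (q / 2)); exact: cvgMl.
    have E3 k : complex.Re (gauss_damped (e_ k) mixture_fourier y * unit A y) =
        expR (- (e_ k * (q / 2))) * complex.Re (mixture_fourier y * unit A y).
      by rewrite E1 ReM/= mul0r subr0.
    have E4 k : complex.Im (gauss_damped (e_ k) mixture_fourier y * unit A y) =
        expR (- (e_ k * (q / 2))) * complex.Im (mixture_fourier y * unit A y).
      by rewrite E1 ImM/= mul0r addr0.
    by split; [apply: (eq_cvg_nat E3)|apply: (eq_cvg_nat E4)];
      rewrite -[X in _ --> X]mul1r; exact: cvgMl.
  have E2 k : cintegral lambda (fun y => gauss_damped (e_ k) mixture_fourier y * unit A y)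
      = ((2 * pi) ^+ n * fine (mixture (e_ k) A))%:C.
    by have [_ _] := damped_fourier A (e0 k).
  split.
    have c0 : complex.Im (((2 * pi) ^+ n * fine (mixture (e_ k) A))%:C) @[k --> \oo] --> (0 : R).
      exact: cvg_cst.
    apply: (cvg_unique _ _ c0) => //.
    exact: (eq_cvg_nat (fun k => congr1 (@complex.Im R) (esym (E2 k)))).
  have c3 : complex.Re ((2 * pi) ^+ n * fine (mixture (e_ k) A))%:C @[k --> \oo] -->
      complex.Re (F A).
    exact: (eq_cvg_nat (fun k => congr1 (@complex.Re R) (esym (E2 k)))).
  have E5 k : fine (mixture (e_ k) A) =
      complex.Re (((2 * pi) ^+ n * fine (mixture (e_ k) A))%:C) / (2 * pi) ^+ n.
    by rewrite /= mulrAC mulfV// mul1r.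
  by apply: (eq_cvg_nat E5); exact: cvgMl.
pose M A := complex.Re (F A) / (2 * pi) ^+ n.
have fk k A : mixture (e_ k) A \is a fin_num.
  by have [_ + _] := damped_fourier A (e0 k); exact: integrable_fin_num.
have mM : measurable_fun setT M.
  apply: (@measurable_fun_cvg _ _ _ _ (fun k A => fine (mixture (e_ k) A))) => [k|A _].
    apply: (measurableT_comp (@fine_measurable R _ measurableT)).
    exact: measurable_mixture.
  exact: (cF A).2.
have m0M : measurable_fun setT (fun A => `|mixture 0 A - (M A)%:E|)%E.
  apply: measurableT_comp => //; apply: emeasurable_funB.
    exact: measurable_mixture.
  exact/measurable_EFinP.
have cM A : (`|mixture 0 A - mixture (e_ k) A| @[k --> \oo] -->
    `|mixture 0 A - (M A)%:E|)%E.
  apply: cvg_abse; apply: cvgeB; last 2 first.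
  - exact: cvg_cst.
  - under eq_fun do rewrite -(fineK (fk _ A)).
    by apply: cvg_EFin; [exact: nearW|exact: (cF A).2].
  - by rewrite fin_num_adde_defl.
have i0 : (\int[lambda]_A `|mixture 0 A - (M A)%:E| = 0)%E.
  apply/eqP; rewrite eq_le integral_ge0// andbT.
  have mk k : measurable_fun setT (fun A => `|mixture 0 A - mixture (e_ k) A|)%E.
    by apply: measurableT_comp => //; apply: emeasurable_funB; exact: measurable_mixture.
  have := @fatou _ _ _ lambda _ measurableT _ mk (fun k A _ => abse_ge0 _).
  under eq_integral do rewrite (cvg_limn_einf_sup (cM _)).1.
  move/cvge_at_rightP : cvg_mixture => /(_ e_ (conj e0 ce)) c3.
  by rewrite (cvg_limn_einf_sup c3).1.
have mM' : measurable_fun setT (fun A => mixture 0 A - (M A)%:E)%E.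
  apply: emeasurable_funB; [exact: measurable_mixture|exact/measurable_EFinP].
have [ae1 _] := ae_eq_integral_abs lambda measurableT mM'.
apply: filterS (ae1 i0) => A /(_ I) E0.
have {}E0 : mixture 0 A = (M A)%:E.
  move: E0 => /=; case: (mixture 0 A) => [x||]//= [] /eqP.
  by rewrite subr_eq0 => /eqP ->.
rewrite -/(F A) E0; split => //; apply: complex_eqP; rewrite ?ReM ?ImM/=.
  by rewrite mul0r subr0 /M mulrCA mulfV// mulr1.
by rewrite mulr0 mul0r addr0; exact: (cF A).1.
Qed.

End gaussian_mixture.

(** * Increments of Levy processes over random times *)

(** A right-continuous process is jointly measurable in time and chance, being
    the pointwise limit of its values at the next point of a refining grid. *)
Lemma measurable_right_continuous (R : realType) d (Z : measurableType d)
    (J : R -> Z -> R) :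
  (forall t, 0 <= t -> measurable_fun setT (J t)) ->
  (forall z t, 0 <= t -> J s z @[s --> t^'+] --> J t z) ->
  measurable_fun setT (fun p : R * Z => J (Num.max 0 p.1) p.2).
Proof.
move=> mJ rcJ.
pose pos (t : R) := Num.max 0 t.
have pos0 t : 0 <= pos t by rewrite le_max lexx.
have mpos : measurable_fun setT (fun p : R * Z => pos p.1).
  by apply: measurable_maxr => //; exact: measurable_fst.
pose k (m : nat) (t : R) := Num.truncn (pos t * m.+1%:R).
pose grid m t : R := (k m t).+1%:R / m.+1%:R.
apply: (@measurable_fun_cvg _ _ _ _ (fun m p => J (grid m p.1) p.2)).
- move=> m _ B mB; rewrite setTI.
  rewrite (_ : _ @^-1` B = \bigcup_j
    ((fun p : R * Z => pos p.1 * m.+1%:R) @^-1` `[j%:R, j.+1%:R[ `&`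
     (fun p : R * Z => J (j.+1%:R / m.+1%:R) p.2) @^-1` B)).
    apply: bigcupT_measurable => j; apply: measurableI.
      rewrite -[X in measurable X]setTI; apply: measurable_funM => //.
    rewrite -[X in measurable X]setTI.
    apply: (measurableT_comp _ measurable_snd) => //.
    by apply: mJ; rewrite divr_ge0.
  apply/seteqP; split => [p /= Bp|p [j _ /= [jp Bp]]].
    exists (k m p.1) => //; split => //=; rewrite in_itv/=.
    by apply: truncn_itv; rewrite mulr_ge0.
  rewrite /grid /k; suff -> : Num.truncn (pos p.1 * m.+1%:R) = j by [].
  by apply/truncn_def; move: jp; rewrite in_itv.
- move=> p _; have /cvg_at_rightP := rcJ p.2 _ (pos0 p.1); apply.
  have gridE m : pos p.1 < grid m p.1 <= pos p.1 + m.+1%:R^-1.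
    rewrite /grid ltr_pdivlMr ?ltr0n// truncnS_gt/= ler_pdivrMr ?ltr0n// mulrDl.
    rewrite mulVf ?pnatr_eq0// -natr1 lerD2r.
    have pm : 0 <= pos p.1 * m.+1%:R by rewrite mulr_ge0.
    by have /andP[] := truncn_itv pm.
  split; first by move=> m; have /andP[] := gridE m.
  apply: (@squeeze_cvgr _ _ _ _ (fun=> pos p.1) (fun m => pos p.1 + m.+1%:R^-1)).
  + by apply: nearW => m; have /andP[/ltW -> ->] := gridE m.
  + exact: cvg_cst.
  + rewrite -[X in _ --> X]addr0; apply: cvgD; first exact: cvg_cst.
    exact: cvg_harmonic.
Qed.

Lemma measurable_time_changed_increment (R : realType) d (Z : measurableType d) n
    (J : R -> Z -> R) (clock : 'I_n -> Z -> R) i :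
  (forall t, 0 <= t -> measurable_fun setT (J t)) ->
  (forall z t, 0 <= t -> J s z @[s --> t^'+] --> J t z) ->
  (forall i, measurable_fun setT (clock i)) -> (forall i z, 0 <= clock i z) ->
  measurable_fun setT (time_changed_increment J clock i).
Proof.
move=> mJ rcJ mc c0.
have mJc (c : Z -> R) : measurable_fun setT c -> (forall z, 0 <= c z) ->
    measurable_fun setT (fun z => J (c z) z).
  move=> mcc cc0.
  rewrite (_ : (fun _ => _) = (fun p : R * Z => J (Num.max 0 p.1) p.2) \o
     (fun z => (c z, z))).
    apply: measurableT_comp; first exact: measurable_right_continuous.
    exact: measurable_fun_pair.
  by apply/funext => z /=; rewrite max_r.
have mS : measurable_fun setT (fun z => \sum_(k < n | (k < i)%N) clock k z).
  under eq_fun do rewrite -big_filter.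
  exact: measurable_sum.
have S0 z : 0 <= \sum_(k < n | (k < i)%N) clock k z by rewrite sumr_ge0.
apply: measurable_funB; last exact: mJc.
apply: mJc; first exact: measurable_funD.
by move=> z; rewrite addr_ge0.
Qed.

Lemma measurable_rm_integral (R : realType) d (Z : measurableType d)
    (V : completeMetricType R) (N : Z -> {measure set (borel V) -> \bar R})
    (f : borel V -> R) :
  (forall U, measurable U -> measurable_fun setT (fun z => N z U)) ->
  measurable_fun setT f -> (forall x, 0 <= f x) ->
  measurable_fun setT (fun z => \int[N z]_x f x).
Proof.
move=> mN mf f0; apply: (measurableT_comp (@fine_measurable R _ measurableT)).
apply: measurable_fun_integral_kernel => //.
exact/measurable_EFinP.
Qed.

Section levy_increments.
Context d (T : measurableType d) (R : realType) (P : probability T R).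
Variables (J : R -> T -> R) (psi : R[i] -> R[i]) (beta : R).
Hypotheses (J_levy : levy_process P J) (J_psi : laplace_exponent P J psi)
  (J_beta : exponential_moment P J beta).

Lemma increment_moment s t : 0 <= s -> s <= t ->
  P.-integrable setT (fun o => (expR (- (beta * (J t o - J s o))))%:E).
Proof.
move=> s0 st; have [mJ _ _ stat _] := J_levy.
have t0 := le_trans s0 st; have ts0 : 0 <= t - s by rewrite subr_ge0.
have mI : measurable_fun setT (fun o => J t o - J s o).
  by apply: measurable_funB; exact: mJ.
have [m mE] := image_measure P mI.
have mexp : measurable_fun setT (fun x : R => expR (- (beta * x))).
  by apply: measurableT_comp => //; apply: measurableT_comp => //; exact: measurable_funM.
apply/(integrable_image mI (fun A _ => mE A) mexp).
apply/(@integrable_image _ _ _ _ _ P _ (mJ _ ts0)) => //; last exact: J_beta.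
move=> A mA; rewrite mE; exact: stat.
Qed.

(** The increments over successive intervals of prescribed lengths are
    independent; the exponential moment at [beta] bounds the modulus of every
    factor. *)
Lemma increments_transform n (c : 'I_n -> R) (om : 'I_n -> R[i]) :
  (forall i, 0 <= c i) -> (forall i, complex.Re (om i) = beta) ->
  let F o := \prod_(i < n)
    cexp (- om i * (time_changed_increment J (fun i _ => c i) i o)%:C) in
  cintegrable P F /\
  cintegral P F = \prod_(i < n) cexp (- (c i)%:C * psi (om i)).
Proof.
move=> c0 omb F; have [mJ _ ind _ _] := J_levy.
pose t (k : nat) := \sum_(j < n | (j < k)%N) c j.
have t0 : 0 <= t 0%N by rewrite sumr_ge0.
have tS (i : 'I_n) : t i.+1 = t i + c i.
  rewrite /t (bigD1 i)//= addrC; congr (_ + _); apply: eq_bigl => j.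
  by rewrite ltnS ltn_neqAle andbC.
have tle k : t k <= t k.+1.
  rewrite /t [leRHS](bigID (fun j : 'I_n => (j < k)%N))/=.
  rewrite [X in _ <= X + _](eq_bigl (fun j : 'I_n => (j < k)%N)); last first.
    by move=> j; rewrite andb_idl// => /ltnW.
  by rewrite lerDl sumr_ge0.
have tk0 k : 0 <= t k by rewrite sumr_ge0.
pose X (i : 'I_n) o := J (t i.+1) o - J (t i) o.
have XE i o : time_changed_increment J (fun i _ => c i) i o = X i o.
  by rewrite /time_changed_increment /X tS.
have mX i : measurable_fun setT (X i) by apply: measurable_funB; exact: mJ.
have indX : box_independent P X.
  move=> B mB; have := ind n t t0 tle (fun i => X i @^-1` B i); apply => i.
  apply: sub_sigma_algebra; exists i, (B i); split => //; exact: mB.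
have mf i : cmeasurable (fun x : measurableTypeR R => cexp (- om i * x%:C)).
  apply: cmeasurable_exp; apply: cmeasurableM; first exact: cmeasurable_cst.
  exact: cmeasurable_real.
have mom i := increment_moment (tk0 i) (tle i).
have fi i : cintegrable P (fun o => cexp (- om i * (X i o)%:C)).
  apply: (cintegrable_le _ (mom i)) => [|o].
    exact: (cmeasurable_comp (mf i) (mX i)).
  by rewrite normc_cexp ReM ReN/= mulr0 subr0 omb mulNr.
have [h1 h2] := box_independent_prod mX indX mf fi.
have FE : F = (fun o => \prod_(i < n) cexp (- om i * (X i o)%:C)).
  by apply/funext => o; apply: eq_bigr => i _; rewrite XE.
rewrite FE h2; split => //; apply: eq_bigr => i _.
rewrite J_psi//; last by rewrite omb; exact: mom.
by rewrite tS addrAC subrr add0r.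
Qed.

End levy_increments.

(** * The complex exponential series and the Poisson law *)
Section exponential_series.
Context {R : realType}.
Variable z : R[i].
Let x := complex.Re z.
Let y := complex.Im z.
Let c (k : nat) : R := complex.Re (z ^+ k) / k`!%:R.
Let e (k : nat) : R := complex.Im (z ^+ k) / k`!%:R.

Let Re_expS k : complex.Re (z ^+ k.+1) = x * complex.Re (z ^+ k) - y * complex.Im (z ^+ k).
Proof. by rewrite exprS ReM. Qed.
Let Im_expS k : complex.Im (z ^+ k.+1) = x * complex.Im (z ^+ k) + y * complex.Re (z ^+ k).
Proof. by rewrite exprS ImM. Qed.

Lemma normcX (w : R[i]) k : normc (w ^+ k) = normc w ^+ k.
Proof.
elim: k => [|k IH]; last by rewrite !exprS ComplexField.Normc.normcM IH.
by rewrite !expr0 normcE/= expr1n expr0n/= addr0 sqrtr1.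
Qed.

Let cvg_bounded (a : nat -> R) K : (forall k, `|a k| <= normc z ^+ k / k`!%:R) ->
  cvgn (pseries a K).
Proof.
move=> ab; apply: normed_cvg.
apply: (@series_le_cvg _ _ (exp_coeff (normc z * `|K|))).
- by move=> k; exact: normr_ge0.
- move=> k; rewrite /exp_coeff /= divr_ge0// exprn_ge0// mulr_ge0//.
  exact: normc_ge0.
- move=> k; rewrite -[leLHS]/(`|a k * K ^+ k|) normrM normrX /exp_coeff/= exprMn mulrAC.
  by rewrite ler_wpM2r// exprn_ge0.
- exact: is_cvg_series_exp_coeff.
Qed.

Let cvg_c K : cvgn (pseries c K).
Proof.
apply: cvg_bounded => k; rewrite normrM [`|_^-1|]ger0_norm ?invr_ge0//.
by rewrite ler_wpM2r ?invr_ge0// -normcX; exact: normReal_le.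
Qed.

Let cvg_e K : cvgn (pseries e K).
Proof.
apply: cvg_bounded => k; rewrite normrM [`|_^-1|]ger0_norm ?invr_ge0//.
by rewrite ler_wpM2r ?invr_ge0// -normcX; exact: normImag_le.
Qed.

Let diffs_c : pseries_diffs c = (fun k => x * c k - y * e k).
Proof.
apply/funext => k; rewrite /pseries_diffs /c /e Re_expS factS natrM.
have : (k.+1%:R : R) != 0 by rewrite pnatr_eq0.
have : (k`!%:R : R) != 0 by rewrite pnatr_eq0 -lt0n fact_gt0.
by move: (k.+1%:R : R) (k`!%:R : R) => m q q0 m0; field; rewrite m0 q0.
Qed.

Let diffs_e : pseries_diffs e = (fun k => x * e k + y * c k).
Proof.
apply/funext => k; rewrite /pseries_diffs /c /e Im_expS factS natrM.
have : (k.+1%:R : R) != 0 by rewrite pnatr_eq0.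
have : (k`!%:R : R) != 0 by rewrite pnatr_eq0 -lt0n fact_gt0.
by move: (k.+1%:R : R) (k`!%:R : R) => m q q0 m0; field; rewrite m0 q0.
Qed.

Let pseries_lin (a b : R) (u v : nat -> R) K : cvgn (pseries u K) -> cvgn (pseries v K) ->
  pseries (fun k => a * u k + b * v k) K @ \oo -->
  a * limn (pseries u K) + b * limn (pseries v K).
Proof.
move=> cu cv.
rewrite (_ : pseries _ K = (fun n => a * pseries u K n + b * pseries v K n)).
  by apply: cvgD; apply: cvgMr.
apply/funext => n; rewrite /pseries /series/= !mulr_sumr -big_split/=.
by apply: eq_bigr => k _; ring.
Qed.

Let A t := limn (pseries c t).
Let B t := limn (pseries e t).

Let diffs_cvg1 K : pseries (pseries_diffs c) K @ \oo --> x * A K - y * B K.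
Proof.
rewrite diffs_c -mulNr; under eq_fun do rewrite -mulNr.
exact: pseries_lin.
Qed.

Let diffs_cvg2 K : pseries (pseries_diffs e) K @ \oo --> x * B K + y * A K.
Proof. by rewrite diffs_e; exact: pseries_lin. Qed.

Let lin_diffs (a b : R) (u v : nat -> R) :
  pseries_diffs (fun k => a * u k + b * v k) =
  (fun k => a * pseries_diffs u k + b * pseries_diffs v k).
Proof. by apply/funext => k; rewrite /pseries_diffs; ring. Qed.

Let dA t : is_derive t (1 : R) (A : R -> R) (x * A t - y * B t).
Proof.
rewrite -(cvg_lim (@Rhausdorff R) (@diffs_cvg1 t)).
apply: (@pseries_snd_diffs _ _ (`|t| + 1)).
- exact: cvg_c.
- by apply/cvg_ex; exists (x * A (`|t| + 1) - y * B (`|t| + 1)); exact: diffs_cvg1.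
- rewrite diffs_c; under [X in pseries_diffs X]eq_fun do rewrite -mulNr.
  rewrite lin_diffs; apply/cvg_ex; eexists; apply: pseries_lin.
    by apply/cvg_ex; eexists; exact: diffs_cvg1.
  by apply/cvg_ex; eexists; exact: diffs_cvg2.
- by rewrite [ltRHS]ger0_norm ?addr_ge0// ltrDl.
Qed.

Let dB t : is_derive t (1 : R) (B : R -> R) (x * B t + y * A t).
Proof.
rewrite -(cvg_lim (@Rhausdorff R) (@diffs_cvg2 t)).
apply: (@pseries_snd_diffs _ _ (`|t| + 1)).
- exact: cvg_e.
- by apply/cvg_ex; exists (x * B (`|t| + 1) + y * A (`|t| + 1)); exact: diffs_cvg2.
- rewrite diffs_e lin_diffs; apply/cvg_ex; eexists; apply: pseries_lin.
    by apply/cvg_ex; eexists; exact: diffs_cvg2.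
  by apply/cvg_ex; eexists; exact: diffs_cvg1.
- by rewrite [ltRHS]ger0_norm ?addr_ge0// ltrDl.
Qed.

Let lim_pseries0 (u : nat -> R) : limn (pseries u 0) = u 0%N.
Proof.
apply: cvg_lim => //; apply: cvg_near_cst; near=> n.
have n0 : (0 < n)%N by near: n; exists 1%N.
rewrite /pseries /series/= -(prednK n0) big_nat_recl//= expr0 mulr1 big1 ?addr0//.
by move=> i _; rewrite exprS mul0r mulr0.
Unshelve. all: by end_near. Qed.

Let A0 : A 0 = 1.
Proof. by rewrite /A lim_pseries0 /c expr0 fact0 divr1. Qed.
Let B0 : B 0 = 0.
Proof. by rewrite /B lim_pseries0 /e expr0 mul0r. Qed.

Let dlin (a : R) t : is_derive t (1 : R) (fun s : R => s * a) a.
Proof.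
have -> : (fun s : R => s * a) = a *: (@id R) by apply/funext => s; rewrite mulrC.
by apply: is_derive_eq; rewrite /GRing.scale/= mulr1.
Qed.

(** Along the ray t z the sums A and B of the two real series satisfy
    A' = x A - y B and B' = x B + y A, so that (A, B) turned back by the angle
    t y and scaled by exp(- t x) has derivative zero. *)
Lemma cexp_series :
  series c @ \oo --> complex.Re (cexp z) /\ series e @ \oo --> complex.Im (cexp z).
Proof.
have pE (u : nat -> R) : pseries u 1 = series u.
  by apply/funext => n; apply: eq_bigr => i _; rewrite /= expr1n mulr1.
have dexp t : is_derive t (1 : R) (fun s : R => expR (s * - x)) (- x * expR (t * - x)).
  have d1 := dlin (- x) t; by apply: is_derive_eq; rewrite mulrC.
have dcos t : is_derive t (1 : R) (fun s : R => cos (s * y)) (- (y * sin (t * y))).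
  have d1 := dlin y t; by apply: is_derive_eq; rewrite mulrC mulrN.
have dsin t : is_derive t (1 : R) (fun s : R => sin (s * y)) (y * cos (t * y)).
  have d1 := dlin y t; by apply: is_derive_eq; rewrite mulrC.
have du t : is_derive t (1 : R) ((fun s : R => expR (s * - x)) *
    (A * (fun s : R => cos (s * y)) + B * (fun s : R => sin (s * y)))) 0.
  have d1 := dexp t; have d2 := dcos t; have d3 := dsin t.
  have d4 := dA t; have d5 := dB t.
  apply: is_derive_eq; rewrite /GRing.scale/=.
  rewrite -[(A * _ + _) t]/(A t * cos (t * y) + B t * sin (t * y)); ring.
have dv t : is_derive t (1 : R) ((fun s : R => expR (s * - x)) *
    (B * (fun s : R => cos (s * y)) - A * (fun s : R => sin (s * y)))) 0.
  have d1 := dexp t; have d2 := dcos t; have d3 := dsin t.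
  have d4 := dA t; have d5 := dB t.
  apply: is_derive_eq; rewrite /GRing.scale/=.
  rewrite -[(B * _ - _) t]/(B t * cos (t * y) - A t * sin (t * y)); ring.
have u1 : expR (1 * - x) * (A 1 * cos (1 * y) + B 1 * sin (1 * y)) =
    expR (0 * - x) * (A 0 * cos (0 * y) + B 0 * sin (0 * y)).
  exact: (is_derive_0_is_cst 1 0 du).
have v1 : expR (1 * - x) * (B 1 * cos (1 * y) - A 1 * sin (1 * y)) =
    expR (0 * - x) * (B 0 * cos (0 * y) - A 0 * sin (0 * y)).
  exact: (is_derive_0_is_cst 1 0 dv).
rewrite A0 B0 !(mul0r, mul1r, sin0, cos0, expR0, addr0, subr0) in u1.
rewrite A0 B0 !(mul0r, mul1r, sin0, cos0, expR0, addr0, subr0) in v1.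
have en : expR (- x) != 0 by rewrite gt_eqF// expR_gt0.
have u2 : A 1 * cos y + B 1 * sin y = expR x.
  by apply: (mulfI en); rewrite u1 -expRD addNr expR0.
have v2 : B 1 * cos y - A 1 * sin y = 0.
  by apply: (mulfI en); rewrite v1 mulr0.
have c2s2 := cos2Dsin2 y.
have A1 : A 1 = complex.Re (cexp z).
  rewrite Re_cexp -/x -/y -u2.
  have -> : (A 1 * cos y + B 1 * sin y) * cos y =
     A 1 * (cos y ^+ 2 + sin y ^+ 2) + (B 1 * cos y - A 1 * sin y) * sin y by ring.
  by rewrite c2s2 v2 mul0r addr0 mulr1.
have B1 : B 1 = complex.Im (cexp z).
  rewrite Im_cexp -/x -/y -u2.
  have -> : (A 1 * cos y + B 1 * sin y) * sin y =
     B 1 * (cos y ^+ 2 + sin y ^+ 2) - (B 1 * cos y - A 1 * sin y) * cos y by ring.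
  by rewrite c2s2 v2 mul0r subr0 mulr1.
by rewrite -A1 -B1 -!pE; split; [exact: cvg_c|exact: cvg_e].
Qed.

End exponential_series.

Section poisson_law.
Context d (T : measurableType d) (R : realType) (P : probability T R).
Variables (Y : T -> R) (lam : R).
Hypotheses (mY : measurable_fun setT Y) (lam0 : 0 <= lam).
Hypothesis Y_poisson : forall k : nat,
  P (Y @^-1` [set k%:R]) = poisson_prob lam 0 [set k].

Let p (k : nat) : R := lam ^+ k / k`!%:R * expR (- lam).

Lemma poisson_prob1 k : poisson_prob lam 0 [set k] = (p k)%:E.
Proof.
rewrite /poisson_prob; case: ifPn => [l0|].
  by rewrite esum_set1 ?lee_fin ?poisson_pmf_ge0// /poisson_pmf l0.
rewrite -leNgt => l0; have l00 : lam = 0 by apply/eqP; rewrite eq_le l0.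
rewrite /p l00 oppr0 expR0 mulr1 diracE; case: k => [|k].
  by rewrite mem_set// expr0 fact0 divr1.
by rewrite memNset// exprS mul0r mul0r.
Qed.

Let E (k : nat) := Y @^-1` [set k%:R].
Let D := \bigcup_k E k.

Let mE k : measurable (E k).
Proof. by rewrite -[X in measurable X]setTI; apply: mY. Qed.

Let tE : trivIset setT E.
Proof.
apply/trivIsetP => i j _ _ ij; apply/seteqP; split => // o [Yi Yj].
have : i%:R = j%:R :> R by rewrite -Yi -Yj.
by move/eqP; rewrite eqr_nat (negbTE ij).
Qed.

Let mD : measurable D. Proof. exact: bigcupT_measurable. Qed.

(** The Poisson weights sum to 1, so that [Y] is almost surely an integer and
    expectations are series. *)
Lemma poisson_support : P D = 1%E.
Proof.
rewrite /D measure_bigcup//.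
transitivity (poisson_prob lam 0 (\bigcup_(k in setT) [set k])).
  rewrite measure_bigcup//; last first.
    apply/trivIsetP => i j _ _ ij; apply/seteqP; split => // k [/= -> /eqP].
    by rewrite (negbTE ij).
  by apply: eq_eseriesr => k _; exact: Y_poisson.
rewrite (_ : \bigcup_(k in setT) _ = setT) ?probability_setT//.
by apply/seteqP; split => // k _; exists k.
Qed.

Let PD0 : P (~` D) = 0%E.
Proof. by rewrite probability_setC// poisson_support subee. Qed.

Let integral_E (g : R -> R) k :
  (\int[P]_(o in E k) (g (Y o))%:E = (g k%:R * p k)%:E)%E.
Proof.
rewrite (eq_integral (fun=> (g k%:R)%:E)); last by move=> o; rewrite inE => ->.
have PE : P (E k) = (p k)%:E by rewrite -poisson_prob1 -Y_poisson.
by rewrite integral_cst//= PE.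
Qed.

Let sum_E (g : R -> R) l : series (fun k => g k%:R * p k) @ \oo --> l ->
  (\sum_(k <oo) \int[P]_(o in E k) (g (Y o))%:E = l%:E)%E.
Proof.
move=> cl; apply/cvg_lim => //.
rewrite (_ : (fun n => _) = EFin \o series (fun k => g k%:R * p k)).
  by apply: cvg_EFin => //; exact: nearW.
by apply/funext => n; rewrite /series/= -sumEFin; apply: eq_bigr => k _; exact: integral_E.
Qed.

Lemma poisson_integral_ge0 (g : R -> R) l : measurable_fun setT g ->
  (forall x, 0 <= g x) -> series (fun k => g k%:R * p k) @ \oo --> l ->
  (\int[P]_o (g (Y o))%:E = l%:E)%E.
Proof.
move=> mg g0 cl.
have mgY : measurable_fun setT (fun o => (g (Y o))%:E).
  by apply/measurable_EFinP; exact: measurableT_comp.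
rewrite (ge0_negligible_integral (measurableC mD) measurableT mgY _ PD0); last first.
  by move=> o _; rewrite lee_fin.
rewrite setDE setTI setCK ge0_integral_bigcup//; last first.
  - by move=> o _; rewrite lee_fin.
  - exact: measurable_funTS.
exact: sum_E.
Qed.

Lemma poisson_integral (g : R -> R) l : measurable_fun setT g ->
  P.-integrable setT (fun o => (g (Y o))%:E) ->
  series (fun k => g k%:R * p k) @ \oo --> l ->
  \int[P]_o g (Y o) = l.
Proof.
move=> mg gi cl; rewrite /Rintegral.
rewrite (negligible_integral (measurableC mD) measurableT gi PD0).
rewrite setDE setTI setCK integral_bigcup//; last exact: (integrableS measurableT).
by rewrite (sum_E cl).
Qed.

(** The exponential series, summed against the Poisson weights. *)
Lemma poisson_transform (c : R[i]) :
  cintegrable P (fun o => cexp (- c * (Y o)%:C)) /\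
  cintegral P (fun o => cexp (- c * (Y o)%:C)) = cexp (- lam%:C * (1 - cexp (- c))).
Proof.
set w := cexp (- c).
have mf : cmeasurable (fun y : R => cexp (- c * y%:C)).
  apply: cmeasurable_exp; apply: cmeasurableM; first exact: cmeasurable_cst.
  exact: cmeasurable_real.
have fk k : cexp (- c * k%:R%:C) = w ^+ k.
  rewrite (rmorph_nat (real_complex R)) mulr_natr.
  elim: k => [|k IH]; first by rewrite mulr0n cexp0.
  by rewrite mulrS cexpD IH exprS.
have ek k : w ^+ k * (p k)%:C = (expR (- lam))%:C * ((lam%:C * w) ^+ k * (k`!%:R^-1)%:C).
  rewrite [(lam%:C * w) ^+ k]exprMn /p !(rmorphM (real_complex R)) (rmorphXn (real_complex R)).
  rewrite [LHS]mulrA [LHS]mulrC; congr (_ * _).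
  by rewrite mulrA [w ^+ k * _]mulrC.
have nseries : series (fun k => normc (cexp (- c * k%:R%:C)) * p k) @ \oo -->
    expR (- lam) * expR (lam * normc w).
  rewrite (_ : series _ = (fun n => expR (- lam) * series (exp_coeff (lam * normc w)) n)).
    apply: cvgMr; rewrite expRE /pseries -exp_coeffE.
    exact: is_cvg_series_exp_coeff.
  apply/funext => n; rewrite mulr_sumr; apply: eq_bigr => k _.
  rewrite fk normcX exp_coeffE exprMn /p; ring.
have mn := measurable_normc mf.
have ni := poisson_integral_ge0 mn (fun y => normc_ge0 _) nseries.
have iw : P.-integrable setT (fun o => (normc (cexp (- c * (Y o)%:C)))%:E).
  apply/integrableP; split; first by apply/measurable_EFinP; exact: (measurableT_comp mn mY).
  under eq_integral do rewrite gee0_abs ?lee_fin ?normc_ge0//.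
  by rewrite ni ltry.
have fi : cintegrable P (fun o => cexp (- c * (Y o)%:C)).
  exact: (cintegrable_le (cmeasurable_comp mf mY) iw).
split => //.
have [s1 s2] := cexp_series (lam%:C * w).
have -> : cexp (- lam%:C * (1 - w)) = (expR (- lam))%:C * cexp (lam%:C * w).
  by rewrite -cexp_real -cexpD; congr cexp; rewrite (rmorphN (real_complex R)); ring.
apply: complex_eqP.
  apply: (poisson_integral (g := fun y => complex.Re (cexp (- c * y%:C)))).
  - exact: mf.1.
  - exact: fi.1.
  - rewrite ReZ; rewrite (_ : series _ = (fun n => expR (- lam) *
        series (fun k => complex.Re ((lam%:C * w) ^+ k) / k`!%:R) n)); first exact: cvgMr.
    apply/funext => n.
    rewrite mulr_sumr; apply: eq_bigr => k _.
    rewrite fk mulrC -ReZ (mulrC (p k)%:C) ek ReZ; congr (_ * _).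
    by rewrite [X in complex.Re X]mulrC ReZ mulrC.
apply: (poisson_integral (g := fun y => complex.Im (cexp (- c * y%:C)))).
- exact: mf.2.
- exact: fi.2.
- rewrite ImZ; rewrite (_ : series _ = (fun n => expR (- lam) *
        series (fun k => complex.Im ((lam%:C * w) ^+ k) / k`!%:R) n)); first exact: cvgMr.
    apply/funext => n.
  rewrite mulr_sumr; apply: eq_bigr => k _.
  rewrite fk mulrC -ImZ (mulrC (p k)%:C) ek ImZ; congr (_ * _).
  by rewrite [X in complex.Im X]mulrC ImZ mulrC.
Qed.

End poisson_law.

(** * Laplace functional of a Poisson random measure *)

Lemma measurable_cintegral_kernel (R : realType) d (Z : measurableType d)
    (V : completeMetricType R) (N : Z -> {measure set (borel V) -> \bar R})
    (f : borel V -> R[i]) :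
  (forall U, measurable U -> measurable_fun setT (fun z => N z U)) ->
  cmeasurable f -> cmeasurable (fun z => cintegral (N z) f).
Proof.
move=> mN [f1 f2].
have key (g : borel V -> R) : measurable_fun setT g ->
    measurable_fun setT (fun z => \int[N z]_x g x).
  move=> mg; apply: (measurableT_comp (@fine_measurable R _ measurableT)).
  under eq_fun do rewrite integralE.
  have mge : measurable_fun setT (EFin \o g) by exact/measurable_EFinP.
  apply: emeasurable_funB; apply: measurable_fun_integral_kernel => //.
    exact: measurable_funepos.
  exact: measurable_funeneg.
by split; exact: key.
Qed.

Section finite_valued_integral.
Context {R : realType} d (T : measurableType d) (mu : {measure set T -> \bar R}).

Lemma cintegral_indic (A : set T) : measurable A -> (mu A < +oo)%E ->
  cintegrable mu (fun x => (\1_A x)%:C) /\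
  cintegral mu (fun x => (\1_A x)%:C) = (fine (mu A))%:C.
Proof.
move=> mA Aoo; split.
  split => /=; last exact: integrable0.
  apply/integrableP; split; first exact/measurable_EFinP/measurable_indic.
  rewrite (eq_integral (fun x => (\1_A x)%:E)) ?integral_indic ?setIT// => x _.
  by rewrite gee0_abs// lee_fin.
apply: complex_eqP => /=; last by rewrite /Rintegral integral0.
by rewrite /Rintegral integral_indic// setIT.
Qed.

Variables (f : T -> R[i]) (s : seq R[i]).
Hypotheses (us : uniq s) (s0 : 0 \notin s).
Hypothesis fs : forall x, f x != 0 -> f x \in s.

Let level (i : 'I_(size s)) : set T := f @^-1` [set s`_i].

Lemma finite_valuedE (g : R[i] -> R[i]) x : g 0 = 0 ->
  g (f x) = \sum_(i < size s) g s`_i * (\1_(level i) x)%:C.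
Proof.
move=> g0; have [fx0|fx0] := eqVneq (f x) 0.
  rewrite fx0 g0 big1// => i _; rewrite indicE memNset ?mulr0//.
  rewrite /level/= fx0 => E; move: s0; rewrite E.
  by rewrite mem_nth ?ltn_ord.
have lt : (index (f x) s < size s)%N by rewrite index_mem; exact: fs.
rewrite (bigD1 (Ordinal lt))//= indicE mem_set; last first.
  by rewrite /level/= nth_index// fs.
rewrite nth_index ?fs// mulr1 big1 ?addr0// => i /eqP ni.
rewrite indicE memNset ?mulr0// /level/= => E; apply: ni; apply/val_inj => /=.
by rewrite E index_uniq.
Qed.

Lemma cintegral_finite_valued (g : R[i] -> R[i]) : g 0 = 0 ->
  (forall i, measurable (level i)) -> (forall i, (mu (level i) < +oo)%E) ->
  cintegrable mu (fun x => g (f x)) /\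
  cintegral mu (fun x => g (f x)) =
    \sum_(i < size s) g s`_i * (fine (mu (level i)))%:C.
Proof.
move=> g0 ml loo.
have E x : g (f x) = \sum_(i < size s) g s`_i * (\1_(level i) x)%:C.
  exact: finite_valuedE.
have ii (i : 'I_(size s)) : cintegrable mu (fun x => g s`_i * (\1_(level i) x)%:C).
  exact/cintegrableZ/(cintegral_indic _ _).1.
split; first by under eq_fun do rewrite E; exact: cintegrable_sum.
rewrite (eq_cintegral _ E) cintegral_sum//; apply: eq_bigr => i _.
rewrite cintegralZ; last exact: (cintegral_indic _ _).1.
by rewrite (cintegral_indic _ _).2.
Qed.

End finite_valued_integral.

Lemma measurable_level (R : realType) d (T : measurableType d) (f : T -> R[i]) c :
  cmeasurable f -> measurable (f @^-1` [set c]).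
Proof.
move=> [f1 f2].
rewrite (_ : _ @^-1` _ = (fun x => complex.Re (f x)) @^-1` [set complex.Re c] `&`
                         (fun x => complex.Im (f x)) @^-1` [set complex.Im c]).
  apply: measurableI; rewrite -[X in measurable X]setTI; first exact: f1.
  exact: f2.
apply/seteqP; split => x /= => [->//|[h1 h2]]; exact: complex_eqP.
Qed.

Section poisson_functional.
Context d (T : measurableType d) (R : realType) (P : probability T R).
Context (V : completeMetricType R) (N : R.-ker T ~> borel V)
  (nu : {measure set (borel V) -> \bar R}).
Hypothesis N_poisson : poisson_random_measure P N nu.
Implicit Types (A : set (borel V)) (f : borel V -> R[i]).

(** Infinity is sent to [-1] rather than to the default value [0] of [fine], which
    is an atom of the Poisson law. *)
Definition count A (o : T) : R := fine (N o A) - \1_[set +oo%E] (N o A).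

Let mphi : measurable_fun setT (fun x : \bar R => fine x - \1_[set +oo%E] x : R).
Proof.
apply: measurable_funB; first exact: fine_measurable.
apply: measurable_indic; exact: emeasurable_set1.
Qed.

Lemma measurable_count A : measurable A -> measurable_fun setT (count A).
Proof. by move=> mA; apply: (measurableT_comp mphi); exact: measurable_kernel. Qed.

Lemma count_fine A o : (N o A < +oo)%E -> count A o = fine (N o A).
Proof. by move=> fA; rewrite /count indicE memNset ?subr0//= => E; rewrite E in fA. Qed.

Lemma count_eq A (k : nat) o : count A o = k%:R <-> N o A = k%:R%:E.
Proof.
have [Aoo|Aoo] := eqVneq (N o A) +oo%E; last first.
  rewrite count_fine ?ltey//; split => [<-|->//].
  by rewrite fineK// ge0_fin_numE// ltey.
split => [h|h]; last by rewrite h in Aoo.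
exfalso.
have : (0 : R) <= k%:R by [].
rewrite -h /count Aoo indicE mem_set//=; lra.
Qed.

Lemma poisson_finite A : measurable A -> (nu A < +oo)%E ->
  {ae P, forall o, (N o A < +oo)%E}.
Proof.
move=> mA Aoo; have [c1 _ _] := N_poisson.
have mD (k : nat) : measurable (count A @^-1` [set k%:R]).
  by rewrite -[X in measurable X]setTI; apply: measurable_count.
have PY (k : nat) : P (count A @^-1` [set k%:R]) =
    poisson_prob (fine (nu A)) 0 [set k].
  rewrite -c1//; congr (P _); apply/seteqP.
  by split => o /= /count_eq.
have := poisson_support (measurable_count mA) PY.
set D := \bigcup_k _ => PD.
have mDD : measurable D by exact: bigcupT_measurable.
exists (~` D); split; first exact: measurableC.
  rewrite /= probability_setC// PD subee//.
move=> o /= nfin [k _ /count_eq h]; apply: nfin; rewrite h ltry//.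
Qed.

Lemma poisson_infinite A : measurable A -> nu A = +oo%E ->
  {ae P, forall o, N o A = +oo%E}.
Proof.
move=> mA Aoo; have [_ c2 _] := N_poisson.
have mD : measurable [set o | N o A = +oo%E].
  have mN := measurable_kernel N A mA.
  rewrite -[X in measurable X]setTI; apply: (mN measurableT [set +oo%E]).
  exact: emeasurable_set1.
exists (~` [set o | N o A = +oo%E]); split; first exact: measurableC.
  by rewrite /= probability_setC// c2// subee.
by [].
Qed.

Lemma count_transform A c : measurable A -> (nu A < +oo)%E ->
  cintegrable P (fun o => cexp (- c * (count A o)%:C)) /\
  cintegral P (fun o => cexp (- c * (count A o)%:C)) =
    cexp (- (1 - cexp (- c)) * (fine (nu A))%:C).
Proof.
move=> mA Aoo; have [c1 _ _] := N_poisson.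
have PY (k : nat) : P (count A @^-1` [set k%:R]) =
    poisson_prob (fine (nu A)) 0 [set k].
  by rewrite -c1//; congr (P _); apply/seteqP; split => o /= /count_eq.
have [h1 h2] := poisson_transform (measurable_count mA)
  (fine_ge0 (measure_ge0 _ _)) PY c.
by split => //; rewrite h2; congr cexp; ring.
Qed.

Lemma count_independent n (A : 'I_n -> set (borel V)) :
  (forall i, measurable (A i)) -> trivIset setT A ->
  box_independent P (fun i => count (A i) : T -> measurableTypeR R).
Proof.
move=> mA tA B mB; have [_ _ c3] := N_poisson; apply: c3 => // i.
apply: sub_sigma_algebra; exists i, ((fun x : \bar R => fine x - \1_[set +oo%E] x) @^-1` B i).
split; [by []| |by []].
by rewrite -[X in measurable X]setTI; apply: (mphi measurableT); exact: mB.
Qed.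

(** Campbell's formula for exp(- N f), with complex [f]; integrability is part of
    it because the real part of [f] may be negative. *)
Definition laplace_at f :=
  cintegrable P (fun o => cexp (- cintegral (N o) f)) /\
  cintegral P (fun o => cexp (- cintegral (N o) f)) =
    cexp (- cintegral nu (fun x => 1 - cexp (- f x))).

Lemma measurable_laplace f : cmeasurable f ->
  cmeasurable (fun o => cexp (- cintegral (N o) f)).
Proof.
move=> mf; apply: cmeasurable_exp; apply: cmeasurableN.
by apply: measurable_cintegral_kernel => // U mU; exact: measurable_kernel.
Qed.

(** Here N f is a linear combination of the numbers of points in the level sets
    of [f], which are independent Poisson variables. *)
Lemma laplace_finite_valued f : cmeasurable f -> finite_set (range f) ->
  (forall c, c != 0 -> (nu (f @^-1` [set c]) < +oo)%E) -> laplace_at f.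
Proof.
move=> mf /finite_seqP[s0 rf] foo.
pose s := [seq c <- undup s0 | c != 0].
have us : uniq s by rewrite filter_uniq ?undup_uniq.
have s00 : 0 \notin s by rewrite mem_filter eqxx.
have fs x : f x != 0 -> f x \in s.
  move=> fx0; rewrite mem_filter fx0 mem_undup.
  by have /= -> : [set` s0] (f x) by rewrite -rf; exists x.
pose A (i : 'I_(size s)) : set (borel V) := f @^-1` [set s`_i].
have mA i : measurable (A i) by exact: measurable_level.
have s0i (i : 'I_(size s)) : s`_i != 0.
  by apply: contraNneq s00 => <-; exact: mem_nth.
have Aoo i : (nu (A i) < +oo)%E by exact: foo.
have tA : trivIset setT A.
  apply/trivIsetP => i j _ _ ij; apply/seteqP; split => // x [/= h1 h2].
  move/eqP: ij; apply; apply/val_inj/eqP.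
  have /eqP := etrans (esym (h1 : f x = _)) (h2 : f x = _).
  by rewrite nth_uniq.
have g0 : 1 - cexp (- 0) = 0 :> R[i] by rewrite oppr0 cexp0 subrr.
have [_ nuE] := cintegral_finite_valued us s00 fs (g := fun z => 1 - cexp (- z))
  g0 mA Aoo.
have finA : {ae P, forall o, forall i, (N o (A i) < +oo)%E}.
  by apply: filter_forall => i; exact: poisson_finite.
have NE : {ae P, forall o, \prod_(i < size s) cexp (- s`_i * (count (A i) o)%:C) =
    cexp (- cintegral (N o) f)}.
  apply: filterS finA => o fo.
  have [_ ->] := cintegral_finite_valued us s00 fs (g := id) erefl mA fo.
  rewrite -cexp_sum; congr cexp; rewrite -sumrN; apply: eq_bigr => i _.
  by rewrite count_fine// mulNr.
have mexp (i : 'I_(size s)) : cmeasurable (fun y : measurableTypeR R => cexp (- s`_i * y%:C)).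
  apply: cmeasurable_exp; apply: cmeasurableM; first exact: cmeasurable_cst.
  exact: cmeasurable_real.
have [h1 h2] := box_independent_prod (f := fun i y => cexp (- s`_i * y%:C))
  (fun i => measurable_count (mA i)) (count_independent mA tA)
  mexp
  (fun i => (count_transform s`_i (mA i) (Aoo i)).1).
have mL := measurable_laplace mf.
split; first exact: (cintegrable_ae mL h1 NE).
rewrite -(ae_eq_cintegral (cintegrable_cmeasurable h1) mL NE) h2 nuE -sumrN cexp_sum.
by apply: eq_bigr => i _; rewrite (count_transform _ (mA i) (Aoo i)).2 mulNr.
Qed.

Section complex_test_function.
Variable f : borel V -> R[i].
Hypotheses (mf : cmeasurable f) (fN : {ae P, forall o, cintegrable (N o) f})
  (fnu : cintegrable nu (fun x => 1 - cexp (- f x))).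

(** A set of infinite mean measure almost surely has infinite [N]-measure, which
    Markov's inequality excludes for a set on which |f| is at least [e]. *)
Lemma finite_far (e : R) : 0 < e -> (nu [set x | (e <= normc (f x))%R] < +oo)%E.
Proof.
move=> e0; set A := [set x | _].
have mnf := measurable_normc mf.
have mA : measurable A.
  rewrite -[X in measurable X]setTI (_ : A = (fun x => normc (f x)) @^-1` `[e, +oo[).
    exact: mnf.
  by apply/seteqP; split => x /=; rewrite in_itv/= andbT.
rewrite ltey; apply/negP => /eqP Aoo.
have PT : (0 < P setT)%E by rewrite probability_setT.
have := ae_properfilter_algebraOfSetsType PT => PF.
have [w [w1 w2]] := filter_ex (filterI fN (poisson_infinite mA Aoo)).
have /measurable_EFinP mnfe := mnf.
have := le_integral_abse (N w) measurableT mnfe e0.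
rewrite setTI (_ : [set _ | _] = A); last first.
  by apply/seteqP; split => x /=; rewrite lee_fin ger0_norm ?normc_ge0.
have /integrableP[_ wf] := cintegrable_normc w1.
by move=> /le_lt_trans /(_ wf); rewrite w2 gt0_muley ?lte_fin.
Qed.

Let pneg x : R := Num.max (- complex.Re (f x)) 0.

Let mpneg : measurable_fun setT pneg.
Proof.
by apply: measurable_maxr => //; apply: measurableT_comp => //; exact: mf.1.
Qed.

Let pneg_ge0 x : 0 <= pneg x.
Proof. by rewrite /pneg le_max lexx orbT. Qed.

Let pneg_le x : pneg x <= normc (f x).
Proof.
rewrite /pneg ge_max normc_ge0 andbT; apply: le_trans (normReal_le _).
by rewrite -normrN ler_norm.
Qed.

Let expR_pneg x : expR (pneg x) - 1 <= normc (1 - cexp (- f x)).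
Proof.
rewrite /pneg; have [_|_] := leP (- complex.Re (f x)) 0.
  by rewrite expR0 subrr normc_ge0.
rewrite -ReN -normc_cexp -(normr1 R) -normc_real lerBlDr.
have {1}-> : cexp (- f x) = - (1 - cexp (- f x)) + 1 by rewrite opprB subrK.
by rewrite -[X in _ <= X + _]normcN; exact: normcD.
Qed.

Let mNi (g : borel V -> R) : measurable_fun setT g ->
  measurable_fun setT (fun w => \int[N w]_x g x).
Proof.
move=> mg; have mN U : measurable U -> measurable_fun setT (fun w => N w U).
  by move=> mU; exact: measurable_kernel.
exact: (measurable_cintegral_kernel mN (cmeasurable_real mg)).1.
Qed.

Let dominated_integrable w (g : borel V -> R[i]) : cintegrable (N w) f ->
  cmeasurable g -> (forall x, normc (g x) <= normc (f x)) -> cintegrable (N w) g.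
Proof. by move=> iw mg gf; exact: (cintegrable_le mg (cintegrable_normc iw)). Qed.

Let far_level (g : borel V -> R[i]) c : cmeasurable g ->
  (forall x, normc (g x) <= normc (f x)) -> c != 0 ->
  (nu (g @^-1` [set c]) < +oo)%E.
Proof.
move=> mg gf c0.
have nc0 : 0 < normc c.
  rewrite lt_neqAle normc_ge0 andbT eq_sym; apply: contra_neq c0.
  exact: ComplexField.Normc.eq0_normc.
apply: le_lt_trans (finite_far nc0); apply: le_measure; rewrite ?inE.
- exact: measurable_level.
- rewrite -[X in measurable X]setTI (_ : [set x | _] = (fun x => normc (f x)) @^-1` `[normc c, +oo[).
    exact: measurable_normc.
  by apply/seteqP; split => x /=; rewrite in_itv/= andbT.
- by move=> x /= <-.
Qed.

Let moment_bound (v : borel V -> R) : measurable_fun setT v -> finite_set (range v) ->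
  (forall x, 0 <= v x) -> (forall x, v x <= pneg x) ->
  (\int[P]_w (expR (\int[N w]_x v x))%:E <=
    (expR (\int[nu]_x normc (1 - cexp (- f x))))%:E)%E.
Proof.
move=> mv fv v0 vp.
pose g x : R[i] := - (v x)%:C.
have mg : cmeasurable g by apply: cmeasurableN; exact: cmeasurable_real.
have nv x : normc (v x)%:C <= normc (f x).
  by rewrite normc_real ger0_norm//; exact: le_trans (vp x) (pneg_le x).
have ng x : normc (g x) <= normc (f x) by rewrite normcN.
have fg : finite_set (range g).
  apply: sub_finite_set (finite_image (fun a : R => - a%:C) fv).
  by move=> _ [x _ <-]; exists (v x) => //; exists x.
have [i1 e1] := laplace_finite_valued mg fg (fun c c0 => far_level mg ng c0).
have Eg w : cintegrable (N w) f ->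
    cexp (- cintegral (N w) g) = (expR (\int[N w]_x v x))%:C.
  move=> iw; rewrite cintegralN; last exact: (dominated_integrable iw (cmeasurable_real mv)).
  by rewrite opprK cintegral_real cexp_real.
have mE : measurable_fun setT (fun w => expR (\int[N w]_x v x)).
  by apply: measurableT_comp => //; exact: mNi.
have aeE : {ae P, forall w, cexp (- cintegral (N w) g) = (expR (\int[N w]_x v x))%:C}.
  by apply: filterS fN => w iw; exact: Eg.
have i2 := cintegrable_ae (cmeasurable_real mE) i1 aeE.
have e2 := ae_eq_cintegral (cintegrable_cmeasurable i1) (cmeasurable_real mE) aeE.
have ie : nu.-integrable setT (fun x => (expR (v x) - 1)%:E).
  apply: le_integrable (cintegrable_normc fnu) => //.
    by apply/measurable_EFinP; apply: measurable_funB => //; exact: measurableT_comp.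
  move=> x _; rewrite lee_fin !ger0_norm ?normc_ge0//; last first.
    by rewrite subr_ge0 -(expR0 R) ler_expR.
  by apply: le_trans (expR_pneg x); rewrite lerD2r ler_expR.
have e3 : cintegral nu (fun x => 1 - cexp (- g x)) =
    - (\int[nu]_x (expR (v x) - 1))%:C.
  have ice : cintegrable nu (fun x => (expR (v x) - 1)%:C).
    by split; [exact: ie|exact: integrable0].
  rewrite -cintegral_real -(cintegralN ice).
  apply: eq_cintegral => x; rewrite /g opprK cexp_real (rmorphB (real_complex R)).
  by rewrite opprB.
have := e2; rewrite e1 e3 opprK cintegral_real cexp_real => /(congr1 (@complex.Re R))/= e4.
have i2' : P.-integrable setT (fun w => (expR (\int[N w]_x v x))%:E) := i2.1.
have := integrable_fin_num measurableT i2'.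
move=> /fineK <-; rewrite -[fine _]/(\int[P]_w expR (\int[N w]_x v x)) -e4.
rewrite lee_fin ler_expR; apply: le_Rintegral.
- exact: measurableT.
- exact: ie.
- exact: (cintegrable_normc fnu).
move=> x _; apply: le_trans (expR_pneg x); by rewrite lerD2r ler_expR.
Qed.

Import HBNNSimple.

(** The negative real part of [f] is what may make exp(- N f) large. Its simple
    approximations have exponential moments bounded uniformly by [moment_bound],
    and Fatou passes to the limit. *)
Lemma negative_part_moment :
  P.-integrable setT (fun w => (expR (\int[N w]_x pneg x))%:E).
Proof.
have mpe : measurable_fun setT (EFin \o pneg) by exact/measurable_EFinP.
pose v_ k x : R := nnsfun_approx measurableT mpe k x.
have v0 k x : 0 <= v_ k x by exact: fun_ge0.
have vp k x : v_ k x <= pneg x.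
  rewrite -lee_fin /v_ nnsfun_approxE; apply: (le_approx (f := EFin \o pneg)) => //.
  by move=> y _; rewrite lee_fin.
have mv k : measurable_fun setT (v_ k) by exact: measurable_funP.
have fv k : finite_set (range (v_ k)) by exact: fimfunP.
have cv x : v_ k x @[k --> \oo] --> pneg x.
  have := @cvg_nnsfun_approx _ _ _ _ measurableT _ mpe (fun y _ => pneg_ge0 y) x I.
  move=> /fine_cvg; exact.
pose u k w : \bar R := (expR (\int[N w]_x v_ k x))%:E.
have mu_ k : measurable_fun setT (u k).
  by apply/measurable_EFinP; apply: measurableT_comp => //; exact: mNi.
have mE : measurable_fun setT (fun w => expR (\int[N w]_x pneg x)).
  by apply: measurableT_comp => //; exact: mNi.
have cu : {ae P, forall w, setT w ->
    limn_einf (u^~ w) = (expR (\int[N w]_x pneg x))%:E}.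
  apply: filterS fN => w iw _.
  have [|||||_ c1 _] := @cvg_cintegral _ _ _ (N w) (fun k x => (v_ k x)%:C)
    (fun x => (pneg x)%:C) (fun x => normc (f x)).
  - by move=> k; exact: cmeasurable_real.
  - exact: cmeasurable_real.
  - exact: cintegrable_normc.
  - apply: aeW => x k; rewrite normc_real ger0_norm//.
    exact: le_trans (vp _ _) (pneg_le _).
  - by apply: aeW => x; split; [exact: cv|exact: cvg_cst].
  have c2 : u k w @[k --> \oo] --> (expR (\int[N w]_x pneg x))%:E.
    apply: cvg_EFin; first exact: nearW.
    by apply: (@continuous_cvg _ _ _ _ _ _ (@expR R)); [exact: continuous_expR|].
  exact: (cvg_limn_einf_sup c2).1.
apply/integrableP; split; first exact/measurable_EFinP.
rewrite (eq_integral (fun w => (expR (\int[N w]_x pneg x))%:E)); last first.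
  by move=> w _; rewrite gee0_abs// lee_fin expR_ge0.
have -> : (\int[P]_w (expR (\int[N w]_x pneg x))%:E = \int[P]_w limn_einf (u^~ w))%E.
  apply/esym; apply: ae_eq_integral => //; last exact/measurable_EFinP.
  rewrite (_ : (fun _ => _) = (fun w => - limn_esup ((fun k => \- u k)%E ^~ w))%E).
    apply: measurableT_comp => //; apply: measurable_fun_limn_esup => k.
    exact: measurableT_comp.
  by apply/funext => w; rewrite (limn_esupN (u^~ w)) oppeK.
have := @fatou _ _ _ P _ measurableT _ mu_ (fun k w _ => expR_ge0 _).
move=> /le_lt_trans; apply.
apply: (@le_lt_trans _ _ (expR (\int[nu]_x normc (1 - cexp (- f x))))%:E); last exact: ltry.
rewrite limn_einf_lim; apply: lime_le; first exact: is_cvg_einfs.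
apply: nearW => k; apply: le_trans (moment_bound (mv k) (fv k) (v0 k) (vp k)).
by apply: ereal_inf_lbound; exists k => /=.
Qed.

(** Passage to the limit: dominated convergence under the points of [N], under
    [nu] and under [P], the last one by [negative_part_moment]. *)
Lemma laplace_limit (f_ : nat -> borel V -> R[i]) (g : borel V -> R[i])
    (D : borel V -> R) :
  (forall k, cmeasurable (f_ k)) -> cmeasurable g -> (forall k, laplace_at (f_ k)) ->
  (forall k x, normc (f_ k x) <= normc (f x)) ->
  (forall k x, - complex.Re (f_ k x) <= pneg x) ->
  (forall x, complex.Re (f_ k x) @[k --> \oo] --> complex.Re (g x)) ->
  (forall x, complex.Im (f_ k x) @[k --> \oo] --> complex.Im (g x)) ->
  nu.-integrable setT (EFin \o D) ->
  (forall k x, normc (1 - cexp (- f_ k x)) <= D x) ->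
  laplace_at g.
Proof.
move=> mf_ mg lf_ ff fp c1 c2 iD fD.
have cN : {ae P, forall w,
    complex.Re (cexp (- cintegral (N w) (f_ k))) @[k --> \oo] -->
      complex.Re (cexp (- cintegral (N w) g)) /\
    complex.Im (cexp (- cintegral (N w) (f_ k))) @[k --> \oo] -->
      complex.Im (cexp (- cintegral (N w) g))}.
  apply: filterS fN => w iw.
  have [|||||_ d1 d2] := @cvg_cintegral _ _ _ (N w) f_ g (fun x => normc (f x)) => //.
  - exact: cintegrable_normc.
  - exact: aeW.
  - by apply: aeW.
  - exact: cvg_cexpN.
have bound : {ae P, forall w k, normc (cexp (- cintegral (N w) (f_ k))) <=
    expR (\int[N w]_x pneg x)}.
  apply: filterS fN => w iw k; rewrite normc_cexp ler_expR ReN.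
  have ik := dominated_integrable iw (mf_ k) (ff k).
  rewrite -ReN -cintegralN//; apply: le_Rintegral.
  - exact: measurableT.
  - exact: (cintegrableN ik).1.
  - apply: le_integrable (cintegrable_normc iw) => //; first exact/measurable_EFinP.
    by move=> x _; rewrite lee_fin !ger0_norm ?normc_ge0.
  - by move=> x _; rewrite ReN.
have mL h : cmeasurable h -> cmeasurable (fun w => cexp (- cintegral (N w) h)).
  exact: measurable_laplace.
have [iP p1 p2] := cvg_cintegral (fun k => mL _ (mf_ k)) (mL _ mg)
  negative_part_moment bound cN.
split => //.
have m1 h : cmeasurable h -> cmeasurable (fun x => 1 - cexp (- h x)).
  move=> mh; apply: cmeasurableD; first exact: cmeasurable_cst.
  exact/cmeasurableN/cmeasurable_exp/cmeasurableN.
have [|||||_ n1 n2] := @cvg_cintegral _ _ _ nu (fun k x => 1 - cexp (- f_ k x))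
   (fun x => 1 - cexp (- g x)) D.
- by move=> k; exact: m1.
- exact: m1.
- exact: iD.
- by apply: aeW.
- apply: aeW => x; have [e1 e2] := cvg_cexpN (c1 x) (c2 x); split.
    by rewrite ReD ReN; under eq_fun do rewrite ReD ReN; apply: cvgB => //; exact: cvg_cst.
  by rewrite ImD ImN; under eq_fun do rewrite ImD ImN; apply: cvgB => //; exact: cvg_cst.
have [q1 q2] := cvg_cexpN n1 n2.
have E k := (lf_ k).2.
by apply: complex_eqP; [apply: (cvg_unique _ p1)|apply: (cvg_unique _ p2)] => //;
  [apply: (eq_cvg_nat _ q1)|apply: (eq_cvg_nat _ q2)] => k; rewrite E.
Qed.

(** The positive and negative parts of both components are approximated from
    below by simple functions, so that neither the modulus nor the negative real
    part of [f] is ever exceeded. *)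
Lemma finite_valued_approximation : exists f_ : nat -> borel V -> R[i],
  [/\ forall k, cmeasurable (f_ k) /\ finite_set (range (f_ k)),
      forall k x, normc (f_ k x) <= normc (f x),
      forall k x, - complex.Re (f_ k x) <= pneg x,
      forall x, complex.Re (f_ k x) @[k --> \oo] --> complex.Re (f x) &
      forall x, complex.Im (f_ k x) @[k --> \oo] --> complex.Im (f x)].
Proof.
have key (h : borel V -> R) : measurable_fun setT h -> exists h_ : nat -> borel V -> R,
    [/\ forall k, measurable_fun setT (h_ k) /\ finite_set (range (h_ k)),
        forall k x, `|h_ k x| <= `|h x|,
        forall k x, - h_ k x <= Num.max (- h x) 0 &
        forall x, h_ k x @[k --> \oo] --> h x].
  move=> mh.
  pose p x : \bar R := (Num.max (h x) 0)%:E.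
  pose q x : \bar R := (Num.max (- h x) 0)%:E.
  have mp : measurable_fun setT p by apply/measurable_EFinP; exact: measurable_maxr.
  have mq : measurable_fun setT q.
    by apply/measurable_EFinP; apply: measurable_maxr => //; exact: measurableT_comp.
  have p0 x : (0 <= p x)%E by rewrite lee_fin le_max lexx orbT.
  have q0 x : (0 <= q x)%E by rewrite lee_fin le_max lexx orbT.
  pose u k x : R := nnsfun_approx measurableT mp k x.
  pose v k x : R := nnsfun_approx measurableT mq k x.
  have u0 k x : 0 <= u k x by exact: fun_ge0.
  have v0 k x : 0 <= v k x by exact: fun_ge0.
  have up k x : u k x <= Num.max (h x) 0.
    by rewrite -lee_fin /u nnsfun_approxE; exact: (le_approx (f := p)).
  have vq k x : v k x <= Num.max (- h x) 0.
    by rewrite -lee_fin /v nnsfun_approxE; exact: (le_approx (f := q)).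
  exists (fun k x => u k x - v k x); split.
  - move=> k; split; first by apply: measurable_funB; exact: measurable_funP.
    have fu : finite_set (range (u k)) by exact: fimfunP.
    have fv : finite_set (range (v k)) by exact: fimfunP.
    apply: sub_finite_set (finite_image (fun z => z.1 - z.2) (finite_setX fu fv)).
    by move=> _ [x _ <-]; exists (u k x, v k x) => //; split; exists x.
  - move=> k x; move: (u0 k x) (v0 k x) (up k x) (vq k x).
    case: (lerP 0 (h x)) => hx; rewrite ?(max_l hx) ?(max_r (ltW hx)).
      rewrite (ger0_norm hx) ler_norml (_ : Num.max (- h x) 0 = 0).
        by move=> *; apply/andP; split; lra.
      by rewrite max_r ?oppr_le0.
    rewrite (ltr0_norm hx) ler_norml (_ : Num.max (- h x) 0 = - h x).
      by move=> *; apply/andP; split; lra.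
    by rewrite max_l// oppr_ge0 ltW.
  - by move=> k x; rewrite opprB lerBlDr; apply: le_trans (vq k x) _; rewrite lerDl.
  - move=> x.
    have cu := fine_cvg (cvg_nnsfun_approx measurableT mp (fun y _ => p0 y) I : _ --> (Num.max (h x) 0)%:E).
    have cv := fine_cvg (cvg_nnsfun_approx measurableT mq (fun y _ => q0 y) I : _ --> (Num.max (- h x) 0)%:E).
    have -> : h x = Num.max (h x) 0 - Num.max (- h x) 0.
      case: (lerP 0 (h x)) => hx.
        by rewrite max_r ?oppr_le0// subr0.
      by rewrite max_l ?oppr_ge0 ?ltW// opprK add0r.
    exact: (cvgB (cu _) (cv _)).
have [a [fa la na ca]] := key _ mf.1.
have [b [fb lb _ cb]] := key _ mf.2.
exists (fun k x => a k x +i* b k x); split => //=.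
- move=> k; split; first by split; [exact: (fa k).1|exact: (fb k).1].
  apply: sub_finite_set (finite_image (fun z => z.1 +i* z.2) (finite_setX (fa k).2 (fb k).2)).
  by move=> _ [x _ <-]; exists (a k x, b k x) => //; split; exists x.
- move=> k x; rewrite !normcE ler_sqrt ?addr_ge0 ?sqr_ge0//=.
  by apply: lerD; rewrite -[leLHS]real_normK ?num_real// -[leRHS]real_normK ?num_real//;
    rewrite lerXn2r ?nnegrE.
Qed.

(** Two passages to the limit. Where |f| is at least 1/(k+1) the measure [nu] is
    finite and constants are integrable, so the finite-valued approximations
    converge; then the truncations of [f] to these sets converge, dominated by
    |1 - exp(- f)| itself. *)
Lemma poisson_laplace : laplace_at f.
Proof.
have [f_ [mf_ nf_ pf_ c1 c2]] := finite_valued_approximation.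
pose A (k : nat) : set (borel V) := [set x | k.+1%:R^-1 <= normc (f x)].
have mA k : measurable (A k).
  rewrite -[X in measurable X]setTI
    (_ : A k = (fun x => normc (f x)) @^-1` `[k.+1%:R^-1, +oo[).
    exact: (measurable_normc mf).
  by apply/seteqP; split => x /=; rewrite in_itv/= andbT.
have m1 k : cmeasurable (fun x => (\1_(A k) x)%:C).
  by apply: cmeasurable_real; exact: measurable_indic.
have n1 k (z : R[i]) x : normc ((\1_(A k) x)%:C * z) <= normc z.
  rewrite ComplexField.Normc.normcM normc_real indicE; case: (x \in A k).
    by rewrite normr1 mul1r.
  by rewrite normr0 mul0r normc_ge0.
have pneg1 k (z : R[i]) x : - complex.Re z <= pneg x ->
    - complex.Re ((\1_(A k) x)%:C * z) <= pneg x.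
  by move=> zp; rewrite ReZ indicE; case: (x \in A k); rewrite ?mul1r// mul0r oppr0.
(* On A k, |1 - exp(- f_j)| <= 1 + exp(pneg) <= 2 + |1 - exp(- f)|. *)
have cut k : laplace_at (fun x => (\1_(A k) x)%:C * f x).
  apply: (@laplace_limit (fun j x => (\1_(A k) x)%:C * f_ j x) _
    (fun x => normc (1 - cexp (- f x)) + 2 * \1_(A k) x)).
  - by move=> j; apply: cmeasurableM => //; exact: (mf_ j).1.
  - exact: cmeasurableM.
  - move=> j; have mj : cmeasurable (fun x => (\1_(A k) x)%:C * f_ j x).
      by apply: cmeasurableM => //; exact: (mf_ j).1.
    apply: laplace_finite_valued => //.
      apply: sub_finite_set (finite_image (fun z : bool * R[i] => z.1%:R%:C * z.2)
         (finite_setX (@finite_finset _ setT) (mf_ j).2)).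
      by move=> _ [x _ <-]; exists (x \in A k, f_ j x) => //; split => //; exists x.
    by move=> c; apply: far_level => // x; exact: le_trans (n1 _ _ _) (nf_ _ _).
  - by move=> j x; exact: le_trans (n1 _ _ _) (nf_ _ _).
  - by move=> j x; exact: pneg1.
  - move=> x; rewrite ReZ; under eq_fun do rewrite ReZ; apply: cvgM (c1 x); exact: cvg_cst.
  - move=> x; rewrite ImZ; under eq_fun do rewrite ImZ; apply: cvgM (c2 x); exact: cvg_cst.
  - have h1 := cintegrable_normc fnu.
    have h2 := (cintegral_indic (mA k) (finite_far _)).1.1.
    have e0 : 0 < k.+1%:R^-1 :> R by rewrite invr_gt0.
    exact: (integrableD measurableT h1 (integrableZl measurableT 2 (h2 e0))).
  - move=> j x; rewrite indicE; case: (x \in A k); last first.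
      by rewrite mul0r oppr0 cexp0 subrr normc_real normr0 mulr0 addr0 normc_ge0.
    rewrite mul1r mulr1; apply: le_trans (normcD _ _) _.
    rewrite normcN normc_cexp -[X in normc X]/(1%:C) normc_real normr1.
    have := expR_pneg x; have : expR (complex.Re (- f_ j x)) <= expR (pneg x).
      by rewrite ler_expR ReN.
    lra.
have cvg1 (h : borel V -> R) x : (f x = 0 -> h x = 0) ->
    \1_(A k) x * h x @[k --> \oo] --> h x.
  move=> h0; have [fx0|fx0] := eqVneq (f x) 0.
    by rewrite h0//; under eq_fun do rewrite mulr0; exact: cvg_cst.
  apply: cvg_near_cst.
  have nfx : 0 < normc (f x).
    by rewrite lt_neqAle normc_ge0 andbT eq_sym; apply: contra_neq fx0;
      exact: ComplexField.Normc.eq0_normc.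
  have /cvgrPdist_lt /(_ _ nfx) := @cvg_harmonic R; apply: filterS => k.
  rewrite sub0r normrN ger0_norm ?harmonic_ge0// => /ltW kx.
  by rewrite indicE mem_set ?mul1r.
apply: (@laplace_limit (fun k x => (\1_(A k) x)%:C * f x) _
    (fun x => normc (1 - cexp (- f x)))) => //.
- by move=> k; exact: cmeasurableM.
- by move=> k x; apply: pneg1; rewrite /pneg le_max lexx.
- move=> x; under eq_fun do rewrite ReZ.
  by apply: (cvg1 (fun x => complex.Re (f x))) => ->.
- move=> x; under eq_fun do rewrite ImZ.
  by apply: (cvg1 (fun x => complex.Im (f x))) => ->.
- exact: cintegrable_normc.
- move=> k x; rewrite indicE; case: (x \in A k); rewrite ?mul1r//.
  by rewrite mul0r oppr0 cexp0 subrr normc_real normr0 normc_ge0.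
Qed.

End complex_test_function.

End poisson_functional.

(** * Law of a vector of independent Gaussian variables *)

(** Makes the uniqueness theorem for measures applicable to integrals of [f]. *)
Lemma density_measure d (T : measurableType d) (R : realType)
    (mu : {measure set T -> \bar R}) (f : T -> \bar R) :
  measurable_fun setT f -> (forall x, 0 <= f x)%E ->
  exists m : {measure set T -> \bar R}, forall A, m A = (\int[mu]_(x in A) f x)%E.
Proof.
move=> mf f0; pose m A := (\int[mu]_(x in A) f x)%E.
have m0 : m set0 = 0%E by rewrite /m integral_set0.
have m_ge0 A : (0 <= m A)%E by exact: integral_ge0.
have m_add : semi_sigma_additive m.
  move=> F mF tF mUF; rewrite /m ge0_integral_bigcup//; last first.
    exact: measurable_funTS.
  by apply: is_cvg_nneseries => k _ _; exact: integral_ge0.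
pose mm : {measure set T -> \bar R} :=
  HB.pack m (isMeasure.Build _ _ _ m m0 m_ge0 m_add).
by exists mm.
Qed.

Section affine_change.
Context {R : realType}.
Notation lebesgue := (@lebesgue_measure R).

Lemma lebesgue_affine (a s : R) (B : set (measurableTypeR R)) : 0 < s -> measurable B ->
  lebesgue B = (s%:E * lebesgue ((fun x => a + s * x)%R @^-1` B))%E.
Proof.
move=> s0 mB.
have mphi : measurable_fun setT (fun x : measurableTypeR R => a + s * x : measurableTypeR R).
  by apply: measurable_funD => //; exact: measurable_funM.
have [m1 m1E] := image_measure lebesgue mphi.
rewrite (@lebesgue_measure_unique _ (mscale (NngNum (ltW s0)) m1))//; last first.
  move=> _ [[b c] _ <-]/=; rewrite /mscale/= m1E.
  transitivity (s%:E * (if ((b - a) / s < (c - a) / s)%R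
      then ((c - a) / s)%:E - ((b - a) / s)%:E else 0))%E; last first.
    congr (_ * _)%E; rewrite (_ : _ @^-1` _ = `](b - a) / s, (c - a) / s]%classic).
      by apply/esym; apply: (etrans (lebesgue_measure_itv _)); rewrite /= lte_fin.
    apply/seteqP; split => x /=; rewrite !in_itv/= ltr_pdivrMr// ler_pdivlMr//;
    by rewrite ltrBlDl lerBrDl mulrC.
  rewrite lebesgue_measure_itv/= lte_fin ltr_pM2r ?invr_gt0// ltrD2r.
  case: ifPn => bc; last by rewrite mule0.
  by rewrite -!EFinB -EFinM; congr _%:E; field; rewrite gt_eqF.
by transitivity (s%:E * m1 B)%E => //; congr (_ * _)%E; exact: m1E.
Qed.

Lemma ge0_integral_affine (a s : R) (f : measurableTypeR R -> \bar R) : 0 < s ->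
  measurable_fun setT f -> (forall x, 0 <= f x)%E ->
  (\int[lebesgue]_x f x = s%:E * \int[lebesgue]_x f (a + s * x)%R)%E.
Proof.
move=> s0 mf f0.
have mphi : measurable_fun setT (fun x : measurableTypeR R => a + s * x : measurableTypeR R).
  by apply: measurable_funD => //; exact: measurable_funM.
rewrite -(@ge0_integral_mscale _ _ _ _ _ measurableT (NngNum (ltW s0)))//; last first.
  exact: (measurableT_comp mf mphi).
apply: (@ge0_integral_image _ _ _ _ _ (mscale (NngNum (ltW s0)) lebesgue) _ mphi lebesgue) => //.
by move=> A mA; exact: lebesgue_affine.
Qed.

End affine_change.

Section gaussian_sample.
Context d (T : measurableType d) (R : realType) (P : probability T R).

Lemma npdf_scale (v x : R) : 0 < v ->
  Num.sqrt v * npdf v (Num.sqrt v * x) = normal_pdf 0 1 x.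
Proof.
move=> v0; rewrite -[X in normal_pdf 0 X]sqrtr1 -npdf_normal_pdf// subr0 /npdf mulr1 invr1.
have -> : gauss v^-1 (Num.sqrt v * x) = gauss 1 x.
  by rewrite /gauss exprMn sqr_sqrtr ?ltW// mulrA mulVf ?gt_eqF.
rewrite mulrA; congr (_ * _).
rewrite [Num.sqrt (2 * pi * v)]sqrtrM ?mulr_ge0 ?pi_ge0// invfM mulrCA mulfV ?mulr1//.
by rewrite gt_eqF// sqrtr_gt0.
Qed.

Lemma affine_normal_law (eps : {RV P >-> R}) (v a : R) (B : set (measurableTypeR R)) :
  (forall B : set R, measurable B -> distribution P eps B = normal_prob 0 1 B) ->
  0 < v -> measurable B ->
  P ((fun w => a + Num.sqrt v * eps w)%R @^-1` B) =
  (\int[@lebesgue_measure R]_x (\1_B x * npdf v (x - a))%:E)%E.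
Proof.
move=> law v0 mB; set s := Num.sqrt v.
have s0 : 0 < s by rewrite sqrtr_gt0.
have mphi : measurable_fun setT (fun x : measurableTypeR R => a + s * x : measurableTypeR R).
  by apply: measurable_funD => //; exact: measurable_funM.
have mphiB : measurable ((fun x : measurableTypeR R => a + s * x) @^-1` B).
  by rewrite -[X in measurable X]setTI; exact: mphi.
have mf : measurable_fun setT (fun x : measurableTypeR R => (\1_B x * npdf v (x - a))%:E).
  apply/measurable_EFinP; apply: measurable_funM; first exact: measurable_indic.
  by apply: measurable_npdf; [exact: measurable_cst|exact: measurable_funB].
rewrite (ge0_integral_affine a s0 mf); last first.
  by move=> x; rewrite lee_fin mulr_ge0 ?npdf_ge0.
transitivity (normal_prob 0 1 ((fun x : measurableTypeR R => a + s * x) @^-1` B)).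
  by rewrite -law.
rewrite -ge0_integralZl//; last 3 first.
- exact: (measurableT_comp mf mphi).
- by move=> x _; rewrite lee_fin mulr_ge0 ?npdf_ge0.
- exact: ltW.
rewrite /normal_prob [LHS]integral_mkcond.
apply: eq_integral => x _.
rewrite patchE indicE -EFinM.
rewrite (_ : (_ \in _) = (a + s * x \in B)); last by [].
case: (_ \in B); last by rewrite mul0r mulr0.
by rewrite mul1r addrAC subrr add0r npdf_scale.
Qed.

(** Both sides are finite measures in [B] and factorize over the coordinates of a
    box, where [affine_normal_law] applies. *)
Lemma gaussian_sample_law n (eps : 'I_n -> {RV P >-> R}) (v a : 'I_n -> R)
    (B : set (Rn R n)) :
  (forall i (B : set R), measurable B ->
     distribution P (eps i) B = normal_prob 0 1 B) ->
  box_independent P (fun i => eps i : T -> measurableTypeR R) ->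
  (forall i, 0 < v i) -> measurable B ->
  P ((fun w => [tuple a i + Num.sqrt (v i) * eps i w | i < n]) @^-1` B) =
  (\int[lebesgue_rn R n]_(x in B) (\prod_(i < n) npdf (v i) (tnth x i - a i))%:E)%E.
Proof.
move=> law ind v0 mB.
pose X w : Rn R n := [tuple a i + Num.sqrt (v i) * eps i w | i < n].
have mX : measurable_fun setT X.
  apply/measurable_fun_tnthP => i.
  rewrite (_ : _ \o _ = fun w => a i + Num.sqrt (v i) * eps i w).
    by apply: measurable_funD => //; exact: measurable_funM.
  by apply/funext => w /=; rewrite tnth_mktuple.
have [m1 m1E] := image_measure P mX.
have mf i : measurable_fun setT (fun x : measurableTypeR R => npdf (v i) (x - a i)).
  by apply: measurable_npdf; [exact: measurable_cst|exact: measurable_funB].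
have [||m2 m2E] := @density_measure _ _ _ (lebesgue_rn R n)
  (fun x => (\prod_(i < n) npdf (v i) (tnth x i - a i))%:E).
- have mprod := measurable_prod_rn mf; apply/measurable_EFinP; exact: mprod.
- by move=> x; rewrite lee_fin prodr_ge0// => i _; exact: npdf_ge0.
rewrite -m2E -[LHS]/(P (X @^-1` B)) -m1E; apply: box_measure_unique => //.
  rewrite m1E preimage_setT; apply: (@le_lt_trans _ _ 1%E); last exact: ltry.
  exact: probability_le1.
move=> C mC; rewrite m1E m2E.
pose phi i (x : measurableTypeR R) : measurableTypeR R := a i + Num.sqrt (v i) * x.
have mphiC i : measurable (phi i @^-1` C i).
  rewrite -[X in measurable X]setTI; apply: (_ : measurable_fun setT (phi i)) => //.
  by apply: measurable_funD => //; exact: measurable_funM.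
transitivity (P (\bigcap_i (eps i : T -> measurableTypeR R) @^-1` (phi i @^-1` C i))).
  congr (P _); apply/seteqP; split => w h i.
    by move=> _; have := h i; rewrite tnth_mktuple.
  by have := h i I; rewrite /X tnth_mktuple.
rewrite ind//; under eq_bigr do rewrite (affine_normal_law (a _) (law _) (v0 _) (mC _)).
rewrite -ge0_integral_prod_rn; last 2 first.
- by move=> i; apply: measurable_funM => //; exact: measurable_indic.
- by move=> i x; rewrite mulr_ge0 ?npdf_ge0.
rewrite [RHS]integral_mkcond; apply: eq_integral => x _; rewrite patchE big_split/=.
case: ifPn => [/set_mem xC|/negP xC].
  by rewrite big1 ?mul1r// => i _; rewrite indicE mem_set.
have [i xi] : exists i, tnth x i \notin C i.
  apply/existsP; rewrite -negb_forall; apply/negP => /forallP h; apply: xC.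
  by apply/mem_set => i; apply/set_mem.
by rewrite (bigD1 i)//= indicE (negbTE xi) !mul0r.
Qed.

End gaussian_sample.

(** * From a Gaussian mixture to the likelihood formula *)

(** [L] times exp(- n Abar beta) is the mixture density, so the three clauses are
    [mixture_inversion], [damped_fourier] and [cvg_mixture]. *)
Lemma likelihood_of_mixture d (T : measurableType d) (R : realType)
    (P : probability T R) n (w : T -> R) (m s : 'I_n -> T -> R)
    (mu Delta beta : R) (L : Rn R n -> \bar R) (Phi : Rn R n -> R[i]) :
  (0 < n)%N ->
  measurable_fun setT w -> (forall o, 0 <= w o) -> P.-integrable setT (EFin \o w) ->
  (forall i, measurable_fun setT (m i)) -> (forall i, measurable_fun setT (s i)) ->
  (forall i o, 0 < s i o) ->
  (forall x, L x = ((expR (n%:R * sample_mean (centered mu Delta x) * beta))%:E *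
     mixture P w m s 0 (centered mu Delta x))%E) ->
  (forall y, Phi y = mixture_fourier P w m s y) ->
  likelihood_formula mu Delta beta L Phi.
Proof.
move=> n0 mw w0 wi mm ms s0 LE PhiE.
(* The variable of the Fourier inversion is the return itself: the shift by
   mu Delta is put into the means. *)
pose c := mu * Delta; pose m' i o := m i o + c.
have mm' i : measurable_fun setT (m' i) by exact: measurable_funD.
have mixE e x : mixture P w m s e (centered mu Delta x) = mixture P w m' s e x.
  apply: eq_integral => o _; congr (_ * _)%:E; apply: eq_bigr => i _.
  by rewrite tnth_mktuple /m' opprD addrA addrAC.
pose u (y : Rn R n) : R[i] := \prod_(i < n) cexp ('i * (c * tnth y i)%:C).
have uE (y x : Rn R n) : u y * \prod_(i < n) cexp ('i * (tnth (centered mu Delta x) i * tnth y i)%:C)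
    = \prod_(i < n) cexp ('i * (tnth x i * tnth y i)%:C).
  rewrite -big_split/=; apply: eq_bigr => i _; rewrite -cexpD tnth_mktuple.
  by congr cexp; rewrite -mulrDr -(rmorphD (real_complex R)) -mulrDl addrC subrK.
pose Phi' := mixture_fourier P w m' s.
have iF := cintegrable_mixture_fourier mw w0 wi mm' ms s0.
have Phi'u y : Phi y = Phi' y * u y.
  rewrite PhiE /Phi' /mixture_fourier mulrC -(cintegralZ _ (iF y)).
  apply: eq_cintegral => o; rewrite mulrCA; congr (_ * _).
  rewrite -big_split/=; apply: eq_bigr => i _; rewrite -cexpD; congr cexp.
  by apply: complex_eqP; rewrite ?ReD ?ImD ?ReM ?ImM/= /m'; ring.
have kernelE (G : Rn R n -> R) x : cintegral (lebesgue_rn R n) (fun y => Phi y * (G y)%:C *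
    \prod_(i < n) cexp ('i * (tnth (centered mu Delta x) i * tnth y i)%:C)) =
    cintegral (lebesgue_rn R n) (fun y => Phi' y * (G y)%:C *
    \prod_(i < n) cexp ('i * (tnth x i * tnth y i)%:C)).
  apply: eq_cintegral => y.
  by rewrite -(uE y x) Phi'u !mulrA (mulrAC (Phi' y) (u y)).
have pn0 : (2 * pi) ^+ n != 0 :> R by rewrite expf_neq0// mulf_neq0// gt_eqF// pi_gt0.
set A := centered mu Delta in LE mixE uE kernelE *.
split; last split.
- move=> iPhi.
  pose v (y : Rn R n) : R[i] := \prod_(i < n) cexp ('i * (- (c * tnth y i))%:C).
  have Phi'v y : Phi' y = Phi y * v y.
    rewrite Phi'u -mulrA -big_split/= big1 ?mulr1// => i _.
    by rewrite -cexpD -mulrDr -(rmorphD (real_complex R)) subrr mulr0 cexp0.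
  have iPhi' : cintegrable (lebesgue_rn R n) Phi'.
    apply: (@cintegrable_le _ _ _ _ _ (fun y => normc (Phi y))).
    + rewrite (funext Phi'v); apply: cmeasurableM.
        exact: cintegrable_cmeasurable iPhi.
      apply: cmeasurable_prod => i; apply: cmeasurable_exp.
      apply: cmeasurableM; first exact: cmeasurable_cst.
      apply: cmeasurable_real; apply: measurableT_comp => //.
      by apply: measurable_funM => //; exact: measurable_tnth.
    + exact: cintegrable_normc.
    + move=> y; rewrite Phi'v ComplexField.Normc.normcM normc_prod big1 ?mulr1// => i _.
      by rewrite normc_cexp ReM/= mul0r mul1r subrr expR0.
  apply: (@filterS _ _ (ae_filter_ringOfSetsType (lebesgue_rn R n)) _ _ _ (mixture_inversion mw w0 wi mm' ms s0 iPhi')) => x [ix fx].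
  rewrite -/Phi' in ix.
  have lE : fourier_likelihood beta Phi (A x) =
      (expR (n%:R * sample_mean (A x) * beta) * fine (mixture P w m' s 0 x))%:C.
    rewrite /fourier_likelihood.
    have := kernelE (fun=> 1) x; under eq_cintegral do rewrite mulr1.
    move=> ->; under eq_cintegral do rewrite mulr1; rewrite ix mulrA.
    by rewrite -!(rmorphM (real_complex R)) mulfVK.
  rewrite -/(A x) lE; split => //.
  by rewrite LE mixE -[in LHS](fineK fx).
- move=> e e0.
  have [+ _ _] := damped_fourier mw w0 wi mm' ms s0 [tuple c | i < n] e0.
  congr cintegrable; apply/funext => y; rewrite /gauss_damped Phi'u -/Phi' mulrAC.
  by congr (_ * _ * _); apply: eq_bigr => i _; rewrite tnth_mktuple.
- have := cvg_mixture mw w0 wi mm' ms s0; apply: cvg_trans.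
  apply: near_eq_cvg; near=> e; apply: eq_integral => x _.
  have e0 : 0 < e by near: e; exact: nbhs_right_gt.
  have [_ im cE] := damped_fourier mw w0 wi mm' ms s0 x e0.
  have fe : mixture P w m' s e x \is a fin_num by exact: integrable_fin_num.
  set E := expR (n%:R * sample_mean (A x) * beta).
  have E0 : 0 < E by exact: expR_gt0.
  have lE : complex.Re (fourier_likelihood beta (gauss_damped e Phi) (A x)) =
      E * fine (mixture P w m' s e x).
    rewrite /fourier_likelihood.
    have := kernelE (fun y => expR (- (e * (\sum_(i < n) tnth y i ^+ 2) / 2))) x.
    move=> ->; rewrite cE -(rmorphM (real_complex R))/=.
    by rewrite mulrA mulfVK.
  transitivity ((expR (- (n%:R * sample_mean (A x) * beta)))%:E *
    `|L x - (complex.Re (fourier_likelihood beta (gauss_damped e Phi) (A x)))%:E|)%E; last by [].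
  rewrite lE LE -/E mixE expRN EFinM (fineK fe).
  have absE z : (`|E%:E * z| = E%:E * `|z|)%E by rewrite abseM gee0_abs// lee_fin ltW.
  rewrite -muleBr ?fin_num_adde_defl ?fin_numN// absE muleA.
  by rewrite -EFinM mulVf ?gt_eqF// mul1e.
Unshelve. all: by end_near.
Qed.

(** * Sigma-algebras generated by the data *)

Section generated.
Context d (T : measurableType d).

(** Independence is assumed for sigma-algebras, while [decoupling_complex] speaks
    of random variables: the identity into [T] with a smaller sigma-algebra
    translates one into the other. *)
Lemma measurable_id_generated (G : set (set T)) : (forall E, G E -> measurable E) ->
  measurable_fun setT (id : T -> g_sigma_algebraType G).
Proof.
move=> mG _ A mA; rewrite setTI preimage_id.
move: A mA; apply: smallest_sub => //; exact: sigma_algebra_measurable.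
Qed.

Lemma measurable_sigma_of (I : Type) d' (S : measurableType d') (D : set I)
    (f : I -> T -> S) : (forall i, D i -> measurable_fun setT (f i)) ->
  forall E, sigma_of D f E -> measurable E.
Proof.
move=> mf; apply: smallest_sub; first exact: sigma_algebra_measurable.
move=> _ [i [B [Di mB ->]]]; rewrite -[X in measurable X]setTI.
exact: (mf i Di measurableT B mB).
Qed.

Lemma measurable_sigma_join (F G : set (set T)) : (forall E, F E -> measurable E) ->
  (forall E, G E -> measurable E) -> forall E, sigma_join F G E -> measurable E.
Proof.
move=> mF mG; apply: smallest_sub; first exact: sigma_algebra_measurable.
by move=> E [/mF|/mG].
Qed.

Lemma measurable_generated (G : set (set T)) (I : Type) d' (S : measurableType d')
    (D : set I) (f : I -> T -> S) i : D i -> sigma_of D f `<=` <<s G >> ->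
  measurable_fun setT (f i : g_sigma_algebraType G -> S).
Proof.
move=> Di sG _ B mB; rewrite setTI; apply: sG.
by apply: sub_sigma_algebra; exists i, B.
Qed.

End generated.

(** * Conditional law of the returns *)

Section returns.
Context d (T : measurableType d) (R : realType) (P : probability T R).
Context (V : completeMetricType R) (N : R.-ker T ~> borel V) (n : nat).
Variables (beta rho : R) (h g : 'I_n -> borel V -> R).
Hypotheses (h_meas : forall i, measurable_fun setT (h i))
  (g_meas : forall i, measurable_fun setT (g i))
  (h_ge0 : forall i x, 0 <= h i x) (g_ge0 : forall i x, 0 <= g i x)
  (taus_fin : {ae P, forall o, forall i,
     (0 < \int[N o]_x (h i x + g i x)%:E)%E /\
     (\int[N o]_x (h i x + g i x)%:E < +oo)%E}).
Variables (J1 J2 : R -> T -> R).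
Hypotheses (J1_levy : levy_process P J1) (J2_levy : levy_process P J2).

Let tau i := rm_integral N (h i).
Let gamma i := rm_integral N (g i).

Let tau_ge0 i o : 0 <= tau i o.
Proof. by apply: fine_ge0; apply: integral_ge0 => x _; rewrite lee_fin. Qed.
Let gamma_ge0 i o : 0 <= gamma i o.
Proof. by apply: fine_ge0; apply: integral_ge0 => x _; rewrite lee_fin. Qed.

(** The clocks are read at the sample point [oN] and the paths at [oJ], so that
    after decoupling the two can be integrated separately. *)
Definition drift (i : 'I_n) (oN oJ : T) : R :=
  time_changed_increment J1 (fun i _ => tau i oN) i oJ +
  time_changed_increment J2 (fun i _ => gamma i oN) i oJ + rho * gamma i oN.

Section measurability.
Context d' (Z : measurableType d') (pN pJ : Z -> T).
Hypotheses (mN : forall U, measurable U -> measurable_fun setT (fun z => N (pN z) U))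
  (mJ1 : forall t, 0 <= t -> measurable_fun setT (fun z => J1 t (pJ z)))
  (mJ2 : forall t, 0 <= t -> measurable_fun setT (fun z => J2 t (pJ z))).

Lemma measurable_tau i : measurable_fun setT (fun z => tau i (pN z)).
Proof. exact: (measurable_rm_integral (N := fun z => N (pN z))). Qed.

Lemma measurable_gamma i : measurable_fun setT (fun z => gamma i (pN z)).
Proof. exact: (measurable_rm_integral (N := fun z => N (pN z))). Qed.

Lemma measurable_drift i : measurable_fun setT (fun z => drift i (pN z) (pJ z)).
Proof.
have [_ _ _ _ rc1] := J1_levy; have [_ _ _ _ rc2] := J2_levy.
have m1 := @measurable_time_changed_increment _ _ _ _ (fun t z => J1 t (pJ z))
  (fun i z => tau i (pN z)) i mJ1 (fun z t t0 => (rc1 (pJ z) t t0).1)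
  measurable_tau (fun i z => tau_ge0 i (pN z)).
have m2 := @measurable_time_changed_increment _ _ _ _ (fun t z => J2 t (pJ z))
  (fun i z => gamma i (pN z)) i mJ2 (fun z t t0 => (rc2 (pJ z) t t0).1)
  measurable_gamma (fun i z => gamma_ge0 i (pN z)).
apply: measurable_funD; first exact: (measurable_funD m1 m2).
by apply: measurable_funM => //; exact: measurable_gamma.
Qed.

End measurability.

Let vol i o := tau i o + gamma i o.

Let vol_ge0 i o : 0 <= vol i o. Proof. exact: addr_ge0. Qed.

(** Off this null event [rm_integral] is a genuine integral and not the value 0
    that it takes when the integral is infinite. *)
Lemma clocks_finite : {ae P, forall o,
  (forall i, 0 < vol i o) /\
  (forall i, (N o).-integrable setT (EFin \o h i) /\ (N o).-integrable setT (EFin \o g i))}.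
Proof.
apply: filterS taus_fin => o fin.
have ih i : (N o).-integrable setT (EFin \o h i).
  apply/integrableP; split; first exact/measurable_EFinP.
  apply: le_lt_trans (fin i).2; apply: ge0_le_integral => //.
  - exact/measurable_EFinP/measurableT_comp.
  - exact/measurable_EFinP/measurable_funD.
  - by move=> x _; rewrite /= lee_fin ger0_norm// lerDl.
have ig i : (N o).-integrable setT (EFin \o g i).
  apply/integrableP; split; first exact/measurable_EFinP.
  apply: le_lt_trans (fin i).2; apply: ge0_le_integral => //.
  - exact/measurable_EFinP/measurableT_comp.
  - exact/measurable_EFinP/measurable_funD.
  - by move=> x _; rewrite /= lee_fin ger0_norm// lerDr.
split => // i.
have -> : vol i o = fine (\int[N o]_x (h i x + g i x)%:E).
  by rewrite /vol /tau /gamma /rm_integral -RintegralD.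
by apply: fine_gt0; exact/andP/(fin i).
Qed.

Lemma conditional_densityE i a o :
  conditional_density beta rho J1 J2 tau gamma i a o =
  expR ((a - drift i o o) * beta - vol i o * beta ^+ 2 / 2) *
    npdf (vol i o) (a - drift i o o).
Proof.
rewrite /conditional_density /=.
set z := a - _ - _ - _; have -> : a - drift i o o = z by rewrite /drift /z; ring.
have sE : Num.sqrt (2 * pi * vol i o) = Num.sqrt (2 * pi) * Num.sqrt (vol i o).
  by rewrite sqrtrM ?mulr_ge0 ?pi_ge0.
rewrite -/(vol i o) /npdf /gauss sE expRD [(Num.sqrt (2 * pi) * _)^-1]invfM.
have -> : (vol i o)^-1 * z ^+ 2 / 2 = z ^+ 2 / (2 * vol i o) by rewrite invfM; ring.
ring.
Qed.

(** Completing the square: exp(z beta - v beta^2/2) moves the mean of a Gaussian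
    density of variance v by beta v. *)
Lemma conditional_density_npdf i a o : 0 < vol i o ->
  conditional_density beta rho J1 J2 tau gamma i a o =
  npdf (vol i o) (a - (drift i o o + beta * vol i o)).
Proof.
move=> v0; rewrite conditional_densityE /npdf /gauss mulrCA -expRD.
by congr (_ * expR _); field; rewrite gt_eqF.
Qed.

Lemma conditional_density_ge0 i a o :
  0 <= conditional_density beta rho J1 J2 tau gamma i a o.
Proof. by rewrite conditional_densityE mulr_ge0 ?expR_ge0 ?npdf_ge0. Qed.

Let mN U : measurable U -> measurable_fun setT (fun o => N o U).
Proof. by move=> mU; exact: measurable_kernel. Qed.
Let mJ1 t : 0 <= t -> measurable_fun setT (J1 t).
Proof. by have [m _ _ _ _] := J1_levy; exact: m. Qed.
Let mJ2 t : 0 <= t -> measurable_fun setT (J2 t).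
Proof. by have [m _ _ _ _] := J2_levy; exact: m. Qed.

Let mvol i : measurable_fun setT (vol i).
Proof. by apply: measurable_funD; [exact: measurable_tau|exact: measurable_gamma]. Qed.

Lemma measurable_conditional_density d' (Z : measurableType d') (a : Z -> R) (p : Z -> T) i :
  measurable_fun setT a -> measurable_fun setT p ->
  measurable_fun setT (fun z => conditional_density beta rho J1 J2 tau gamma i (a z) (p z)).
Proof.
move=> ma mp; under eq_fun do rewrite conditional_densityE.
have md : measurable_fun setT (fun z => drift i (p z) (p z)).
  exact: (measurableT_comp (measurable_drift mN mJ1 mJ2 i) mp).
have mv : measurable_fun setT (fun z => vol i (p z)) by exact: measurableT_comp.
apply: measurable_funM; last by apply: measurable_npdf => //; exact: measurable_funB.
apply: measurableT_comp => //; apply: measurable_funB.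
  by apply: measurable_funM => //; exact: measurable_funB.
by apply: measurable_funM => //; apply: measurable_funM.
Qed.

Section density.
Variables (eps : 'I_n -> {RV P >-> R}) (mu Delta : R).
Hypotheses (eps_normal : forall i (B : set R), measurable B ->
     distribution P (eps i) B = normal_prob 0 1 B)
  (eps_indep : mutually_independent P
     (fun i => sigma_of [set i] (fun j : 'I_n => (eps j : T -> R))))
  (eps_N_J_indep : independent P
     (sigma_of setT (fun j : 'I_n => (eps j : T -> R)))
     (sigma_join (sigma_random_measure N)
        (sigma_join (sigma_of [set t | 0 <= t] J1)
                    (sigma_of [set t | 0 <= t] J2)))).

Let past := sigma_random_measure N `|`
  sigma_join (sigma_of [set t | 0 <= t] J1) (sigma_of [set t | 0 <= t] J2).
Let Past := g_sigma_algebraType past.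

Let pastN U : measurable U -> measurable_fun setT (fun o : Past => N o U).
Proof.
move=> mU; apply: (@measurable_generated _ _ past _ _ _ _ (fun U o => N o U) _ mU).
by move=> E EN; apply: sub_sigma_algebra; left.
Qed.

Let pastJ1 t : 0 <= t -> measurable_fun setT (J1 t : Past -> R).
Proof.
move=> t0; apply: (@measurable_generated _ _ past _ _ _ [set t | 0 <= t] J1 _ t0).
by move=> E EN; apply: sub_sigma_algebra; right; apply: sub_sigma_algebra; left.
Qed.

Let pastJ2 t : 0 <= t -> measurable_fun setT (J2 t : Past -> R).
Proof.
move=> t0; apply: (@measurable_generated _ _ past _ _ _ [set t | 0 <= t] J2 _ t0).
by move=> E EN; apply: sub_sigma_algebra; right; apply: sub_sigma_algebra; right.
Qed.

Let mpast : measurable_fun setT (id : T -> Past).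
Proof.
apply: measurable_id_generated => E [|].
  exact: measurable_sigma_of.
by apply: measurable_sigma_join; apply: measurable_sigma_of.
Qed.

Let noise o : Rn R n := [tuple eps i o | i < n].

Let mnoise : measurable_fun setT noise.
Proof.
apply/measurable_fun_tnthP => i; rewrite (_ : _ \o _ = (eps i : T -> R)).
  exact: (measurable_funPT (eps i)).
by apply/funext => o /=; rewrite tnth_mktuple.
Qed.

Let past_noise A B : measurable A -> measurable B ->
  P ((id : T -> Past) @^-1` A `&` noise @^-1` B) =
  (P ((id : T -> Past) @^-1` A) * P (noise @^-1` B))%E.
Proof.
move=> mA mB; rewrite preimage_id setIC muleC; apply: eps_N_J_indep => //.
pose G := [set E : set T | exists i B, [/\ [set: 'I_n] i, measurable B &
  E = (eps i : T -> R) @^-1` B]].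
have mG : measurable_fun setT (noise : g_sigma_algebraType G -> Rn R n).
  apply/measurable_fun_tnthP => i; rewrite (_ : _ \o _ = (eps i : T -> R)); last first.
    by apply/funext => o /=; rewrite tnth_mktuple.
  by apply: (@measurable_generated _ _ G _ _ _ setT (fun j => (eps j : T -> R)) i).
by have := mG measurableT B mB; rewrite setTI.
Qed.

Let mean i o := mu * Delta + (drift i o o + beta * vol i o).

Let X := aggregate_return mu Delta beta rho J1 J2 tau gamma (fun i => (eps i : T -> R)).
Let L := marginal_density P mu Delta beta rho J1 J2 tau gamma.

Let XE o : X o = [tuple mean i o + Num.sqrt (vol i o) * tnth (noise o) i | i < n].
Proof.
apply: eq_from_tnth => i; rewrite !tnth_mktuple /mean /drift /vol.
by congr (_ + _); rewrite -!addrA; congr (_ + _); rewrite /time_changed_increment; ring.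
Qed.

Lemma measurable_centered i : measurable_fun setT
  (fun x : Rn R n => tnth (centered mu Delta x) i).
Proof.
under eq_fun do rewrite tnth_mktuple.
by apply: measurable_funB => //; exact: measurable_tnth.
Qed.

Let joint (z : Rn R n * T) := \prod_(i < n) conditional_density beta rho J1 J2 tau gamma i
  (tnth (centered mu Delta z.1) i) z.2.

Let mjoint : measurable_fun setT joint.
Proof.
apply: measurable_prod => i _; apply: measurable_conditional_density.
  exact: (measurableT_comp (measurable_centered i) measurable_fst).
exact: measurable_snd.
Qed.

Let joint_ge0 z : 0 <= joint z.
Proof. by apply: prodr_ge0 => i _; exact: conditional_density_ge0. Qed.

(** Given the clocks and the jumps, the returns form a Gaussian vector whose
    density is the product of the conditional densities; [decoupling_ge0]
    integrates out the noise first, Tonelli exchanges the two integrals. *)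
Lemma marginal_density_correct : is_density_of P X L.
Proof.
have mL : measurable_fun setT L.
  apply: (@measurable_fun_fubini_tonelli_F _ _ _ _ _ P (fun z => (joint z)%:E)).
    exact/measurable_EFinP.
  by move=> z; rewrite lee_fin joint_ge0.
pose G (z : Past * Rn R n) : Rn R n :=
  [tuple mean i z.1 + Num.sqrt (vol i z.1) * tnth z.2 i | i < n].
have mvolp i : measurable_fun setT (vol i : Past -> R).
  exact: (measurable_funD (measurable_tau (pN := fun o : Past => o) pastN i)
    (measurable_gamma (pN := fun o : Past => o) pastN i)).
have mmean i : measurable_fun setT (mean i : Past -> R).
  apply: measurable_funD => //; apply: measurable_funD; last exact: measurable_funM.
  exact: (measurable_drift (pN := fun o : Past => o) (pJ := fun o : Past => o) pastN pastJ1 pastJ2).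
have mG : measurable_fun setT G.
  apply/measurable_fun_tnthP => i; rewrite (_ : _ \o _ = fun z : Past * Rn R n =>
      mean i z.1 + Num.sqrt (vol i z.1) * tnth z.2 i); last first.
    by apply/funext => o /=; rewrite tnth_mktuple.
  apply: measurable_funD; first exact: (measurableT_comp (mmean i) measurable_fst).
  apply: measurable_funM.
    apply: (measurableT_comp measurable_sqrtr).
    exact: (measurableT_comp (mvolp i) measurable_fst).
  exact: (measurableT_comp (measurable_tnth i) measurable_snd).
have mpn : measurable_fun setT (fun o => ((id : T -> Past) o, noise o)).
  exact: (measurable_fun_pair mpast mnoise).
have XG : X = G \o (fun o => (o, noise o)) by apply/funext => o; exact: XE.
have mX : measurable_fun setT X by rewrite XG; exact: measurableT_comp.
split => // B mB.
have mXB : measurable (X @^-1` B) by rewrite -[X in measurable X]setTI; exact: mX.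
pose F (z : Past * Rn R n) : \bar R := (\1_B (G z))%:E.
have mF : measurable_fun setT F.
  by apply/measurable_EFinP; apply: measurableT_comp => //; exact: measurable_indic.
transitivity (\int[P]_o F ((id : T -> Past) o, noise o))%E.
  rewrite -[X @^-1` B]setIT -integral_indic//; apply: eq_integral => o _.
  have -> : F (o, noise o) = (\1_B (X o))%:E by rewrite XE.
  by rewrite !indicE.
rewrite (decoupling_ge0 mpast mnoise past_noise mF); last by move=> z; rewrite lee_fin.
have mF2 : measurable_fun setT (fun z : T * T => F (z.1, noise z.2)).
  apply: (measurableT_comp mF); apply: measurable_fun_pair.
    exact: (measurableT_comp mpast measurable_fst).
  exact: (measurableT_comp mnoise measurable_snd).
pose D (z : Rn R n * T) := (\1_B z.1 * joint z)%:E.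
have mD : measurable_fun setT D.
  apply/measurable_EFinP; apply: measurable_funM => //.
  by apply: measurableT_comp => //; exact: measurable_indic.
have D0 z : (0 <= D z)%E by rewrite lee_fin mulr_ge0.
transitivity (\int[P]_o \int[lebesgue_rn R n]_x D (x, o))%E.
  apply: ae_eq_integral => //.
  - apply: (@measurable_fun_fubini_tonelli_F _ _ _ _ _ P
      (fun z : T * T => F (z.1, noise z.2))) => //.
    by move=> z; rewrite lee_fin.
  - exact: (@measurable_fun_fubini_tonelli_G _ _ _ _ _ (lebesgue_rn R n) D).
  apply: filterS clocks_finite => o [v0 _] _.
  have indX : box_independent P (fun i => eps i : T -> measurableTypeR R).
    move=> C mC; apply: (eps_indep (E := fun i => eps i @^-1` C i)) => i.
    by apply: sub_sigma_algebra; exists i, (C i); split => //; exact: mC.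
  have := gaussian_sample_law (fun i => mean i o) eps_normal indX v0 mB.
  set Y := (fun w => _); have mY : measurable (Y @^-1` B).
    rewrite (_ : Y @^-1` B = (fun w => G (o, noise w)) @^-1` B); last first.
      by congr (_ @^-1` B); apply/funext => w; apply: eq_from_tnth => i;
        rewrite !tnth_mktuple.
    rewrite -[X in measurable X]setTI; apply: (_ : measurable_fun setT _) => //.
    apply: (measurableT_comp mG); exact: (measurable_fun_pair (measurable_cst _) mnoise).
  rewrite -[Y @^-1` B]setIT -integral_indic//.
  have -> : (\int[P]_w (\1_(Y @^-1` B) w)%:E = \int[P]_w F (o, noise w))%E.
    apply: eq_integral => w _; rewrite /F; congr (\1_B _)%:E.
    by apply: eq_from_tnth => i; rewrite !tnth_mktuple.
  move=> ->; rewrite integral_mkcond; apply: eq_integral => x _.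
  rewrite patchE /D indicE; case: (x \in B); last by rewrite mul0r.
  rewrite mul1r; congr _%:E; apply: eq_bigr => i _.
  rewrite conditional_density_npdf// tnth_mktuple; congr (npdf _ _).
  by rewrite /mean; ring.
rewrite -(fubini_tonelli D)//= [RHS]integral_mkcond; apply: eq_integral => x _.
rewrite patchE /L /marginal_density; under eq_integral do rewrite /D/=.
rewrite indicE; case: (x \in B); first by under eq_integral do rewrite mul1r.
by under eq_integral do rewrite mul0r; rewrite integral0.
Qed.

End density.

Section fourier_transform.
Variables (psi1 psi2 : R[i] -> R[i]).
Hypotheses (J1_psi : laplace_exponent P J1 psi1) (J2_psi : laplace_exponent P J2 psi2)
  (J1_beta : exponential_moment P J1 beta) (J2_beta : exponential_moment P J2 beta)
  (J1_J2_indep : independent P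
     (sigma_of [set t | 0 <= t] J1) (sigma_of [set t | 0 <= t] J2))
  (J_N_indep : independent P
     (sigma_join (sigma_of [set t | 0 <= t] J1) (sigma_of [set t | 0 <= t] J2))
     (sigma_random_measure N)).

Let genJ (J : R -> T -> R) := [set E : set T | exists t B,
  [/\ [set t | 0 <= t] t, measurable B & E = J t @^-1` B]].
Let TJ1 := g_sigma_algebraType (genJ J1).
Let TJ2 := g_sigma_algebraType (genJ J2).
Let genJJ := sigma_of [set t | 0 <= t] J1 `|` sigma_of [set t | 0 <= t] J2.
Let TJ := g_sigma_algebraType genJJ.
Let genN := [set E : set T | exists U B,
  [/\ measurable U, measurable B & E = (fun o => N o U) @^-1` B]].
Let TN := g_sigma_algebraType genN.

Let mid1 : measurable_fun setT (id : T -> TJ1).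
Proof.
apply: measurable_id_generated => E EJ.
by apply: (measurable_sigma_of (D := [set t | 0 <= t]) (f := J1)) => //; exact: sub_sigma_algebra.
Qed.

Let mid2 : measurable_fun setT (id : T -> TJ2).
Proof.
apply: measurable_id_generated => E EJ.
by apply: (measurable_sigma_of (D := [set t | 0 <= t]) (f := J2)) => //; exact: sub_sigma_algebra.
Qed.

Let midJ : measurable_fun setT (id : T -> TJ).
Proof. by apply: measurable_id_generated => E [|]; apply: measurable_sigma_of. Qed.

Let midN : measurable_fun setT (id : T -> TN).
Proof.
apply: measurable_id_generated => E EN.
apply: (measurable_sigma_of (D := measurable) (f := fun U o => N o U)) => //.
exact: sub_sigma_algebra.
Qed.

Let om (y : Rn R n) i : R[i] := beta%:C + 'i * (tnth y i)%:C.

Let Re_om y i : complex.Re (om y i) = beta.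
Proof. by rewrite ReD ReM/= mul0r mul1r subrr addr0. Qed.

Let Im_om y i : complex.Im (om y i) = tnth y i.
Proof. by rewrite ImD ImM/= mul0r mul1r !add0r. Qed.

(** The set of zeros of vol is a null event; the value 1 there makes the
    variances positive everywhere, as a mixture of densities requires. *)
Definition variance i o : R := vol i o + \1_[set 0] (vol i o).

Lemma variance_gt0 i o : 0 < variance i o.
Proof.
have := vol_ge0 i o; rewrite le_eqVlt /variance indicE => /orP[/eqP <-|v0].
  by rewrite add0r mem_set.
by rewrite memNset ?addr0//= => v00; rewrite v00 ltxx in v0.
Qed.

Lemma variance_vol i o : 0 < vol i o -> variance i o = vol i o.
Proof.
by move=> v0; rewrite /variance indicE memNset ?addr0//= => v00; rewrite v00 ltxx in v0.
Qed.

Let mvariance d' (Z : measurableType d') (p : Z -> T) i :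
  measurable_fun setT (fun z => vol i (p z)) -> measurable_fun setT (fun z => variance i (p z)).
Proof.
move=> mv; apply: measurable_funD => //; apply: (measurableT_comp _ mv).
exact: measurable_indic.
Qed.

Let phase y (oN oJ : T) : R[i] := \prod_(i < n) cexp (- om y i * (drift i oN oJ)%:C -
  ((beta ^+ 2 + tnth y i ^+ 2) / 2 * variance i oN)%:C).

Let weight2 (oN oJ : T) : R :=
  \prod_(i < n) expR (- (beta * drift i oN oJ) - variance i oN * beta ^+ 2 / 2).

(** The factor by which a product of conditional densities at A differs from
    exp(n Abar beta) times Gaussian densities with means [drift]. *)
Definition weight o := weight2 o o.

Let TNJ1 t : 0 <= t -> measurable_fun setT (fun z : TN * TJ => J1 t z.2).
Proof.
move=> t0; have mJ : measurable_fun setT (J1 t : TJ -> R).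
  apply: (@measurable_generated _ _ genJJ _ _ _ [set t | 0 <= t] J1 _ t0).
  by move=> E EN; apply: sub_sigma_algebra; left.
exact: (measurableT_comp mJ measurable_snd).
Qed.

Let TNJ2 t : 0 <= t -> measurable_fun setT (fun z : TN * TJ => J2 t z.2).
Proof.
move=> t0; have mJ : measurable_fun setT (J2 t : TJ -> R).
  apply: (@measurable_generated _ _ genJJ _ _ _ [set t | 0 <= t] J2 _ t0).
  by move=> E EN; apply: sub_sigma_algebra; right.
exact: (measurableT_comp mJ measurable_snd).
Qed.

Let TNN U : measurable U -> measurable_fun setT (fun z : TN * TJ => N z.1 U).
Proof.
move=> mU; have mN' : measurable_fun setT (fun o : TN => N o U).
  exact: (@measurable_generated _ _ genN _ _ _ measurable (fun U o => N o U) _ mU).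
exact: (measurableT_comp mN' measurable_fst).
Qed.

Let mdrift2 i : measurable_fun setT (fun z : TN * TJ => drift i z.1 z.2).
Proof. exact: (measurable_drift TNN TNJ1 TNJ2). Qed.

Let mvariance2 i : measurable_fun setT (fun z : TN * TJ => variance i z.1).
Proof.
apply: mvariance; exact: (measurable_funD (measurable_tau TNN i) (measurable_gamma TNN i)).
Qed.

Let mphase y : cmeasurable (fun z : TN * TJ => phase y z.1 z.2).
Proof.
apply: cmeasurable_prod => i; apply: cmeasurable_exp; apply: cmeasurableD.
  by apply: cmeasurableM; [exact: cmeasurable_cst|exact: cmeasurable_real].
by apply: cmeasurableN; apply: cmeasurable_real; exact: measurable_funM.
Qed.

Let mweight2 : measurable_fun setT (fun z : TN * TJ => weight2 z.1 z.2).
Proof.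
apply: measurable_prod => i _; apply: measurableT_comp => //.
apply: measurable_funB.
  by apply: measurableT_comp => //; exact: measurable_funM.
by apply: measurable_funM => //; exact: measurable_funM.
Qed.

Let mdiag : measurable_fun setT (fun o => ((id : T -> TN) o, (id : T -> TJ) o)).
Proof. exact: (measurable_fun_pair midN midJ). Qed.

Lemma measurable_weight : measurable_fun setT weight.
Proof. exact: (measurableT_comp mweight2 mdiag). Qed.

Lemma weight_ge0 o : 0 <= weight o.
Proof. by apply: prodr_ge0 => i _; exact: expR_ge0. Qed.

Lemma measurable_variance i : measurable_fun setT (variance i).
Proof. exact: mvariance. Qed.

Lemma measurable_diagonal_drift i : measurable_fun setT (fun o => drift i o o).
Proof. exact: (measurable_drift (pN := fun o => o) (pJ := fun o => o) mN mJ1 mJ2). Qed.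

Let normc_phase_le y oN oJ : normc (phase y oN oJ) <= weight2 oN oJ.
Proof.
rewrite normc_prod; apply: ler_prod => i _; rewrite normc_ge0 normc_cexp ler_expR.
rewrite ReD ReN ReM ReN Re_om/= mulr0 subr0 mulNr lerD2l lerN2.
rewrite -subr_ge0 [X in 0 <= X](_ : _ = variance i oN * tnth y i ^+ 2 / 2); last by field.
by rewrite divr_ge0// mulr_ge0 ?sqr_ge0// ltW// variance_gt0.
Qed.

Let y0 : Rn R n := [tuple (0 : R) | i < n].

Let phase0 oN oJ : phase y0 oN oJ = (weight2 oN oJ)%:C.
Proof.
rewrite /weight2 (rmorph_prod (real_complex R)); apply: eq_bigr => i _.
rewrite -[RHS]cexp_real; congr cexp; apply: complex_eqP.
  by rewrite ReD ReN ReM ReN Re_om/= tnth_mktuple; ring.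
by rewrite ImD ImN ImM ImN Im_om/= tnth_mktuple; ring.
Qed.

Let drifts y oN : R[i] := \prod_(i < n) cexp (- om y i * (rho * gamma i oN)%:C -
  ((beta ^+ 2 + tnth y i ^+ 2) / 2 * variance i oN)%:C).

(** For frozen clocks only the two independent jump processes are random, and the
    Laplace exponents apply to their increments. *)
Let phase_transform y oN :
  cintegrable P (phase y oN) /\
  cintegral P (phase y oN) = drifts y oN *
    ((\prod_(i < n) cexp (- (tau i oN)%:C * psi1 (om y i))) *
     (\prod_(i < n) cexp (- (gamma i oN)%:C * psi2 (om y i)))).
Proof.
pose F (J : R -> T -> R) (c : 'I_n -> R) (o : T) := \prod_(i < n)
  cexp (- om y i * (time_changed_increment J (fun i _ => c i) i o)%:C).
have [i1 e1] := increments_transform J1_levy J1_psi J1_beta (fun i => tau_ge0 i oN) (Re_om y).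
have [i2 e2] := increments_transform J2_levy J2_psi J2_beta (fun i => gamma_ge0 i oN) (Re_om y).
have m1 (J : R -> T -> R) (c : 'I_n -> R) : levy_process P J -> (forall i, 0 <= c i) ->
    cmeasurable (F J c : g_sigma_algebraType (genJ J) -> R[i]).
  move=> [_ _ _ _ rc] c0; apply: cmeasurable_prod => i; apply: cmeasurable_exp.
  apply: cmeasurableM; first exact: cmeasurable_cst.
  apply: cmeasurable_real; apply: measurable_time_changed_increment => // [t t0|z t t0].
    exact: (@measurable_generated _ _ (genJ J) _ _ _ [set t | 0 <= t] J _ t0).
  exact: (rc z t t0).1.
have ind12 A B : measurable A -> measurable B ->
    P ((id : T -> TJ1) @^-1` A `&` (id : T -> TJ2) @^-1` B) =
    (P ((id : T -> TJ1) @^-1` A) * P ((id : T -> TJ2) @^-1` B))%E.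
  by move=> mA mB; rewrite !preimage_id; exact: J1_J2_indep.
have [i3 e3] := decoupling_tensor mid1 mid2 ind12 (m1 _ _ J1_levy (fun i => tau_ge0 i oN))
  (m1 _ _ J2_levy (fun i => gamma_ge0 i oN)) i1 i2.
have E oJ : phase y oN oJ = drifts y oN *
    (F J1 (fun i => tau i oN) oJ * F J2 (fun i => gamma i oN) oJ).
  rewrite -!big_split/=; apply: eq_bigr => i _; rewrite -!cexpD; congr cexp.
  by rewrite /drift !(rmorphD (real_complex R)); ring.
split; first by rewrite (funext E); exact: cintegrableZ.
by rewrite (eq_cintegral _ E) (cintegralZ _ i3) e3 e1 e2.
Qed.

Let f (y : Rn R n) x := Omega_n psi1 beta h y x + Upsilon_n psi2 beta rho g y x.

Lemma exponent_kernel_integral : {ae P, forall o, forall y,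
  cintegrable (N o) (f y) /\
  cintegral (N o) (f y) =
    \sum_(i < n) ((psi1 (om y i) + ((beta ^+ 2 + tnth y i ^+ 2) / 2)%:C) * (tau i o)%:C +
      (psi2 (om y i) + rho%:C * om y i + ((beta ^+ 2 + tnth y i ^+ 2) / 2)%:C) *
      (gamma i o)%:C)}.
Proof.
apply: filterS clocks_finite => o [_ fin] y.
have ih i : cintegrable (N o) (fun x => (h i x)%:C).
  by split; [exact: (fin i).1|exact: integrable0].
have ig i : cintegrable (N o) (fun x => (g i x)%:C).
  by split; [exact: (fin i).2|exact: integrable0].
have iO : cintegrable (N o) (Omega_n psi1 beta h y).
  by apply: cintegrable_sum => i; exact: cintegrableZ.
have iU : cintegrable (N o) (Upsilon_n psi2 beta rho g y).
  by apply: cintegrable_sum => i; exact: cintegrableZ.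
split; first exact: cintegrableD.
rewrite cintegralD// big_split/=; congr (_ + _).
  rewrite cintegral_sum; last by move=> i; exact: cintegrableZ.
  by apply: eq_bigr => i _; rewrite cintegralZ// cintegral_real.
rewrite cintegral_sum; last by move=> i; exact: cintegrableZ.
by apply: eq_bigr => i _; rewrite cintegralZ// cintegral_real.
Qed.

Let phase_laplace : {ae P, forall o, forall y,
  cintegral P (phase y o) = cexp (- cintegral (N o) (f y))}.
Proof.
apply: filterS (filterI exponent_kernel_integral clocks_finite) => o [Nf [v0 _]] y.
rewrite (phase_transform y o).2 (Nf y).2 -!big_split/= -sumrN cexp_sum.
apply: eq_bigr => i _; rewrite -!cexpD variance_vol//; congr cexp.
rewrite /vol !(rmorphM (real_complex R)) !(rmorphD (real_complex R)); ring.
Qed.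

Let N_J_indep A B : measurable A -> measurable B ->
  P ((id : T -> TN) @^-1` A `&` (id : T -> TJ) @^-1` B) =
  (P ((id : T -> TN) @^-1` A) * P ((id : T -> TJ) @^-1` B))%E.
Proof. by move=> mA mB; rewrite !preimage_id setIC muleC; exact: J_N_indep. Qed.

Hypothesis laplace_finite : forall y,
  cintegrable P (fun o => cexp (- cintegral (N o) (f y))).

(** At y = 0 the phase is the weight itself, so that its mean is the transform at
    0, finite by hypothesis. *)
Lemma integrable_weight : P.-integrable setT (EFin \o weight).
Proof.
have mw2 : measurable_fun setT (fun z : TN * TJ => (weight2 z.1 z.2)%:E).
  exact/measurable_EFinP.
have w20 (z : TN * TJ) : (0 <= (weight2 z.1 z.2)%:E)%E.
  by rewrite lee_fin; apply: prodr_ge0 => i _; exact: expR_ge0.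
apply/integrableP; split; first exact/measurable_EFinP/measurable_weight.
rewrite (eq_integral (fun o => (weight2 o o)%:E)); last first.
  by move=> o _; rewrite /= ger0_norm// weight_ge0.
have -> : (\int[P]_o (weight2 o o)%:E = \int[P]_oN \int[P]_oJ (weight2 oN oJ)%:E)%E.
  exact: (decoupling_ge0 midN midJ N_J_indep mw2 w20).
have mF : measurable_fun setT (fun z : T * T => (weight2 z.1 z.2)%:E).
  apply: (measurableT_comp mw2 (g := fun z : T * T => ((z.1, z.2) : TN * TJ))).
  exact: (measurable_fun_pair (measurableT_comp midN measurable_fst)
    (measurableT_comp midJ measurable_snd)).
have [ReL _] := laplace_finite y0.
have -> : (\int[P]_oN \int[P]_oJ (weight2 oN oJ)%:E =
    \int[P]_oN (complex.Re (cexp (- cintegral (N oN) (f y0))))%:E)%E.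
  apply: ae_eq_integral => //.
  - exact: (@measurable_fun_fubini_tonelli_F _ _ _ _ _ P (fun z : T * T => (weight2 z.1 z.2)%:E)).
  - by have /integrableP[] := ReL.
  apply: filterS phase_laplace => oN pN _.
  rewrite -(pN y0); have [[i1 _] _] := phase_transform y0 oN.
  have i1' : P.-integrable setT (fun oJ => (weight2 oN oJ)%:E).
    by move: i1; congr (integrable _ _ _); apply/funext => oJ; rewrite phase0.
  rewrite -(fineK (integrable_fin_num measurableT i1')); congr _%:E.
  by apply: eq_Rintegral => oJ _; rewrite phase0.
have := integrable_fin_num measurableT ReL.
by rewrite fin_num_abs; apply: le_lt_trans; rewrite lee_abs.
Qed.

(** The jumps are averaged first, for frozen clocks. *)
Lemma mixture_fourier_laplace y :
  mixture_fourier P weight (fun i o => drift i o o) variance y =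
  cintegral P (fun o => cexp (- cintegral (N o) (f y))).
Proof.
transitivity (cintegral P (fun o => phase y o o)).
  apply: eq_cintegral => o; rewrite /weight /weight2 (rmorph_prod (real_complex R)).
  rewrite -big_split/=; apply: eq_bigr => i _; rewrite -cexp_real -cexpD; congr cexp.
  apply: complex_eqP.
    by rewrite !ReD ReN ReM ReN Re_om/=; ring.
  by rewrite !ImD ImN ImM ImN Im_om/= ?ReN ?Re_om; ring.
have iF : cintegrable P (fun o => phase y o o).
  apply: (cintegrable_le (g := weight)).
  - exact: (cmeasurable_comp (mphase y) mdiag).
  - exact: integrable_weight.
  - by move=> o; exact: normc_phase_le.
have [i2 e2] := decoupling_complex midN midJ N_J_indep (mphase y) iF.
rewrite [LHS]e2; apply: ae_eq_cintegral.
- exact: cintegrable_cmeasurable i2.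
- exact: cintegrable_cmeasurable (laplace_finite y).
- by apply: filterS phase_laplace => o ->.
Qed.

Lemma marginal_density_mixture (mu Delta : R) x : (0 < n)%N ->
  marginal_density P mu Delta beta rho J1 J2 tau gamma x =
  ((expR (n%:R * sample_mean (centered mu Delta x) * beta))%:E *
   mixture P weight (fun i o => drift i o o) variance 0 (centered mu Delta x))%E.
Proof.
move=> n0; set A := centered mu Delta x.
have mm : measurable_fun setT
    (fun o => mixand weight (fun i o => drift i o o) variance 0 A o).
  have mA := measurable_mixand measurable_weight measurable_diagonal_drift measurable_variance 0.
  exact: (measurableT_comp mA (measurable_pair1 A)).
have mm0 o : 0 <= mixand weight (fun i o => drift i o o) variance 0 A o.
  by apply: mixand_ge0 => // o'; exact: weight_ge0.
rewrite /mixture -ge0_integralZl//; last first.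
- by move=> o _; rewrite lee_fin.
- exact/measurable_EFinP.
apply: ae_eq_integral => //.
- apply/measurable_EFinP; apply: measurable_prod => i _.
  by apply: measurable_conditional_density => //; exact: measurable_cst.
- by apply: measurable_funeM; exact/measurable_EFinP.
apply: filterS clocks_finite => o [v0 _] _; rewrite -EFinM; congr _%:E.
rewrite /mixand mulrA.
have -> : n%:R * sample_mean A * beta = \sum_(i < n) tnth A i * beta.
  by rewrite /sample_mean mulrA mulfV ?pnatr_eq0 -?lt0n// mul1r mulr_suml.
rewrite expR_sum /weight /weight2 -!big_split/=; apply: eq_bigr => i _.
rewrite conditional_densityE variance_vol// addr0 -expRD; congr (expR _ * _); ring.
Qed.

End fourier_transform.

End returns.

Theorem theorem2p1 (R : realType)
  (d : measure_display) (T : measurableType d) (P : probability T R)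
  (V : completeMetricType R) (V_separable : separable V)
  (N : R.-ker T ~> borel V) (N_bfin : boundedly_finite N)
  (n : nat) (n_ge1 : (1 <= n)%N)
  (r q alpha beta Delta : R) (Delta_gt0 : 0 < Delta)
  (h g : 'I_n -> borel V -> R)
  (h_meas : forall i, measurable_fun setT (h i))
  (g_meas : forall i, measurable_fun setT (g i))
  (h_ge0 : forall i x, 0 <= h i x) (g_ge0 : forall i x, 0 <= g i x)
  (taus_fin : {ae P, forall o, forall i,
     (0 < \int[N o]_x (h i x + g i x)%:E)%E /\
     (\int[N o]_x (h i x + g i x)%:E < +oo)%E})
  (J1 J2 : R -> T -> R)
  (J1_levy : levy_process P J1) (J2_levy : levy_process P J2)
  (J1_pure : pure_jump P J1) (J2_pure : pure_jump P J2)
  (psi1 psi2 : R[i] -> R[i])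
  (J1_psi : laplace_exponent P J1 psi1) (J2_psi : laplace_exponent P J2 psi2)
  (J1_beta : exponential_moment P J1 beta)
  (J2_beta : exponential_moment P J2 beta)
  (eps : 'I_n -> {RV P >-> R})
  (eps_normal : forall i (B : set R), measurable B ->
     distribution P (eps i) B = normal_prob 0 1 B)
  (eps_indep : mutually_independent P
     (fun i => sigma_of [set i] (fun j : 'I_n => (eps j : T -> R))))
  (J1_J2_indep : independent P
     (sigma_of [set t | 0 <= t] J1) (sigma_of [set t | 0 <= t] J2))
  (J_N_indep : independent P
     (sigma_join (sigma_of [set t | 0 <= t] J1) (sigma_of [set t | 0 <= t] J2))
     (sigma_random_measure N))
  (eps_N_J_indep : independent P
     (sigma_of setT (fun j : 'I_n => (eps j : T -> R)))
     (sigma_join (sigma_random_measure N)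
        (sigma_join (sigma_of [set t | 0 <= t] J1)
                    (sigma_of [set t | 0 <= t] J2)))) :
  let mu := r - q in
  let rho := alpha - beta in
  let tau := fun i => rm_integral N (h i) in
  let gamma := fun i => rm_integral N (g i) in
  let X := aggregate_return mu Delta beta rho J1 J2 tau gamma
             (fun i => (eps i : T -> R)) in
  let L := marginal_density P mu Delta beta rho J1 J2 tau gamma in
  let f := fun y x => Omega_n psi1 beta h y x + Upsilon_n psi2 beta rho g y x in
  [/\ is_density_of P X L,
      forall nu : {measure set (borel V) -> \bar R},
        poisson_random_measure P N nu ->
        (forall y, cintegrable nu (fun x => 1 - cexp (- f y x))) ->
        likelihood_formula mu Delta beta L
          (fun y => cexp (- cintegral nu (fun x => 1 - cexp (- f y x))))
    & (forall y, cintegrable P (fun o => cexp (- cintegral (N o) (f y)))) ->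
        likelihood_formula mu Delta beta L
          (fun y => cintegral P (fun o => cexp (- cintegral (N o) (f y))))].
Proof.
move=> mu rho tau gamma X L f.
have N_formula : (forall y, cintegrable P (fun o => cexp (- cintegral (N o) (f y)))) ->
    likelihood_formula mu Delta beta L
      (fun y => cintegral P (fun o => cexp (- cintegral (N o) (f y)))).
  move=> fin.
  apply: (likelihood_of_mixture n_ge1 (w := weight N beta rho h g J1 J2)
    (m := fun i o => drift N rho h g J1 J2 i o o) (s := variance N h g)).
  - exact: (measurable_weight (P := P)).
  - exact: weight_ge0.
  - exact: (integrable_weight h_meas g_meas h_ge0 g_ge0 taus_fin J1_levy J2_levy
      J1_psi J2_psi J1_beta J2_beta J1_J2_indep J_N_indep fin).
  - exact: (measurable_diagonal_drift (P := P)).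
  - exact: measurable_variance.
  - exact: variance_gt0.
  - by move=> x; apply: (marginal_density_mixture (P := P)).
  - move=> y; apply/esym.
    exact: (mixture_fourier_laplace h_meas g_meas h_ge0 g_ge0 taus_fin J1_levy J2_levy
      J1_psi J2_psi J1_beta J2_beta J1_J2_indep J_N_indep fin).
split.
- exact: (marginal_density_correct beta rho h_meas g_meas h_ge0 g_ge0 taus_fin
    J1_levy J2_levy mu Delta eps_normal eps_indep eps_N_J_indep).
- move=> nu N_poisson fnu.
  have mf y : cmeasurable (f y).
    by apply: cmeasurableD; apply: cmeasurable_sum => i;
      apply: cmeasurableM; (exact: cmeasurable_cst || exact: cmeasurable_real).
  have laplace y : laplace_at P N nu (f y).
    apply: (poisson_laplace N_poisson (mf y) _ (fnu y)).
    apply: filterS (exponent_kernel_integral beta rho h_meas g_meas h_ge0 g_ge0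
      taus_fin psi1 psi2) => o.
    by move=> /(_ y)[].
  rewrite (_ : (fun y => _) = (fun y => cintegral P (fun o => cexp (- cintegral (N o) (f y))))).
    by apply: N_formula => y; exact: (laplace y).1.
  by apply/funext => y; rewrite (laplace y).2.
- exact: N_formula.
Qed.
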